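(* Let $n$ be a nonnegative integer and suppose $bcd=aq$ and $de=a^2q^{3n+1}$. If $f=a/b$ or $f=a/e$, then \begin{multline*} \sum_{k=0}^n \frac{E(aq^{4k})}{E(a)} \frac{(b,c;q,p)_k}{(aq^3/b,aq^3/c;q^3,p)_k} \frac{(d;q,p)_{2k}}{(aq/d;q,p)_{2k}} \frac{(e,q^{-3n};q^3,p)_k}{(aq/e,aq^{3n+1};q,p)_k}\, q^k \\ =\frac{(aq^3,a^2q^3/bce,a^2q^3/bdef,afq^3/cd;q^3,p)_n} {(a^2q^3/bef,afq^3/c,aq^3/d,a^2q^3/bcde;q^3,p)_n} \,{_{10}\omega_9}(af/c;a/c,fq^3/c,bef/a,d,dq,f,q^{-3n};q^3,p). \end{multline*}
   Context: Let $p$ be a complex number with $|p|<1$, $q$ a nonzero complex number, and all parameters generic so that no denominator vanishes. For nonzero $x$, $E(x)=E(x;p)=\prod_{k\ge 0}(1-xp^k)(1-p^{k+1}/x)$. For a nonzero base $Q$ and integer $m$, $(a;Q,p)_m=\prod_{k=0}^{m-1}E(aQ^k)$ if $m>0$, $=1$ if $m=0$, and $=1/\prod_{k=0}^{-m-1}E(aQ^{m+k})$ if $m<0$; $(a_1,\dots,a_s;Q,p)_m=\prod_{i=1}^s(a_i;Q,p)_m$. For parameters with $(a_4\cdots a_{r+1})^2=a_1^{r-3}Q^{r-5}$ and one of $a_4,\dots,a_{r+1}$ of the form $Q^{-N}$ ($N$ a nonnegative integer), \[{_{r+1}\omega_r}(a_1;a_4,\dots,a_{r+1};Q,p)=\sum_{k\ge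 0}\frac{E(a_1Q^{2k})}{E(a_1)}\frac{(a_1,a_4,\dots,a_{r+1};Q,p)_k\,Q^k}{(Q,a_1Q/a_4,\dots,a_1Q/a_{r+1};Q,p)_k}.\] *)

(* Defs.v *)
From HB Require Import structures.
From mathcomp Require Import all_boot all_order all_algebra.
From mathcomp Require Import all_classical all_reals all_analysis.
From mathcomp Require Import complex.
Set Implicit Arguments. Unset Strict Implicit. Unset Printing Implicit Defensive.
Import Order.TTheory GRing.Theory Num.Theory.
Import numFieldTopology.Exports numFieldNormedType.Exports.
Local Open Scope ring_scope.
Local Open Scope complex_scope.
Local Open Scope classical_set_scope.

HB.instance Definition _ (R : realType) :=
  PseudoPointedMetric.copy (R[i]) (R[i])^o.

Section Elliptic.
Variable R : realType.
Notation C := (R[i]).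

Definition Etheta (p x : C) : C :=
  lim ((fun N : nat => \prod_(k < N) ((1 - x * p ^+ k) * (1 - p ^+ k.+1 / x))) @ \oo).

Definition epoch (p Q a : C) (m : int) : C :=
  match m with
  | Posz n => \prod_(k < n) Etheta p (a * Q ^+ k)
  | Negz n =>
      (\prod_(k < n.+1) Etheta p (a * Q ^ (m + k%:Z)))^-1
  end.

Definition epochs (p Q : C) (s : seq C) (m : int) : C :=
  \prod_(a <- s) epoch p Q a m.

(* Terminating very-well-poised series
   r+1 omega r (a1; a4,...,a_{r+1}; Q, p), where the list [as_] = a4,...,a_{r+1}
   contains Q^{-N}; the terms with k > N vanish (they contain E(1) = 0),
   so the sum is taken over 0 <= k <= N. *)
Definition omega (p Q a1 : C) (as_ : seq C) (N : nat) : C :=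
  \sum_(k < N.+1)
    Etheta p (a1 * Q ^+ (2 * k)) / Etheta p a1
    * epochs p Q (a1 :: as_) k * Q ^+ k
    / epochs p Q (Q :: [seq a1 * Q / ai | ai <- as_]) k.

End Elliptic.

(* Main.v *)
(* Write E for the theta function.  By the Jacobi triple product, for fixed m
   the functions x |-> E(s x) E(s m / x) all lie in one two-dimensional space.
   Hence a sum of products of n such factors behaves like a binary form of
   degree n and is determined by its values at n + 1 points in general position.

   For bc = mu fixed, both sides of the transformation with f = a/b, cleared of
   denominators, are of this kind in b.  At b = a q^(3m), 1 <= m <= n, the
   right-hand sum reduces to one term and the left-hand sum to an instance with
   n - m in place of n; at b = 1 the left-hand sum is its first term and the
   right-hand side is summed by the Frenkel-Turaev formula.  Interpolation and
   induction on n give the case f = a/b.  The Frenkel-Turaev sum is obtained by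
   the same interpolation, it gives the elliptic Bailey transformation of 10 omega 9
   by exchanging two summations, and the latter turns f = a/b into f = a/e.

   These arguments divide by values of E that the hypotheses do not exclude from
   vanishing, so they are carried out for multiplicatively independent (a, b, c);
   such triples approximate every (a, b, c), and both sides are continuous. *)
Require Import Defs.
From HB Require Import structures.
From mathcomp Require Import all_boot all_order all_algebra.
From mathcomp Require Import all_classical all_reals all_analysis.
From mathcomp Require Import complex.
From mathcomp Require Import ring lra zify.
Import Order.TTheory GRing.Theory Num.Theory.
Import numFieldTopology.Exports numFieldNormedType.Exports.
Local Open Scope ring_scope.
Local Open Scope complex_scope.

Set Implicit Arguments. Unset Strict Implicit. Unset Printing Implicit Defensive.

(** * Interpolation of theta functions *)

(** The algebra takes place over an arbitrary field and rests on three properties of [E]: E(1) = 0,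
    E(1/x) = -E(x)/x, and the two-dimensional span. Analysis enters only to supply the span, the
    continuity of [E] and its zeros. With s = 1/y the product E(s x) E(s m / x) is a linear form
    that vanishes at x = y, so zeros at nodes can be divided out one at a time, as for polynomials.
    This is why nodes are separated by two conditions, on E(y/z) and on E(m/(y z)), and why every
    sum is carried with denominators cleared, so that all its terms have the same degree n. The
    perturbation moves a, b, c only: d and e follow from the two balancing conditions, and q stays
    fixed. The values E(q^(3k)), 1 <= k <= n, are therefore nonzero not by genericity but because
    (q^3; q^3)_n is among the assumed denominators. *)

Ltac nz := repeat (apply/andP; split);
  by rewrite ?(mulf_neq0, expf_neq0, invr_neq0, oner_neq0, oppr_eq0).
Ltac ex :=
  rewrite ?[(2 * _)%N]mulnC ?[(3 * _)%N]mulnC ?[(4 * _)%N]mulnC ?[(6 * _)%N]mulnC ?[(8 * _)%N]mulnC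
  -?[_ ^+ 2 ^+ _]exprM -?[_ ^+ 3 ^+ _]exprM
  ?(mulnDl,mulnDr,mulnS,mulSn,addSn,addnS,addnA,muln1,mul1n,muln0,mul0n)
  ?[(2 * _)%N]mulnC ?[(3 * _)%N]mulnC ?[(4 * _)%N]mulnC
  ?(exprMn,exprVn,exprD,exprS,exprM,expr0).
Ltac fld := ex; field; nz.

Section EvenTheta.
Variables (F : fieldType) (E : F -> F).

(* On nonzero arguments, [h] is a binary form of degree [n] in [(u, v)]. *)
Fixpoint homog (u v : F -> F) (n : nat) (h : F -> F) : Prop :=
  if n is n'.+1 then
    exists h1 h2, [/\ homog u v n' h1, homog u v n' h2
                    & forall x : F, x != 0 -> h x = u x * h1 x + v x * h2 x]
  else exists c, forall x : F, x != 0 -> h x = c.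

Lemma homogSP u v n h : homog u v n.+1 h -> exists h1 h2,
  [/\ homog u v n h1, homog u v n h2 & forall x : F, x != 0 -> h x = u x * h1 x + v x * h2 x].
Proof. by []. Qed.

Lemma homog_ext u v n h h' :
  (forall x : F, x != 0 -> h x = h' x) -> homog u v n h -> homog u v n h'.
Proof.
case: n => [|n] hh' /=; first by move=> [c hc]; exists c => x x0; rewrite -hh' ?hc.
by move=> [h1] [h2] [? ? hh]; exists h1, h2; split=> // x x0; rewrite -hh' ?hh.
Qed.

Lemma homogZ u v n c h : homog u v n h -> homog u v n (fun x => c * h x).
Proof.
elim: n h => [|n IHn] h /=; first by move=> [d hd]; exists (c * d) => x /hd ->.
move=> [h1] [h2] [/IHn V1 /IHn V2 hh]; do 2 eexists; split; [exact: V1|exact: V2|].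
by move=> x /hh ->; ring.
Qed.

Lemma homogD u v n h h' : homog u v n h -> homog u v n h' ->
  homog u v n (fun x => h x + h' x).
Proof.
elim: n h h' => [|n IHn] h h' /=.
  by move=> [d hd] [d' hd']; exists (d + d') => x x0; rewrite hd ?hd'.
move=> [h1] [h2] [V1 V2 hh] [h1'] [h2'] [V1' V2' hh'].
do 2 eexists; split; [exact: (IHn _ _ V1 V1')|exact: (IHn _ _ V2 V2')|].
by move=> x x0; rewrite hh ?hh' //; ring.
Qed.

Lemma homogM u v n al be h : homog u v n h ->
  homog u v n.+1 (fun x => (al * u x + be * v x) * h x).
Proof.
move=> Vh; exists (fun x => al * h x), (fun x => be * h x).
by split; [exact: homogZ|exact: homogZ|move=> x _; ring].
Qed.

(** The determinant condition makes the two linear forms a basis replacing (u, v). In a binary form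
    every monomial except the pure power of the second basis element is divisible by the first. *)
Lemma homog_factor u v n h al be al' be' : al * be' - be * al' != 0 ->
  homog u v n.+1 h ->
  exists h' k, homog u v n h' /\
    forall x : F, x != 0 -> h x = (al * u x + be * v x) * h' x
                              + k * (al' * u x + be' * v x) ^+ n.+1.
Proof.
set D := al * be' - be * al' => D0.
have uE x : u x = be' / D * (al * u x + be * v x) - be / D * (al' * u x + be' * v x).
  by rewrite /D; field; exact: D0.
have vE x : v x = - al' / D * (al * u x + be * v x) + al / D * (al' * u x + be' * v x).
  by rewrite /D; field; exact: D0.
elim: n h => [|n IHn] h.
  move=> [h1] [h2] [[c1 hc1] [c2 hc2] hh].
  exists (fun=> be' / D * c1 - al' / D * c2), (- be / D * c1 + al / D * c2); split.
    by exists (be' / D * c1 - al' / D * c2).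
  move=> x x0; rewrite hh // hc1 // hc2 //.
  by rewrite [X in X * c1]uE [X in X * c2]vE; ring.
move=> /homogSP [h1 [h2 [V1 V2 hh]]].
have := homogD (homogZ (- be / D) V1) (homogZ (al / D) V2).
move=> /IHn [h'] [k] [Vh' kE].
exists (fun x => (be' / D * h1 x + - al' / D * h2 x)
                 + (al' * u x + be' * v x) * h' x), k; split.
  by apply: homogD (homogD _ _) (homogM _ _ Vh'); exact: homogZ.
move=> x x0; rewrite hh // [X in X * h1 x]uE [X in X * h2 x]vE.
transitivity ((al * u x + be * v x) * (be' / D * h1 x + - al' / D * h2 x)
  + (al' * u x + be' * v x) * (- be / D * h1 x + al / D * h2 x)); first ring.
by rewrite kE // [in RHS]exprS; ring.
Qed.

Hypothesis E1 : E 1 = 0.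
Hypothesis EV : forall x : F, x != 0 -> E x^-1 = - (E x / x).
Hypothesis Espan : forall m : F, m != 0 -> exists u v, forall s : F, s != 0 ->
  exists al be, forall x : F, x != 0 -> E (s * x) * E (s * m / x) = al * u x + be * v x.

(* Sums of products of [n] theta factors symmetric under [x <-> m / x], as functions of [x]. *)
Inductive etheta (m : F) : nat -> (F -> F) -> Prop :=
| etheta_const c : etheta m 0 (fun=> c)
| etheta_mul s n h : s != 0 -> etheta m n h ->
    etheta m n.+1 (fun x => E (s * x) * E (s * m / x) * h x)
| etheta_add n h1 h2 : etheta m n h1 -> etheta m n h2 ->
    etheta m n (fun x => h1 x + h2 x)
| etheta_ext n h1 h2 : (forall x : F, x != 0 -> h1 x = h2 x) ->
    etheta m n h1 -> etheta m n h2.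

Lemma ethetaZ m n c h : etheta m n h -> etheta m n (fun x => c * h x).
Proof.
move=> Vh; elim: Vh c => {n h} [d|s n h s0 _ IH|n h1 h2 _ IH1 _ IH2|n h1 h2 hh _ IH] c.
- exact: etheta_const.
- by apply: etheta_ext (etheta_mul s0 (IH c)) => x _; ring.
- by apply: etheta_ext (etheta_add (IH1 c) (IH2 c)) => x _; ring.
- by apply: etheta_ext (IH c) => x /hh ->.
Qed.

Lemma etheta_sum m n N (h : nat -> F -> F) :
  (forall j, (j <= N)%N -> etheta m n (h j)) ->
  etheta m n (fun x => \sum_(j < N.+1) h j x).
Proof.
elim: N => [|N IHN] Vh.
  by apply: etheta_ext (Vh 0%N _) => // x _; rewrite big_ord1.
apply: etheta_ext (etheta_add (IHN _) (Vh N.+1 _)) => //; last first.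
  by move=> j jN; apply: Vh; rewrite leqW.
by move=> x _; rewrite [in RHS]big_ord_recr.
Qed.

Lemma etheta_homog m u v n h :
  (forall s : F, s != 0 -> exists al be, forall x : F, x != 0 ->
     E (s * x) * E (s * m / x) = al * u x + be * v x) ->
  etheta m n h -> homog u v n h.
Proof.
move=> uvP; elim=> {n h} [c|s n h s0 _ IH|n h1 h2 _ IH1 _ IH2|n h1 h2 hh _ IH].
- by exists c.
- have [al [be sE]] := uvP s s0.
  by apply: homog_ext (homogM al be IH) => x x0; rewrite sE.
- exact: homogD.
- exact: homog_ext IH.
Qed.

(** Induction on the degree. The linear form with a zero at [pt 0] is divided out, the one with a
    zero at [pt 1] completing the basis; the vanishing of [h] at [pt 0] removes the remaining pure
    power, and the quotient vanishes at the other nodes. *)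
Lemma etheta_eq0 m n h (pt : nat -> F) : m != 0 -> etheta m n h ->
  (forall i, (i <= n)%N -> pt i != 0) ->
  (forall i j, (i < j <= n)%N -> E (pt i / pt j) != 0) ->
  (forall i j, (i < j <= n)%N -> E (m / (pt i * pt j)) != 0) ->
  (forall i, (i <= n)%N -> h (pt i) = 0) ->
  forall x : F, x != 0 -> h x = 0.
Proof.
move=> m0; have [u [v uvP]] := Espan m0.
move=> /(etheta_homog uvP); elim: n h pt => [|n IHn] h pt Vh pt0 Ept Empt hpt x x0.
  by have [c hc] := Vh; rewrite hc // -(hc (pt 0%N)) ?pt0 ?hpt.
have p0 := pt0 0%N isT; have p1 := pt0 1%N isT.
have [al [be ab]] := uvP _ (invr_neq0 p0).
have [al' [be' ab']] := uvP _ (invr_neq0 p1).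
have z00 : al * u (pt 0%N) + be * v (pt 0%N) = 0.
  by rewrite -ab // mulVf // E1 mul0r.
have z11 : al' * u (pt 1%N) + be' * v (pt 1%N) = 0.
  by rewrite -ab' // mulVf // E1 mul0r.
have n01 i : (0 < i <= n.+1)%N -> al * u (pt i) + be * v (pt i) != 0.
  move=> /[dup] i0 /andP[_ /pt0 pi]; rewrite -ab // mulf_neq0 //; last first.
    by have := Empt 0%N i i0; rewrite invfM mulrA [m / _]mulrC.
  have : E (pt 0%N / pt i) != 0 by exact: Ept.
  apply: contra => /eqP H; rewrite -[_ / _]invrK EV ?invf_div.
    by rewrite [pt i / _]mulrC H mul0r oppr0.
  by rewrite mulf_neq0 ?invr_neq0.
have n10 : al' * u (pt 0%N) + be' * v (pt 0%N) != 0.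
  rewrite -ab' // mulf_neq0 //; first by rewrite mulrC; exact: Ept.
  by have := Empt 0%N 1%N isT; rewrite [_ * pt 1%N]mulrC invfM mulrA [m / _]mulrC.
have D0 : al * be' - be * al' != 0.
  apply/eqP => D0; move/eqP: (mulf_neq0 (n01 1%N isT) n10); apply.
  (* For linear forms L, L' and points x, y, the difference L(y) L'(x) - L(x) L'(y) is the
     determinant of the forms times that of the points. Here L(x) = L'(y) = 0 while L(y) L'(x) is
     nonzero. *)
  transitivity ((al * be' - be * al') * (u (pt 1%N) * v (pt 0%N) - v (pt 1%N) * u (pt 0%N))
    + (al * u (pt 0%N) + be * v (pt 0%N)) * (al' * u (pt 1%N) + be' * v (pt 1%N))).
    by ring.
  by rewrite D0 z00 !mul0r addr0.
have [h' [k [Vh' hE]]] := homog_factor D0 Vh.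
have k0 : k = 0.
  have := hpt 0%N isT; rewrite hE // z00 mul0r add0r => /eqP.
  by rewrite mulf_eq0 expf_eq0 /= (negPf n10) orbF => /eqP.
rewrite hE // k0 mul0r addr0 (IHn h' (fun i => pt i.+1)) ?mulr0 //.
- by move=> i i_n; apply: pt0.
- by move=> i j i_j; apply: Ept.
- by move=> i j i_j; apply: Empt.
move=> i i_n; have := hpt i.+1 i_n; rewrite hE ?pt0 // k0 mul0r addr0 => /eqP.
by rewrite mulf_eq0 (negPf (n01 i.+1 _)) //= => /eqP.
Qed.

Lemma etheta_interp m n h1 h2 (pt : nat -> F) : m != 0 ->
  etheta m n h1 -> etheta m n h2 ->
  (forall i, (i <= n)%N -> pt i != 0) ->
  (forall i j, (i < j <= n)%N -> E (pt i / pt j) != 0) ->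
  (forall i j, (i < j <= n)%N -> E (m / (pt i * pt j)) != 0) ->
  (forall i, (i <= n)%N -> h1 (pt i) = h2 (pt i)) ->
  forall x : F, x != 0 -> h1 x = h2 x.
Proof.
move=> m0 V1 V2 pt0 Ept Empt hpt x x0.
have V12 := etheta_add V1 (ethetaZ (-1) V2).
have := etheta_eq0 m0 V12 pt0 Ept Empt _ x0.
rewrite mulN1r => /(_ _)/subr0_eq; apply=> i i_n.
by rewrite hpt // mulN1r subrr.
Qed.

(** * Theta-shifted factorials *)

Definition poch (Q a : F) (n : nat) := \prod_(k < n) E (a * Q ^+ k).

Lemma poch0 Q a : poch Q a 0 = 1. Proof. exact: big_ord0. Qed.

Lemma pochS Q a n : poch Q a n.+1 = poch Q a n * E (a * Q ^+ n).
Proof. exact: big_ord_recr. Qed.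

Lemma pochD Q a m n : poch Q a (m + n) = poch Q a m * poch Q (a * Q ^+ m) n.
Proof.
elim: n => [|n IHn]; first by rewrite addn0 poch0 mulr1.
by rewrite addnS !pochS IHn exprD !mulrA.
Qed.

Lemma pochB Q a n j : (j <= n)%N -> poch Q a n = poch Q a j * poch Q (a * Q ^+ j) (n - j).
Proof. by move=> jn; rewrite -pochD subnKC. Qed.

Lemma pochSl Q a n : poch Q a n.+1 = E a * poch Q (a * Q) n.
Proof. by rewrite -add1n pochD pochS poch0 expr0 expr1 mulr1 mul1r. Qed.

Lemma poch_eq0 Q a n k : (k < n)%N -> a * Q ^+ k = 1 -> poch Q a n = 0.
Proof. by move=> kn aQ; rewrite /poch (bigD1 (Ordinal kn)) //= aQ E1 mul0r. Qed.

Lemma poch_neq0 Q a n : (forall k, (k < n)%N -> E (a * Q ^+ k) != 0) -> poch Q a n != 0.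
Proof. by move=> nz; apply/prodf_neq0 => i _; exact: nz. Qed.

Lemma bin2_addn i j : 'C(i + j, 2) = ('C(i, 2) + 'C(j, 2) + i * j)%N.
Proof. by elim: j => [|j IHj]; rewrite ?addn0 ?muln0 ?addn0 // addnS !binS !bin1 IHj; lia. Qed.

Lemma poch_exch Q a x m n : x = a * Q ^+ m -> poch Q a m != 0 ->
  poch Q x n = poch Q a n * poch Q (a * Q ^+ n) m / poch Q a m.
Proof. by move=> -> am0; rewrite -pochD addnC pochD [RHS]mulrC mulKf. Qed.

(** The condition says that x Q^k and y Q^(n-1-k) are inverse to each other, so this is E(1/x) =
    -E(x)/x applied factor by factor with the order reversed. *)
Lemma poch_refl Q x y n : Q != 0 -> x != 0 -> y != 0 -> x * y * Q ^+ n = Q ->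
  poch Q x n = (- x) ^+ n * Q ^+ 'C(n, 2) * poch Q y n.
Proof.
move=> Q0 + y0; elim: n x => [|n IHn] x x0 xyQ.
  by rewrite !poch0 bin0n !expr0 !mulr1.
rewrite pochSl (IHn (x * Q)) ?mulf_neq0 //; last first.
    by rewrite -[RHS]xyQ exprS; ring.
have -> : x = (y * Q ^+ n)^-1.
  apply: (mulIf (mulf_neq0 y0 (expf_neq0 n Q0))); rewrite mulVf; last by nz.
  by apply: (mulIf Q0); rewrite mul1r -[RHS]xyQ exprS; ring.
rewrite EV; last by nz. rewrite pochS binS bin1 exprD [(- (_ * Q)) ^+ n]exprNn [(- _) ^+ n.+1]exprNn.
rewrite exprMn !exprS; field. nz.
Qed.

Lemma etheta_poch m n h Q s k : Q != 0 -> s != 0 -> etheta m n h ->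
  etheta m (k + n) (fun x => poch Q (s * x) k * poch Q (s * m / x) k * h x).
Proof.
move=> Q0 s0 Vh; elim: k => [|k IHk].
  by apply: etheta_ext Vh => x x0; rewrite !poch0 !mul1r.
have sQ0 : s * Q ^+ k != 0 by nz.
apply: etheta_ext (etheta_mul sQ0 IHk) => x x0; rewrite !pochS.
have -> : s * Q ^+ k * x = s * x * Q ^+ k by ring.
have -> : s * Q ^+ k * m / x = s * m / x * Q ^+ k by ring.
by ring.
Qed.

(** The shape of the general term of every sum below: j factor pairs from the numerator and n - j
    from the cleared denominator. Two bases are allowed because the left side of the cubic
    transformation mixes q and q^3. *)
Lemma etheta_term m n Q Q' s t j c :
  Q != 0 -> Q' != 0 -> s != 0 -> t != 0 -> (j <= n)%N ->
  etheta m n (fun x => c * (poch Q (s * x) j * poch Q (s * m / x) j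
                            * (poch Q' (t * x) (n - j) * poch Q' (t * m / x) (n - j)))).
Proof.
move=> Q0 Q0' s0 t0 jn; rewrite -{1}(subnKC jn); apply: ethetaZ.
have := etheta_poch j Q0 s0 (etheta_poch (n - j) Q0' t0 (etheta_const m 1)).
by rewrite addn0; apply: etheta_ext => x _; rewrite mulr1.
Qed.

(* [x] stays away from the zeros of [E] along its whole [q]-orbit. *)
Definition orbit_neq0 (q x : F) := forall i j : nat, E (x * q ^+ i / q ^+ j) != 0.

Lemma orbit_neq0P q x i j y : orbit_neq0 q x -> y = x * q ^+ i / q ^+ j -> E y != 0.
Proof. by move=> xq ->. Qed.

Lemma E_neq0V x : x != 0 -> E x != 0 -> E x^-1 != 0.
Proof. by move=> x0 Ex; rewrite EV // oppr_eq0 mulf_neq0 ?invr_neq0. Qed.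

Lemma poch_orbit_neq0 Q q x y n i j r : Q = q ^+ r -> orbit_neq0 q x ->
  y = x * q ^+ i / q ^+ j -> poch Q y n != 0.
Proof.
move=> -> xq ->; apply: poch_neq0 => k _; apply: (@orbit_neq0P _ _ (i + r * k) j _ xq).
by rewrite exprD exprM; ring.
Qed.

Lemma poch_orbit1_neq0 q x y n i j : orbit_neq0 q x ->
  y = x * q ^+ i / q ^+ j -> poch q y n != 0.
Proof. exact: (@poch_orbit_neq0 q q x y n i j 1 erefl). Qed.

(* Makes all theta values atoms for [field]. *)
Ltac pgen :=
  repeat match goal with
  | H : is_true (poch _ _ _ != 0) |- _ => revert H
  | H : is_true (E _ != 0) |- _ => revert H
  end;
  repeat match goal with
  | |- context [poch ?Q ?a ?n] => let x := fresh "x" in move: (poch Q a n); intro x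
  | |- context [E ?a] => let x := fresh "x" in move: (E a); intro x
  end; intros.

(** * Very-well-poised series *)

Section FrenkelTuraev.
Variable q : F.
Hypothesis q0 : q != 0.
Local Notation P := (poch q).

(* The (d, e)-dependence of a terminating very-well-poised series, multiplied by
   [(a q / d, a q / e; q)_n] so that it is a theta function of degree [n] of [e]
   when [d e] is fixed; [w] collects the remaining parameters. *)
Definition vwp_sum n a (w : nat -> F) d e := \sum_(j < n.+1)
  w j * E (a * q ^+ (2 * j)) * P (q ^- n) j * q ^+ j / (P q j * P (a * q ^+ n.+1) j)
  * (P d j * P e j * (P (a * q ^+ j.+1 / d) (n - j) * P (a * q ^+ j.+1 / e) (n - j))).

Definition qpow_neq0 n := forall k, (0 < k <= n)%N -> E (q ^+ k) != 0.

Lemma poch_q_neq0 n j : qpow_neq0 n -> (j <= n)%N -> P q j != 0.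
Proof.
move=> qn jn; apply: poch_neq0 => k kj; rewrite -exprS; apply: qn.
by rewrite /= (leq_trans kj).
Qed.

Lemma vwp_sum_etheta n a w mu : a != 0 -> mu != 0 ->
  etheta mu n (fun e => vwp_sum n a w (mu / e) e).
Proof.
move=> a0 mu0.
apply: (@etheta_sum _ _ n (fun j e => w j * E (a * q ^+ (2 * j)) * P (q ^- n) j * q ^+ j
  / (P q j * P (a * q ^+ n.+1) j)
  * (P (mu / e) j * P e j * (P (a * q ^+ j.+1 / (mu / e)) (n - j) * P (a * q ^+ j.+1 / e) (n - j))))) => j jn.
have t0 : a * q ^+ j.+1 / mu != 0 by nz.
apply: etheta_ext (etheta_term mu _ q0 q0 (oner_neq0 F) t0 jn) => x x0 /=.
rewrite !mul1r; congr (_ * _); rewrite [P x j * _]mulrC; congr (_ * (P _ _ * P _ _)).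
  field; nz.
field; nz.
Qed.

(** At e = a q^n the factor (a q^(j+1) / e; q)_(n-j) contains E(1) for every j < n. *)
Lemma vwp_sum_last n a w d : a != 0 -> qpow_neq0 n -> orbit_neq0 q a ->
  vwp_sum n a w d (a * q ^+ n) =
  w n * E (a * q ^+ n) * P d n * ((- q ^- n) ^+ n * q ^+ 'C(n, 2) * q ^+ n).
Proof.
move=> a0 qn aq; rewrite /vwp_sum big_ord_recr /= big1 ?add0r => [|j _]; last first.
  move: (nat_of_ord j) (ltn_ord j) => {}j jn.
  have -> : P (a * q ^+ j.+1 / (a * q ^+ n)) (n - j) = 0.
    apply: (@poch_eq0 _ _ _ (n - j.+1)); first lia.
    by rewrite -{1}(subnKC jn); fld.
  by rewrite !(mulr0).
rewrite subnn !poch0 !mulr1.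
rewrite (@poch_refl q (q ^- n) q) ?invr_neq0 ?expf_neq0 //; last by fld.
have N1 := poch_q_neq0 qn (leqnn n).
have N4 : P (a * q ^+ n.+1) n != 0.
  by apply: (poch_orbit1_neq0 (i := n.+1) (j := 0) _ aq); rewrite ?expr0 ?divr1; ring.
have S : P (a * q ^+ n) n * E (a * q ^+ (2 * n)) = E (a * q ^+ n) * P (a * q ^+ n.+1) n.
  rewrite exprSr mulrA -pochSl pochS; congr (_ * E _); fld.
transitivity (w n * (P (a * q ^+ n) n * E (a * q ^+ (2 * n))) / P (a * q ^+ n.+1) n
  * ((- q ^- n) ^+ n * q ^+ 'C(n, 2) * q ^+ n) * P d n).
  by field; nz.
by rewrite S; field; nz.
Qed.

(** The nodes are the points where a series can be evaluated: at q^(-m) it breaks off after m, at a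
    q^n only its last term survives. The orbit conditions on [a], [mu] and [mu / a] keep these n + 1
    nodes in general position. *)
Lemma vwp_interp n a mu h1 h2 : a != 0 -> mu != 0 -> qpow_neq0 n ->
  orbit_neq0 q a -> orbit_neq0 q mu -> orbit_neq0 q (mu / a) ->
  etheta mu n h1 -> etheta mu n h2 ->
  (forall m, (m < n)%N -> h1 (q ^- m) = h2 (q ^- m)) ->
  h1 (a * q ^+ n) = h2 (a * q ^+ n) ->
  forall e, e != 0 -> h1 e = h2 e.
Proof.
move=> a0 mu0 qn aq muq muaq V1 V2 hm hn.
pose pt i := if (i < n)%N then q ^- i else a * q ^+ n.
apply: (etheta_interp (pt := pt) mu0 V1 V2) => [i _|i j|i j|i].
- by rewrite /pt; case: ifP => _; nz.
- move=> /andP[ij jn]; rewrite /pt; case: (ltnP j n) => jn'.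
    rewrite (ltn_trans ij) //; have -> : q ^- i / q ^- j = q ^+ (j - i).
      by rewrite -[in LHS](subnKC (ltnW ij)); fld.
    by apply: qn; lia.
  rewrite (leq_trans ij) //.
  have -> : q ^- i / (a * q ^+ n) = (a * q ^+ (i + n))^-1 by fld.
  by apply: E_neq0V; [nz|apply: (orbit_neq0P (j := 0) aq); rewrite expr0 divr1].
- move=> /andP[ij jn]; rewrite /pt; case: (ltnP j n) => jn'.
    by rewrite (ltn_trans ij) //; apply: (@orbit_neq0P _ _ (i + j) 0 _ muq); fld.
  by rewrite (leq_trans ij) //; apply: (@orbit_neq0P _ _ i n _ muaq); fld.
- by rewrite leq_eqVlt /pt => /orP[/eqP ->|i_n]; rewrite ?ltnn // i_n hm.
Qed.

(** The terminating factor q^(-n) and the parameter e enter the summand symmetrically. With e =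
    q^(-m) the sum stops at m, and exchanging the two roles gives a shorter sum with e = q^(-n), to
    which an induction hypothesis applies; the prefactor is the change of cleared denominators. *)
Lemma vwp_sum_swap n m a w d : (m < n)%N ->
  orbit_neq0 q a -> a != 0 -> d != 0 ->
  vwp_sum n a w d (q ^- m) =
  P (a * q ^+ m.+1 / d) (n - m) * P (a * q ^+ m.+1) n / P (a * q ^+ n.+1) m
  * vwp_sum m a w d (q ^- n).
Proof.
move=> mn aq a0 d0; rewrite /vwp_sum.
have ltmn : (m.+1 <= n.+1)%N by rewrite ltnS ltnW.
rewrite (big_ord_widen _ (fun j : nat =>
  w j * E (a * q ^+ (2 * j)) * P (q ^- m) j * q ^+ j / (P q j * P (a * q ^+ m.+1) j)
  * (P d j * P (q ^- n) j * (P (a * q ^+ j.+1 / d) (m - j) * P (a * q ^+ j.+1 / q ^- n) (m - j)))) ltmn).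
rewrite [in RHS]big_mkcond big_distrr /=.
apply: eq_bigr => j _; case: ltnP => jm; last first.
  have -> : P (q ^- m) j = 0 by apply: (poch_eq0 jm); rewrite mulVf // expf_neq0.
  by rewrite !(mul0r, mulr0).
rewrite ltnS in jm.
have jn : (j <= n)%N by rewrite (leq_trans jm) // ltnW.
have S1 : P (a * q ^+ j.+1 / d) (n - j) =
    P (a * q ^+ j.+1 / d) (m - j) * P (a * q ^+ m.+1 / d) (n - m).
  have -> : (n - j = (m - j) + (n - m))%N by lia.
  rewrite pochD; congr (_ * P _ _); rewrite -[m in RHS](subnKC jm); fld.
have Na k l : P (a * q ^+ k.+1) l != 0.
  by apply: (poch_orbit1_neq0 (i := k.+1) (j := 0) _ aq); rewrite ?expr0 ?divr1; ring.
have S2 : P (a * q ^+ j.+1 / q ^- m) (n - j) = P (a * q ^+ m.+1) n / P (a * q ^+ m.+1) j.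
  by rewrite (pochB _ _ jn) [RHS]mulrC mulKf //; congr (P _ _); fld.
have S3 : P (a * q ^+ j.+1 / q ^- n) (m - j) = P (a * q ^+ n.+1) m / P (a * q ^+ n.+1) j.
  by rewrite (pochB _ _ jm) [RHS]mulrC mulKf //; congr (P _ _); fld.
rewrite S1 S2 S3; have N1 := Na n m.
rewrite !invfM; move: (P (a * q ^+ n.+1) j)^-1 (P (a * q ^+ m.+1) j)^-1 (P q j)^-1 => x1 x2 x3.
by field.
Qed.

Definition ft_weight a b c j :=
  P a j * P b j * P c j / (P (a * q / b) j * P (a * q / c) j).

(** The 8 omega 7 summation with parameters b, c, d, e, q^(-n). The variable is e with d e fixed;
    the orbit conditions on a^2/(b c) and a/(b c) are those on [mu] and [mu / a] up to powers of
    q. *)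
Lemma frenkel_turaev n a b c d e :
  a != 0 -> b != 0 -> c != 0 -> d != 0 -> e != 0 ->
  qpow_neq0 n -> orbit_neq0 q a -> orbit_neq0 q (a / b) -> orbit_neq0 q (a / c) ->
  orbit_neq0 q (a ^+ 2 / (b * c)) -> orbit_neq0 q (a / (b * c)) ->
  b * c * d * e = a ^+ 2 * q ^+ n.+1 ->
  vwp_sum n a (ft_weight a b c) d e =
  P a n.+1 * P (a * q / (b * c)) n * c ^+ n / (P (a * q / b) n * P (a * q / c) n)
  * (P (a * q / (c * d)) n * P (a * q / (c * e)) n).
Proof.
move=> a0 b0 c0 + + + aq abq acq aabcq abcq.
elim/ltn_ind: n d e => n IHn d e d0 e0 qn bcde.
pose mu := a ^+ 2 * q ^+ n.+1 / (b * c).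
have mu0 : mu != 0 by rewrite /mu; nz.
have -> : d = mu / e.
  apply: (mulIf e0); rewrite divfK // /mu -bcde; field; nz.
move: e e0 {d d0 bcde}.
have ab1 i k : P (a * q ^+ i.+1 / b) k != 0.
  by apply: (poch_orbit1_neq0 (i := i.+1) (j := 0) _ abq); rewrite ?expr0 ?divr1; ring.
have ac1 i k : P (a * q ^+ i.+1 / c) k != 0.
  by apply: (poch_orbit1_neq0 (i := i.+1) (j := 0) _ acq); rewrite ?expr0 ?divr1; ring.
have a1 i k : P (a * q ^+ i) k != 0.
  by apply: (poch_orbit1_neq0 (i := i) (j := 0) _ aq); rewrite ?expr0 ?divr1; ring.
have V2 : etheta mu n (fun e =>
   P a n.+1 * P (a * q / (b * c)) n * c ^+ n / (P (a * q / b) n * P (a * q / c) n)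
   * (P (a * q / (c * (mu / e))) n * P (a * q / (c * e)) n)).
  have t0 : a * q / (c * mu) != 0 by nz.
  apply: etheta_ext (etheta_term mu _ q0 q0 t0 (oner_neq0 F) (leqnn n)) => x x0 /=.
  rewrite subnn !poch0 !mulr1; congr (_ * (P _ _ * P _ _)).
    field; nz.
  field; nz.
apply: (vwp_interp a0 mu0 qn aq _ _ (vwp_sum_etheta n (ft_weight a b c) a0 mu0) V2).
- by move=> i j; apply: (@orbit_neq0P _ _ (n.+1 + i) j _ aabcq); rewrite /mu; fld.
- by move=> i j; apply: (@orbit_neq0P _ _ (n.+1 + i) j _ abcq); rewrite /mu; fld.
- move=> i i_n.
  have d0 : mu / q ^- i != 0 by nz.
  rewrite vwp_sum_swap // IHn //; last 3 first.
  + by nz.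
  + by move=> k /andP[k0 ki]; apply: qn; rewrite k0 (leq_trans ki) // ltnW.
  + by rewrite /mu; fld.
  have -> : a * q / (c * (mu / q ^- i)) = b / (a * q ^+ (n + i)) by rewrite /mu; fld.
  have -> : a * q ^+ i.+1 / (mu / q ^- i) = b * c / (a * q ^+ n) by rewrite /mu; fld.
  have [l nE] : exists l, n = (i + l)%N by exists (n - i)%N; rewrite subnKC // ltnW.
  have -> : (n - i)%N = l by rewrite nE addKn.
  rewrite (@poch_refl q (b / (a * q ^+ (n + i))) (a * q ^+ i.+1 / b) n) //; [|by nz|by nz|by fld].
  rewrite (@poch_refl q (b / (a * q ^+ (n + i))) (a * q ^+ n.+1 / b) i) //; [|by nz|by nz|by fld].
  rewrite (@poch_refl q (b * c / (a * q ^+ n)) (a * q ^+ i.+1 / (b * c)) l) //;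
    [|by nz|by nz|by rewrite nE; fld].
  have -> : P (a * q / (b * c)) n = P (a * q / (b * c)) i * P (a * q ^+ i.+1 / (b * c)) l.
    by rewrite nE pochD; congr (_ * P _ _); fld.
  have Bi := ab1 0%N i; have Ci := ac1 0%N i; have Ai := a1 1%N i.
  have Bn := ab1 0%N n; have Cn := ac1 0%N n; have An := a1 1%N n.
  rewrite ?expr1 in Bi Ci Ai Bn Cn An.
  rewrite (@poch_exch q (a * q) (a * q ^+ i.+1) i n) //; last by fld.
  rewrite (@poch_exch q (a * q / b) (a * q ^+ i.+1 / b) i n) //; last by fld.
  rewrite (@poch_exch q (a * q / c) (a * q / (c * q ^- i)) i n) //; last by fld.
  have -> : a * q * q ^+ n = a * q ^+ n.+1 by fld.
  have -> : a * q / b * q ^+ n = a * q ^+ n.+1 / b by fld.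
  have -> : a * q / c * q ^+ n = a * q / (c * q ^- n) by fld.
  have An' := a1 n.+1 i.
  rewrite !(pochSl _ a) nE bin2_addn [(- _) ^+ (i + l)]exprNn [(- _) ^+ i]exprNn [(- _) ^+ l]exprNn.
  by rewrite -nE; pgen; rewrite nE; fld.
- rewrite vwp_sum_last //.
  have -> : mu / (a * q ^+ n) = a * q / (b * c) by rewrite /mu; fld.
  have -> : a * q / (c * (a * q / (b * c))) = b by fld.
  have -> : a * q / (c * (a * q ^+ n)) = q / (c * q ^+ n) by fld.
  rewrite (@poch_refl q (q / (c * q ^+ n)) c) //; [|by nz|by fld].
  have := ab1 0%N n; have := ac1 0%N n; rewrite expr1 => N1 N2.
  by rewrite /ft_weight pochS [(- _) ^+ n]exprNn [(- (q / _)) ^+ n]exprNn; pgen; fld.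
Qed.

(** * The elliptic Bailey transformation *)

Definition bailey_weight a b c d g j :=
  P a j * P b j * P c j * P d j * P g j
  / (P (a * q / b) j * P (a * q / c) j * P (a * q / d) j * P (a * q / g) j).

(** Both sides are interpolated in one of e, f with e f fixed. At the nodes q^(-i) both series
    shorten to the case i of the induction; at a q^n the left side is its last term and the right
    side becomes a Frenkel-Turaev sum. The parameters g, e, f are kept while b, c, d are scaled by
    la/a. *)
Lemma elliptic_bailey n a b c d g la e f :
  a != 0 -> b != 0 -> c != 0 -> d != 0 -> g != 0 -> la != 0 -> e != 0 -> f != 0 ->
  la * b * c * d = a ^+ 2 * q -> e * f * g = la * a * q ^+ n.+1 ->
  qpow_neq0 n -> orbit_neq0 q a -> orbit_neq0 q la ->
  orbit_neq0 q (a / b) -> orbit_neq0 q (a / c) -> orbit_neq0 q (a / d) ->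
  orbit_neq0 q (a / g) -> orbit_neq0 q (la / g) -> orbit_neq0 q (la * a / g) ->
  orbit_neq0 q (la * d) -> orbit_neq0 q d ->
  vwp_sum n a (bailey_weight a b c d g) e f =
  P a n.+1 * P (la * q / g) n / (P (a * q / g) n * P la n.+1) * (a / la) ^+ n
  * vwp_sum n la (bailey_weight la (la * b / a) (la * c / a) (la * d / a) g) e f.
Proof.
move=> a0 b0 c0 d0 g0 la0 + + laE + + aq laq abq acq adq agq lagq laagq ladq dq.
(* The two names are exchanged here: from now on [e] is the last argument of [vwp_sum] and the
   interpolation variable, and [f] becomes [mu / e]. *)
elim/ltn_ind: n e f => n IHn f e f0 e0 efg qn.
pose mu := la * a * q ^+ n.+1 / g.
have mu0 : mu != 0 by rewrite /mu; nz.
have -> : f = mu / e.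
  apply: (mulIf e0); rewrite divfK // /mu -efg; field; nz.
move: e e0 {f f0 efg}.
have a2E : a ^+ 2 = la * b * c * d / q by rewrite laE mulfK.
have N x y i k : orbit_neq0 q x -> y = x * q ^+ i -> P y k != 0.
  by move=> xq ->; apply: (poch_orbit1_neq0 (i := i) (j := 0) _ xq); rewrite expr0 divr1.
have V2 := vwp_sum_etheta n (bailey_weight la (la * b / a) (la * c / a) (la * d / a) g) la0 mu0.
apply: (vwp_interp a0 mu0 qn aq _ _ (vwp_sum_etheta n _ a0 mu0) (ethetaZ _ V2)).
- by move=> i j; apply: (@orbit_neq0P _ _ (n.+1 + i) j _ laagq); rewrite /mu; fld.
- by move=> i j; apply: (@orbit_neq0P _ _ (n.+1 + i) j _ lagq); rewrite /mu; fld.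
- move=> i i_n.
  have d0' : mu / q ^- i != 0 by nz.
  rewrite (@vwp_sum_swap n i a) // (@vwp_sum_swap n i la) // (IHn i) //; last 3 first.
  + by nz.
  + by rewrite /mu; fld.
  + by move=> k /andP[k0 ki]; apply: qn; rewrite k0 (leq_trans ki) // ltnW.
  have -> : a * q ^+ i.+1 / (mu / q ^- i) = g / (la * q ^+ n) by rewrite /mu; fld.
  have -> : la * q ^+ i.+1 / (mu / q ^- i) = g / (a * q ^+ n) by rewrite /mu; fld.
  have [l nE] : exists l, n = (i + l)%N by exists (n - i)%N; rewrite subnKC // ltnW.
  have -> : (n - i)%N = l by rewrite nE addKn.
  rewrite (@poch_refl q (g / (la * q ^+ n)) (la * q ^+ i.+1 / g) l) //;
    [|by nz|by nz|by rewrite nE; fld].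
  rewrite (@poch_refl q (g / (a * q ^+ n)) (a * q ^+ i.+1 / g) l) //;
    [|by nz|by nz|by rewrite nE; fld].
  have S x : P (x * q / g) n = P (x * q / g) i * P (x * q ^+ i.+1 / g) l.
    by rewrite nE pochD; congr (_ * P _ _); fld.
  rewrite !S.
  have Ai : P (a * q) i != 0 by apply: (N a _ 1%N).
  have Li : P (la * q) i != 0 by apply: (N la _ 1%N).
  have An : P (a * q) n != 0 by apply: (N a _ 1%N).
  have Ln : P (la * q) n != 0 by apply: (N la _ 1%N).
  have Lg : P (la * q / g) i != 0 by apply: (N _ _ 1%N _ lagq); fld.
  have Ag : P (a * q / g) i != 0 by apply: (N _ _ 1%N _ agq); fld.
  have Ag' : P (a * q ^+ i.+1 / g) l != 0 by apply: (N _ _ i.+1 _ agq); fld.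
  have An' : P (a * q ^+ n.+1) i != 0 by apply: (N a _ n.+1).
  have Ln' : P (la * q ^+ n.+1) i != 0 by apply: (N la _ n.+1).
  have La : E la != 0 by apply: (orbit_neq0P (i := 0) (j := 0) laq); rewrite expr0 divr1 mulr1.
  rewrite (@poch_exch q (a * q) (a * q ^+ i.+1) i n) //; last by fld.
  rewrite (@poch_exch q (la * q) (la * q ^+ i.+1) i n) //; last by fld.
  have -> : a * q * q ^+ n = a * q ^+ n.+1 by fld.
  have -> : la * q * q ^+ n = la * q ^+ n.+1 by fld.
  rewrite !(pochSl _ a) !(pochSl _ la).
  move: (vwp_sum i _ _ _ _) => V.
  set al1 := (- (g / (la * _))) ^+ l; set al2 := (- (g / (a * _))) ^+ l.
  (* The two reflections differ by (a/la)^l, exactly the part of (a/la)^n that the induction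
     hypothesis for i = n - l does not supply. *)
  have -> : al1 = (a / la) ^+ l * al2.
    by rewrite /al1 /al2 -exprMn; congr (_ ^+ _); fld.
  have -> : (a / la) ^+ n = (a / la) ^+ i * (a / la) ^+ l by rewrite nE exprD.
  clearbody al1 al2; move: ((a / la) ^+ i) ((a / la) ^+ l) (q ^+ 'C(l, 2)) => r1 r2 r3.
  by pgen; field; nz.
- have La : E la != 0 by apply: (orbit_neq0P (i := 0) (j := 0) laq); rewrite expr0 divr1 mulr1.
  have -> : mu / (a * q ^+ n) = la * q / g by rewrite /mu; fld.
  rewrite vwp_sum_last //.
  have AD j : P (a * q / d) j != 0 by apply: (N _ _ 1%N _ adq); fld.
  have AG j : P (a * q / g) j != 0 by apply: (N _ _ 1%N _ agq); fld.
  have LG j : P (la * q / g) j != 0 by apply: (N _ _ 1%N _ lagq); fld.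
  have AB j : P (a * q / b) j != 0 by apply: (N _ _ 1%N _ abq); fld.
  have AC j : P (a * q / c) j != 0 by apply: (N _ _ 1%N _ acq); fld.
  have LP j : P la j != 0 by apply: (N _ _ 0%N _ laq); rewrite expr0 mulr1.
  (* At this node the parameters la q / g and g have product la q, so they cancel from the summand
     up to a constant and a summable 8 omega 7 remains. *)
  have -> : vwp_sum n la (bailey_weight la (la * b / a) (la * c / a) (la * d / a) g)
      (la * q / g) (a * q ^+ n) =
    P g n / P (a * q / d) n
    * vwp_sum n la (ft_weight la (la * b / a) (la * c / a)) (la * d / a) (a * q ^+ n).
    rewrite /vwp_sum big_distrr /=; apply: eq_bigr => j _.
    have jn : (j <= n)%N by rewrite -ltnS.
    rewrite /bailey_weight /ft_weight.
    have -> : la * q / (la * d / a) = a * q / d by fld.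
    have -> : la * q ^+ j.+1 / (la * q / g) = g * q ^+ j by fld.
    have -> : la * q ^+ j.+1 / (la * d / a) = a * q / d * q ^+ j by fld.
    rewrite (pochB q g jn) (pochB q (a * q / d) jn).
    have N1 : P (a * q / d * q ^+ j) (n - j) != 0 by apply: (N _ _ j.+1 _ adq); fld.
    have := LG j; have := AD j; have := AG j.
    have -> : la * q / (la * b / a) = a * q / b by fld.
    have -> : la * q / (la * c / a) = a * q / c by fld.
    have := AB j; have := AC j; have := poch_q_neq0 qn jn.
    have : P (la * q ^+ n.+1) j != 0 by apply: (N la _ n.+1).
    by pgen; field; nz.
  rewrite frenkel_turaev //; try by nz.
  + have -> : la * q / (la * b / a * (la * c / a)) = d.
      by apply: (mulIf (mulf_neq0 la0 (mulf_neq0 b0 c0))); rewrite [RHS]mulrC !mulrA laE; field; nz.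
    have -> : la * q / (la * b / a) = a * q / b by fld.
    have -> : la * q / (la * c / a) = a * q / c by fld.
    have -> : la * q / (la * c / a * (la * d / a)) = b.
      by apply: (mulIf (mulf_neq0 la0 (mulf_neq0 c0 d0))); rewrite [RHS]mulrCA !mulrA laE; field; nz.
    have -> : la * q / (la * c / a * (a * q ^+ n)) = q / (c * q ^+ n) by fld.
    rewrite (@poch_refl q (q / (c * q ^+ n)) c) //; [|by nz|by fld].
    rewrite /bailey_weight pochS [(- _) ^+ n]exprNn [(- (q / _)) ^+ n]exprNn.
    have := AB n; have := AC n; have := AD n; have := AG n; have := LG n; have := LP n.+1.
    by pgen; fld.
  + move=> i j; apply: (@orbit_neq0P _ _ i j _ abq); field; nz.
  + move=> i j; apply: (@orbit_neq0P _ _ i j _ acq); field; nz.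
  + move=> i j; apply: (@orbit_neq0P _ _ i j.+1 _ ladq).
    transitivity (a ^+ 2 / (b * c) * q ^+ i / q ^+ j); first fld.
    by rewrite a2E; fld.
  + move=> i j; apply: (@orbit_neq0P _ _ i j.+1 _ dq).
    transitivity (a ^+ 2 / (la * b * c) * q ^+ i / q ^+ j); first fld.
    by rewrite a2E; fld.
  + transitivity (la ^+ 2 * (la * b * c * d) / a ^+ 2 * q ^+ n); first fld.
    by rewrite laE; fld.
Qed.
End FrenkelTuraev.

Lemma orbit_neq0X q x r i j y : orbit_neq0 q x -> y = x * q ^+ i / q ^+ j ->
  orbit_neq0 (q ^+ r) y.
Proof.
move=> xq -> k l; apply: (@orbit_neq0P _ _ (i + r * k) (j + r * l) _ xq).
by rewrite !exprD -!exprM invfM; ring.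
Qed.

Lemma poch_triple q a n :
  poch q a (3 * n) = poch (q ^+ 3) a n * poch (q ^+ 3) (a * q) n * poch (q ^+ 3) (a * q ^+ 2) n.
Proof.
elim: n => [|n IHn]; first by rewrite !poch0 !mul1r.
have -> : (3 * n.+1 = (3 * n).+3)%N by lia.
rewrite !pochS IHn exprM.
have -> : a * q ^+ (3 * n).+1 = a * q * (q ^+ 3) ^+ n by rewrite exprS exprM mulrA.
have -> : a * q ^+ (3 * n).+2 = a * q ^+ 2 * (q ^+ 3) ^+ n by rewrite -addn2 exprD exprM mulrA mulrAC.
by pgen; ring.
Qed.

(** * The cubic transformation *)

Section Cubic.
Variable q : F.
Hypothesis q0 : q != 0.
Local Notation Q := (q ^+ 3).
Local Notation P := (poch q).
Local Notation PQ := (poch (q ^+ 3)).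

(* Both sides are multiplied by [(a q^3 / b, a q^3 / c; q^3, p)_n]; the paper's [e] is
   [a ^ 2 q ^ (3 n + 1) / d], and [a d / q] is the [a_1] of the series on the right. *)
Definition cubic_lhs n a d b c := \sum_(k < n.+1)
  E (a * q ^+ (4 * k)) * (P d (2 * k) / P (a * q / d) (2 * k))
  * (PQ (a ^+ 2 * q ^+ (3 * n).+1 / d) k * PQ (Q ^- n) k
     / (P (d / (a * q ^+ (3 * n))) k * P (a * q ^+ (3 * n).+1) k)) * q ^+ k
  * (P b k * P c k * (PQ (a * Q ^+ k.+1 / b) (n - k) * PQ (a * Q ^+ k.+1 / c) (n - k))).

Definition cubic_rhs n a d b c := \sum_(j < n.+1)
  E (a * d / q * Q ^+ (2 * j))
  * (PQ (a * d / q) j * PQ (a ^+ 2 * q ^+ (3 * n).+1 / d) j * PQ (Q ^- n) j * P d (3 * j))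
  / (PQ Q j * PQ (d ^+ 2 * q / (a * q ^+ (3 * n))) j * PQ (a * d / q * Q ^+ n.+1) j * P a (3 * j))
  * Q ^+ j
  * (PQ (a / b) j * PQ (a / c) j * (PQ (a * Q ^+ j.+1 / b) (n - j) * PQ (a * Q ^+ j.+1 / c) (n - j))).

(** The prefactor in a form free of b and c: it must be constant in the interpolation variable b.
    [cubic_coef_prod] turns it into the product of the statement. *)
Definition cubic_coef n a d :=
  P a (3 * n).+1 * PQ (a * q ^+ 2 / d ^+ 2) n / (P (a * q / d) (3 * n) * PQ (a * d / q) n.+1).

Record cubic_generic a d : Prop := CubicGeneric {
  cg_a : orbit_neq0 q a; cg_d : orbit_neq0 q d; cg_aa : orbit_neq0 q (a ^+ 2);
  cg_ad : orbit_neq0 q (a * d); cg_avd : orbit_neq0 q (a / d);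
  cg_dda : orbit_neq0 q (d ^+ 2 / a) }.

(** The induction on n replaces (a, d) by (a q^(4m), d q^(2m)); every monomial in [cubic_generic]
    changes by a power of q, and d^2/a not at all. *)
Lemma cubic_generic_shift a d m : d != 0 -> a != 0 ->
  cubic_generic a d -> cubic_generic (a * q ^+ (4 * m)) (d * q ^+ (2 * m)).
Proof.
move=> d0 a0 [ga gd gaa gad gavd gdda]; split=> i j.
- by apply: (@orbit_neq0P _ _ (4 * m + i) j _ ga); fld.
- by apply: (@orbit_neq0P _ _ (2 * m + i) j _ gd); fld.
- by apply: (@orbit_neq0P _ _ (8 * m + i) j _ gaa); fld.
- by apply: (@orbit_neq0P _ _ (6 * m + i) j _ gad); fld.
- by apply: (@orbit_neq0P _ _ (2 * m + i) j _ gavd); fld.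
- by apply: (@orbit_neq0P _ _ i j _ gdda); fld.
Qed.

Lemma cubic_lhs_etheta n a d mu : a != 0 -> mu != 0 ->
  etheta mu n (fun b => cubic_lhs n a d b (mu / b)).
Proof.
move=> a0 mu0.
apply: (@etheta_sum _ _ n (fun k b =>
  E (a * q ^+ (4 * k)) * (P d (2 * k) / P (a * q / d) (2 * k))
  * (PQ (a ^+ 2 * q ^+ (3 * n).+1 / d) k * PQ (Q ^- n) k
     / (P (d / (a * q ^+ (3 * n))) k * P (a * q ^+ (3 * n).+1) k)) * q ^+ k
  * (P b k * P (mu / b) k * (PQ (a * Q ^+ k.+1 / b) (n - k) * PQ (a * Q ^+ k.+1 / (mu / b)) (n - k))))) => k kn.
have t0 : a * Q ^+ k.+1 / mu != 0 by nz.
apply: etheta_ext (etheta_term mu _ q0 (expf_neq0 3 q0) (oner_neq0 F) t0 kn) => x x0 /=.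
rewrite !mul1r; congr (_ * (_ * _)).
by rewrite [LHS]mulrC; congr (PQ _ _ * PQ _ _); field; nz.
Qed.

Lemma cubic_rhs_etheta n a d mu : a != 0 -> mu != 0 ->
  etheta mu n (fun b => cubic_rhs n a d b (mu / b)).
Proof.
move=> a0 mu0.
apply: (@etheta_sum _ _ n (fun j b => E (a * d / q * Q ^+ (2 * j))
  * (PQ (a * d / q) j * PQ (a ^+ 2 * q ^+ (3 * n).+1 / d) j * PQ (Q ^- n) j * P d (3 * j))
  / (PQ Q j * PQ (d ^+ 2 * q / (a * q ^+ (3 * n))) j * PQ (a * d / q * Q ^+ n.+1) j * P a (3 * j))
  * Q ^+ j
  * (PQ (a / b) j * PQ (a / (mu / b)) j
     * (PQ (a * Q ^+ j.+1 / b) (n - j) * PQ (a * Q ^+ j.+1 / (mu / b)) (n - j))))) => j jn.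
have t0 : a * Q ^+ j.+1 / mu != 0 by nz.
have s0 : a / mu != 0 by nz.
have Q0 := expf_neq0 3 q0.
apply: etheta_ext (etheta_term mu _ Q0 Q0 s0 t0 jn) => x x0 /=.
congr (_ * (_ * _)); rewrite [LHS]mulrC; congr (PQ _ _ * PQ _ _); field; nz.
Qed.

(** The shifted instance met at a node has its b equal to its a, and then (a/b; q^3)_j contains E(1)
    for j > 0. *)
Lemma cubic_rhs_diag n a d : a != 0 -> d != 0 ->
  cubic_rhs n a d a (q / d) =
  E (a * d / q) * (PQ Q n * PQ (a * d / q * Q) n).
Proof.
move=> a0 d0; rewrite /cubic_rhs big_ord_recl big1 /= ?addr0 => [|j _]; last first.
  by rewrite (@poch_eq0 Q (a / a) _ 0) ?expr0 ?mulr1 ?divff // !(mul0r, mulr0).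
rewrite !(muln0, expr0, poch0, subn0, mulr1, mul1r, divr1, expr1).
by congr (_ * (PQ _ _ * PQ _ _)); fld.
Qed.

(** * The cubic transformation at the interpolation nodes *)

Section Step.
Variables (n : nat) (a d : F).
Hypotheses (a0 : a != 0) (d0 : d != 0) (gen : cubic_generic a d) (qn : qpow_neq0 Q n).

Let N x y i j k : orbit_neq0 q x -> y = x * q ^+ i / q ^+ j -> P y k != 0.
Proof. exact: poch_orbit1_neq0. Qed.

Let NQ x y i j k : orbit_neq0 q x -> y = x * q ^+ i / q ^+ j -> PQ y k != 0.
Proof. exact: (@poch_orbit_neq0 _ q x y k i j 3 erefl). Qed.

Let Q0 : Q != 0. Proof. exact: expf_neq0. Qed.

Lemma cubic_at1 : cubic_lhs n a d 1 (a * q / d) =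
  cubic_coef n a d * cubic_rhs n a d 1 (a * q / d).
Proof.
case: gen => ga gd gaa gad gavd gdda.
have -> : cubic_lhs n a d 1 (a * q / d) = E a * (PQ (a * Q) n * PQ (d * q ^+ 2) n).
  rewrite /cubic_lhs big_ord_recl big1 /= ?addr0 => [|k _]; last first.
    by rewrite (@poch_eq0 q 1 _ 0) ?mulr1 // !(mul0r, mulr0).
  rewrite !(muln0, expr0, poch0, subn0, mulr1, mul1r, divr1, expr1).
  by congr (_ * (_ * PQ _ _)); fld.
set e := a ^+ 2 * q ^+ (3 * n).+1 / d.
have e0 : e != 0 by rewrite /e; nz.
have PE k : PQ (d ^+ 2 * q / (a * q ^+ (3 * n))) k != 0.
  by apply: (NQ (i := 1) (j := 3 * n) _ gdda); fld.
(* Splitting (d; q)_(3j) and (a; q)_(3j) by residues modulo 3 gives base q^3. The part (d q^2;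
   q^3)_j joins (a q^(3j+3) / c; q^3)_(n-j) into the constant (d q^2; q^3)_n; what is left is a
   Frenkel-Turaev series in d, d q, d/q, e. *)
have -> : cubic_rhs n a d 1 (a * q / d) =
  PQ (d * q ^+ 2) n / PQ (d ^+ 2 * q / (a * q ^+ (3 * n))) n
  * vwp_sum Q n (a * d / q) (ft_weight Q (a * d / q) d (d * q)) (d / q) e.
  rewrite /cubic_rhs /vwp_sum big_distrr /=; apply: eq_bigr => j _.
  have jn : (j <= n)%N by rewrite -ltnS.
  rewrite /ft_weight -/e divr1.
  have -> : a / (a * q / d) = d / q by fld.
  have -> : a * d / q * Q / d = a * q ^+ 2 by fld.
  have -> : a * d / q * Q / (d * q) = a * q by fld.
  have -> : a * d / q * Q ^+ j.+1 / (d / q) = a * Q ^+ j.+1 / 1 by fld.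
  have -> : a * Q ^+ j.+1 / (a * q / d) = d * q ^+ 2 * Q ^+ j by fld.
  have -> : a * d / q * Q ^+ j.+1 / e = d ^+ 2 * q / (a * q ^+ (3 * n)) * Q ^+ j.
    by rewrite /e; fld.
  rewrite !poch_triple (pochB Q (d * q ^+ 2) jn) (pochB Q (d ^+ 2 * q / _) jn).
  have N1 := PE j.
  have N2 : PQ (d ^+ 2 * q / (a * q ^+ (3 * n)) * Q ^+ j) (n - j) != 0.
    by apply: (NQ (i := (1 + 3 * j)) (j := 3 * n) _ gdda); fld.
  have N3 := poch_q_neq0 qn jn.
  have N4 : PQ (a * d / q * Q ^+ n.+1) j != 0.
    by apply: (NQ (i := 3 * n.+1) (j := 1) _ gad); fld.
  have N5 : PQ a j != 0 by apply: (NQ (i := 0) (j := 0) _ ga); fld.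
  have N6 : PQ (a * q) j != 0 by apply: (NQ (i := 1) (j := 0) _ ga); fld.
  have N7 : PQ (a * q ^+ 2) j != 0 by apply: (NQ (i := 2) (j := 0) _ ga); fld.
  by pgen; field; nz.
have dq0 : d / q != 0 by nz.
rewrite frenkel_turaev //; try by nz.
- have -> : a * d / q * Q / (d * (d * q)) = a * q / d by fld.
  have -> : a * d / q * Q / d = a * q ^+ 2 by fld.
  have -> : a * d / q * Q / (d * q) = a * q by fld.
  have -> : a * d / q * Q / (d * q * (d / q)) = a * q ^+ 2 / d by fld.
  rewrite (@poch_refl Q (a * d / q * Q / (d * q * e)) (a * Q / d)) //;
    [|by nz|by nz|by rewrite /e; fld].
  rewrite (@poch_refl Q (d ^+ 2 * q / (a * q ^+ (3 * n))) (a * q ^+ 2 / d ^+ 2)) //;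
    [|by nz|by nz|by fld].
  rewrite /cubic_coef (pochSl q) !poch_triple.
  have -> : a * q / d * q = a * q ^+ 2 / d by fld.
  have -> : a * q / d * q ^+ 2 = a * Q / d by fld.
  have -> : a * q * q = a * q ^+ 2 by fld.
  have -> : a * q * q ^+ 2 = a * Q by fld.
  have N1 : PQ (a * d / q) n.+1 != 0 by apply: (NQ (i := 0) (j := 1) _ gad); fld.
  have N2 : PQ (a * q ^+ 2 / d) n != 0 by apply: (NQ (i := 2) (j := 0) _ gavd); fld.
  have N3 : PQ (a * Q / d) n != 0 by apply: (NQ (i := 3) (j := 0) _ gavd); fld.
  have N4 : PQ (a * q / d) n != 0 by apply: (NQ (i := 1) (j := 0) _ gavd); fld.
  have N6 : PQ (a * q) n != 0 by apply: (NQ (i := 1) (j := 0) _ ga); fld.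
  have N7 : PQ (a * q ^+ 2) n != 0 by apply: (NQ (i := 2) (j := 0) _ ga); fld.
  have := PE n.
  rewrite (@poch_refl Q (d ^+ 2 * q / (a * q ^+ (3 * n))) (a * q ^+ 2 / d ^+ 2)) //;
    [|by nz|by nz|by fld].
  rewrite mulf_eq0 negb_or => /andP[_ N8].
  set al1 := (- (a * d / q * Q / _)) ^+ n; set al2 := (- (d ^+ 2 * q / _)) ^+ n.
  have al10 : al1 != 0 by rewrite /al1; nz.
  (* The quotient of the two reflection factors is the power c^n of the Frenkel-Turaev sum, whose c
     is d q here. *)
  have -> : al2 = al1 * (d * q) ^+ n.
    by rewrite /al1 /al2 -exprMn; congr (_ ^+ _); rewrite /e; fld.
  have : (d * q) ^+ n != 0 by nz.
  have : Q ^+ 'C(n, 2) != 0 by nz.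
  clearbody al1 al2; move: ((d * q) ^+ n) (Q ^+ 'C(n, 2)) => r1 r2 r10 r20.
  by pgen; field; nz.
- by apply: (orbit_neq0X (i := 0) (j := 1) _ gad); fld.
- by apply: (orbit_neq0X (i := 0) (j := 1) _ ga); fld.
- by apply: (orbit_neq0X (i := 0) (j := 2) _ ga); fld.
- by apply: (orbit_neq0X (i := 0) (j := 3) _ gaa); fld.
- by apply: (orbit_neq0X (i := 0) (j := 2) _ gavd); fld.
- by rewrite /e; fld.
Qed.

(** For k < m the factor (a q^(3k+3) / b; q^3)_(n-k) contains E(1), so the sum starts at k = m.
    Moving the index by m turns E(a q^(4k)) and (d; q)_(2k) into the same expressions with a q^(4m)
    and d q^(2m), and b q^m = a q^(4m) is the new a. *)
Lemma cubic_lhs_node m l : n = (m + l)%N ->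
  cubic_lhs n a d (a * Q ^+ m) (q / (d * Q ^+ m)) =
  P (a * Q ^+ m) m * P (q / (d * Q ^+ m)) m * (P d (2 * m) / P (a * q / d) (2 * m))
  * (PQ (a ^+ 2 * q ^+ (3 * n).+1 / d) m * PQ (Q ^- n) m
     / (P (d / (a * q ^+ (3 * n))) m * P (a * q ^+ (3 * n).+1) m)) * q ^+ m
  * cubic_lhs l (a * q ^+ (4 * m)) (d * q ^+ (2 * m)) (a * q ^+ (4 * m)) (q / (d * q ^+ (2 * m))).
Proof.
move=> nE; case: gen => ga gd gaa gad gavd gdda.
rewrite /cubic_lhs; have -> : n.+1 = (m + l.+1)%N by rewrite nE addnS.
rewrite big_split_ord /= big1 ?add0r => [|k _]; last first.
  have km := ltn_ord k; move: (nat_of_ord k) km => {}k km.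
  have -> : PQ (a * Q ^+ k.+1 / (a * Q ^+ m)) (n - k) = 0.
    apply: (@poch_eq0 _ _ _ (m - k.+1)); first lia.
    by rewrite -{1}(subnKC km); fld.
  by rewrite mul0r !mulr0.
rewrite big_distrr /=; apply: eq_bigr => i _; move: (nat_of_ord i) => {}i.
have -> : (n - (m + i) = l - i)%N by lia.
rewrite [(2 * (m + i))%N]mulnDr !pochD.
have -> : a * Q ^+ m * q ^+ m = a * q ^+ (4 * m) by fld.
have -> : q / (d * Q ^+ m) * q ^+ m = q / (d * q ^+ (2 * m)) by fld.
have -> : a * q / d * q ^+ (2 * m) = a * q ^+ (4 * m) * q / (d * q ^+ (2 * m)).
  by fld.
have -> : (a * q ^+ (4 * m)) ^+ 2 * q ^+ (3 * l).+1 / (d * q ^+ (2 * m)) =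
    a ^+ 2 * q ^+ (3 * n).+1 / d * Q ^+ m by rewrite nE; fld.
have -> : Q ^- n * Q ^+ m = Q ^- l by rewrite nE; fld.
have -> : d / (a * q ^+ (3 * n)) * q ^+ m = d * q ^+ (2 * m) / (a * q ^+ (4 * m) * q ^+ (3 * l)).
  by rewrite nE; fld.
have -> : a * q ^+ (3 * n).+1 * q ^+ m = a * q ^+ (4 * m) * q ^+ (3 * l).+1 by rewrite nE; fld.
have -> : a * q ^+ (4 * (m + i)) = a * q ^+ (4 * m) * q ^+ (4 * i) by fld.
have -> : a * q ^+ (4 * m) * Q ^+ i.+1 / (a * q ^+ (4 * m)) = a * Q ^+ (m + i).+1 / (a * Q ^+ m).
  by fld.
have -> : a * q ^+ (4 * m) * Q ^+ i.+1 / (q / (d * q ^+ (2 * m))) =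
    a * Q ^+ (m + i).+1 / (q / (d * Q ^+ m)) by fld.
by rewrite exprD; pgen; rewrite !invfM; ring.
Qed.

(** The terms j < m vanish through (a q^(3j+3) / b; q^3)_(n-j), the terms j > m through (a/b;
    q^3)_j. *)
Lemma cubic_rhs_node m l : n = (m + l)%N ->
  cubic_rhs n a d (a * Q ^+ m) (q / (d * Q ^+ m)) =
  E (a * d / q * Q ^+ (2 * m))
  * (PQ (a * d / q) m * PQ (a ^+ 2 * q ^+ (3 * n).+1 / d) m * PQ (Q ^- n) m * P d (3 * m))
  / (PQ Q m * PQ (d ^+ 2 * q / (a * q ^+ (3 * n))) m * PQ (a * d / q * Q ^+ n.+1) m * P a (3 * m))
  * Q ^+ m
  * (PQ (Q ^- m) m * PQ (a * d / q * Q ^+ m) m * (PQ Q l * PQ (a * d / q * Q ^+ (2 * m).+1) l)).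
Proof.
move=> nE.
have mn : (m < n.+1)%N by rewrite nE ltnS leq_addr.
rewrite /cubic_rhs (bigD1 (Ordinal mn)) //= big1 ?addr0 => [|j jm]; last first.
  have jn := ltn_ord j; have {}jm : nat_of_ord j != m by [].
  move: (nat_of_ord j) jn jm => {}j jn jm.
  case: (ltngtP j m) => [jm'|mj|jm']; last by rewrite jm' eqxx in jm.
    have -> : PQ (a * Q ^+ j.+1 / (a * Q ^+ m)) (n - j) = 0.
      apply: (@poch_eq0 _ _ _ (m - j.+1)); first lia.
      by rewrite -{1}(subnKC jm'); fld.
    by rewrite mul0r !mulr0.
  have -> : PQ (a / (a * Q ^+ m)) j = 0 by apply: (poch_eq0 mj); fld.
  by rewrite !mul0r !mulr0.
have -> : (n - m = l)%N by rewrite nE addKn.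
by congr (_ * (PQ _ _ * PQ _ _ * (PQ _ _ * PQ _ _))); fld.
Qed.

Lemma cubic_node_coef m l : n = (m + l)%N ->
  P (a * Q ^+ m) m * P (q / (d * Q ^+ m)) m * (P d (2 * m) / P (a * q / d) (2 * m))
  * (PQ (a ^+ 2 * q ^+ (3 * n).+1 / d) m * PQ (Q ^- n) m
     / (P (d / (a * q ^+ (3 * n))) m * P (a * q ^+ (3 * n).+1) m)) * q ^+ m
  * (cubic_coef l (a * q ^+ (4 * m)) (d * q ^+ (2 * m))
     * cubic_rhs l (a * q ^+ (4 * m)) (d * q ^+ (2 * m)) (a * q ^+ (4 * m)) (q / (d * q ^+ (2 * m)))) =
  cubic_coef n a d * cubic_rhs n a d (a * Q ^+ m) (q / (d * Q ^+ m)).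
Proof.
move=> nE; case: gen => ga gd gaa gad gavd gdda.
have A' : a * q ^+ (4 * m) * (d * q ^+ (2 * m)) / q = a * d / q * Q ^+ (2 * m).
  by fld.
set a' := a * q ^+ (4 * m); set d' := d * q ^+ (2 * m); set A := a * d / q.
have a0' : a' != 0 by rewrite /a'; nz.
have d0' : d' != 0 by rewrite /d'; nz.
rewrite cubic_rhs_diag // (cubic_rhs_node nE) /cubic_coef A' -/A.
have -> : a' * q ^+ 2 / d' ^+ 2 = a * q ^+ 2 / d ^+ 2 by rewrite /a' /d'; fld.
(* The products in the prefactor for n are cut into those for l with shifted parameters and pieces
   of the two surviving terms. Where the pieces overlap, one longer product is split in two ways,
   which produces the divisions. *)
have Sa : P a (3 * n).+1 =
    P a (3 * m) * P (a * Q ^+ m) m * P a' (3 * l).+1 / P (a * q ^+ (3 * n).+1) m.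
  apply/eqP; rewrite eq_sym; apply/eqP.
  have -> : a * Q ^+ m = a * q ^+ (3 * m) by rewrite -exprM.
  have -> : a' = a * q ^+ (3 * m + m) by rewrite /a'; fld.
  rewrite -!pochD; have -> : (3 * m + m + (3 * l).+1 = (3 * n).+1 + m)%N by lia.
  rewrite pochD mulfK //.
  by apply: (N (i := (3 * n).+1) (j := 0) _ ga); fld.
have Sd : P (a * q / d) (3 * n) =
    P (a * q / d) (2 * m) * P (a' * q / d') (3 * l) * P (a * q ^+ (2 * m + 3 * l).+1 / d) m.
  have -> : (3 * n = 2 * m + (3 * l) + m)%N by lia.
  rewrite (pochD q _ (2 * m + 3 * l) m) (pochD q _ (2 * m) (3 * l)); congr (_ * P _ _ * P _ _); last by fld.
  by rewrite /a' /d'; fld.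
have Sd3 : P d (3 * m) = P d (2 * m) * P (d * q ^+ (2 * m)) m.
  by rewrite -pochD; congr (P _ _); lia.
have S2 : PQ (a * q ^+ 2 / d ^+ 2) n =
    PQ (a * q ^+ 2 / d ^+ 2) l * PQ (a * q ^+ 2 * Q ^+ l / d ^+ 2) m.
  by rewrite nE addnC pochD; congr (_ * PQ _ _); fld.
have NA i k : PQ (A * Q ^+ i) k != 0.
  by apply: (NQ (i := 3 * i) (j := 1) _ gad); rewrite /A; fld.
have SA : PQ A n.+1 =
  PQ A m * PQ (A * Q ^+ m) m * (E (A * Q ^+ (2 * m)) * PQ (A * Q ^+ (2 * m).+1) l)
  / PQ (A * Q ^+ n.+1) m.
  apply/eqP; rewrite eq_sym; apply/eqP.
  rewrite [A * Q ^+ (2 * m).+1](_ : _ = A * Q ^+ (2 * m) * Q); last by fld.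
  rewrite -pochSl -pochD; have -> : (2 * m = m + m)%N by lia.
  rewrite -pochD; have -> : (m + m + l.+1 = n.+1 + m)%N by lia.
  by rewrite pochD mulfK.
rewrite [PQ _ l.+1]pochSl.
have -> : A * Q ^+ (2 * m) * Q = A * Q ^+ (2 * m).+1 by fld.
rewrite Sa Sd Sd3 S2 SA.
have N1 : P (a * q / d) (2 * m) != 0 by apply: (N (i := 1) (j := 0) _ gavd); fld.
have N2 : P (a' * q / d') (3 * l) != 0.
  by apply: (N (i := (2 * m).+1) (j := 0) _ gavd); rewrite /a' /d'; fld.
have N3 : P (a * q ^+ (2 * m + 3 * l).+1 / d) m != 0.
  by apply: (N (i := (2 * m + 3 * l).+1) (j := 0) _ gavd); fld.
have N4 : P (a * q ^+ (3 * n).+1) m != 0 by apply: (N (i := (3 * n).+1) (j := 0) _ ga); fld.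
have N5 : P a (3 * m) != 0 by apply: (N (i := 0) (j := 0) _ ga); fld.
have N6 : PQ Q m != 0 by apply: (poch_q_neq0 qn); rewrite nE leq_addr.
have N7 : PQ (d ^+ 2 * q / (a * q ^+ (3 * n))) m != 0.
  by apply: (NQ (i := 1) (j := 3 * n) _ gdda); fld.
have N8 : E (A * Q ^+ (2 * m)) != 0.
  by apply: (@orbit_neq0P _ _ (3 * (2 * m)) 1 _ gad); rewrite /A -exprM; fld.
have N9 := NA 0%N m; have N10 := NA m m; have N11 := NA (2 * m).+1 l; have N12 := NA n.+1 m.
rewrite expr0 mulr1 in N9.
move: N7.
rewrite (@poch_refl Q (d ^+ 2 * q / (a * q ^+ (3 * n))) (a * q ^+ 2 * Q ^+ l / d ^+ 2)) //;
  [|by nz|by nz|by rewrite nE; fld].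
rewrite mulf_eq0 negb_or => /andP[_ N7].
rewrite (@poch_refl q (d / (a * q ^+ (3 * n))) (a * q ^+ (2 * m + 3 * l).+1 / d)) //;
  [|by nz|by nz|by rewrite nE; fld].
rewrite (@poch_refl q (q / (d * Q ^+ m)) (d * q ^+ (2 * m))) //; [|by nz|by fld].
rewrite (@poch_refl Q (Q ^- m) Q) ?invr_neq0 ?expf_neq0 //; last by fld.
set al1 := (- (d / _)) ^+ m * q ^+ _; set al2 := (- (d ^+ 2 * q / _)) ^+ m * Q ^+ _.
set al3 := (- (q / _)) ^+ m * q ^+ _; set al4 := (- Q ^- m) ^+ m * Q ^+ _.
have al10 : al1 != 0 by rewrite /al1; nz.
have al20 : al2 != 0 by rewrite /al2; nz.
(* The signs and powers of the four reflections: the exponents quadratic in m cancel, since bases q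
   and q^3 each occur once on either side, and the m-th powers agree. *)
have alE : al3 = Q ^+ m * al4 * al1 / (al2 * q ^+ m).
  have pw : (- (q / (d * Q ^+ m))) ^+ m * ((- (d ^+ 2 * q / (a * q ^+ (3 * n)))) ^+ m * q ^+ m) =
      Q ^+ m * (- Q ^- m) ^+ m * (- (d / (a * q ^+ (3 * n)))) ^+ m.
    by rewrite -!exprMn; congr (_ ^+ _); rewrite nE; fld.
  apply: (mulIf (mulf_neq0 al20 (expf_neq0 m q0))); rewrite divfK; last by nz.
  rewrite /al1 /al2 /al3 /al4.
  transitivity ((- (q / (d * Q ^+ m))) ^+ m * ((- (d ^+ 2 * q / (a * q ^+ (3 * n)))) ^+ m * q ^+ m)
    * q ^+ 'C(m, 2) * Q ^+ 'C(m, 2)); first by ring.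
  by rewrite pw; ring.
have qm : q ^+ m != 0 by nz.
rewrite {}alE; clearbody al1 al2 al4; pgen.
by move: (q ^+ m) (Q ^+ m) qm => r1 r2 r10; field; nz.
Qed.

End Step.

Lemma cubic_transformation n a d b c :
  a != 0 -> d != 0 -> b != 0 -> c != 0 -> b * c * d = a * q ->
  qpow_neq0 Q n -> cubic_generic a d ->
  cubic_lhs n a d b c = cubic_coef n a d * cubic_rhs n a d b c.
Proof.
elim/ltn_ind: n a d b c => n IHn a d b c a0 d0 b0 c0 bcd qn gen.
pose mu := a * q / d.
have mu0 : mu != 0 by rewrite /mu; nz.
have Q0 : Q != 0 by nz.
have -> : c = mu / b.
  by apply: (mulIf b0); rewrite divfK // /mu; apply: (mulIf d0); rewrite divfK // -bcd; ring.
case: (gen) => ga gd gaa gad gavd gdda.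
(* The point a q^(3i) with i = 0 would reproduce the case n itself, so b = 1 takes its place. *)
pose pt i := if i is i'.+1 then a * Q ^+ i else 1.
have V2 := ethetaZ (cubic_coef n a d) (cubic_rhs_etheta n d a0 mu0).
apply: (etheta_interp (pt := pt) mu0 (cubic_lhs_etheta n d a0 mu0) V2) => // {b c b0 c0 bcd}.
- by move=> [|i] _ /=; [exact: oner_neq0|nz].
- move=> [|i] [|j] //= ij.
    rewrite div1r; apply: E_neq0V; first by nz.
    by apply: (@orbit_neq0P _ _ (3 * j.+1) 0 _ ga); fld.
  move: ij => /andP[ij jn].
  have [k jE] : exists k, j = (i + k.+1)%N by exists (j - i.+1)%N; lia.
  have -> : a * Q ^+ i.+1 / (a * Q ^+ j.+1) = (Q ^+ k.+1)^-1.
    rewrite jE; fld.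
  by apply: E_neq0V; [nz|apply: qn; lia].
- move=> [|i] [|j] //= ij.
    have -> : mu / (1 * (a * Q ^+ j.+1)) = (d * q ^+ (3 * j.+1) / q ^+ 1)^-1 by rewrite /mu; fld.
    by apply: E_neq0V; [nz|exact: gd].
  have -> : mu / (a * Q ^+ i.+1 * (a * Q ^+ j.+1)) = (a * d * q ^+ (3 * (i + j.+2)) / q ^+ 1)^-1.
    by rewrite /mu; fld.
  by apply: E_neq0V; [nz|exact: gad].
move=> [|m] mn; rewrite [pt _]/=; first by rewrite divr1; exact: cubic_at1.
have [l nE] : exists l, n = (m.+1 + l)%N by exists (n - m.+1)%N; rewrite subnKC.
have -> : mu / (a * Q ^+ m.+1) = q / (d * Q ^+ m.+1) by rewrite /mu; field; nz.
rewrite (@cubic_lhs_node n a d a0 d0 gen m.+1 l) //.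
rewrite IHn; [|lia|by nz|by nz|by nz|by nz| |by move=> k /andP[k0 kl]; apply: qn; lia|exact: cubic_generic_shift].
  by rewrite (@cubic_node_coef n a d a0 d0 gen qn m.+1 l).
by field; nz.
Qed.

End Cubic.
End EvenTheta.

(** * Generic parameters *)

Section Generic.
Variables (F : fieldType) (E : F -> F) (q : F).
Hypothesis E1 : E 1 = 0.
Hypothesis EV : forall x, x != 0 -> E x^-1 = - (E x / x).
Hypothesis Espan : forall m : F, m != 0 -> exists u v, forall s : F, s != 0 ->
  exists al be, forall x : F, x != 0 -> E (s * x) * E (s * m / x) = al * u x + be * v x.
Hypothesis q0 : q != 0.
Local Notation Q := (q ^+ 3).
Local Notation P := (poch E q).
Local Notation PQ := (poch E (q ^+ 3)).

Ltac pgen :=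
  repeat match goal with
  | H : is_true (poch _ _ _ _ != 0) |- _ => revert H
  | H : is_true (E _ != 0) |- _ => revert H
  end;
  repeat match goal with
  | |- context [poch ?G ?Q ?a ?n] => let x := fresh "x" in move: (poch G Q a n); intro x
  | |- context [E ?a] => let x := fresh "x" in move: (E a); intro x
  end; intros.

(** [pochs], [pomega], [transf_lhs] and [transf_rhs] mirror the expressions of the theorem over a
    field. For [R[i]] and [Etheta p] they agree with them by conversion, so the theorem is obtained
    as an instance. *)
Definition pochs r s n := \prod_(x <- s) poch E r x n.

Lemma pochs1 r x n : pochs r [:: x] n = poch E r x n. Proof. exact: big_seq1. Qed.

Lemma pochs_cons r x s n : pochs r (x :: s) n = poch E r x n * pochs r s n.
Proof. exact: big_cons. Qed.

Definition pochsE := (pochs1, pochs_cons).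

Definition pomega a1 s n := \sum_(k < n.+1) E (a1 * Q ^+ (2 * k)) / E a1
  * pochs Q (a1 :: s) k * Q ^+ k / pochs Q (Q :: [seq a1 * Q / x | x <- s]) k.

(* Multiplicative independence modulo the zeros of [E] and powers of [q]. *)
Definition generic3 (a b c : F) := forall i1 j1 k1 l1 i2 j2 k2 l2 : nat,
  (i1, j1, k1) != (i2, j2, k2) ->
  E (a ^+ i1 * b ^+ j1 * c ^+ k1 * q ^+ l1 / (a ^+ i2 * b ^+ j2 * c ^+ k2 * q ^+ l2)) != 0.

Definition transf_lhs n a b c d e := \sum_(k < n.+1)
  E (a * q ^+ (4 * k)) / E a
  * pochs q [:: b; c] k / pochs Q [:: a * Q / b; a * Q / c] k
  * P d (2 * k) / P (a * q / d) (2 * k)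
  * pochs Q [:: e; q ^- (3 * n)] k / pochs q [:: a * q / e; a * q ^+ (3 * n + 1)] k * q ^+ k.

Definition transf_rhs n a b c d e f :=
  pochs Q [:: a * Q; a ^+ 2 * Q / (b * c * e); a ^+ 2 * Q / (b * d * e * f); a * f * Q / (c * d)] n
  / pochs Q [:: a ^+ 2 * Q / (b * e * f); a * f * Q / c; a * Q / d; a ^+ 2 * Q / (b * c * d * e)] n
  * pomega (a * f / c) [:: a / c; f * Q / c; b * e * f / a; d; d * q; f; q ^- (3 * n)] n.

(** Passes between a 10 omega 9 and the form with cleared denominators. The positions matter: x1 and
    x5 are the pair kept outside the weight, and x4 takes the place of g; Bailey's transformation
    fixes these three. *)
Lemma pomega_vwp n A x1 x2 x3 x4 x5 x6 :
  A != 0 -> x1 != 0 -> x5 != 0 -> E A != 0 ->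
  (forall j, (j <= n)%N -> PQ (A * Q / x1) j != 0) ->
  (forall j, (j <= n)%N -> PQ (A * Q / x5) j != 0) ->
  vwp_sum E Q n A (bailey_weight E Q A x2 x3 x6 x4) x1 x5 =
  E A * PQ (A * Q / x1) n * PQ (A * Q / x5) n
    * pomega A [:: x1; x2; x3; x4; x5; x6; q ^- (3 * n)] n.
Proof.
move=> A0 x10 x50 EA N1 N5; rewrite /vwp_sum /pomega big_distrr /=; apply: eq_bigr => j _.
have jn : (j <= n)%N by rewrite -ltnS.
move: (nat_of_ord j) jn => {}j jn.
rewrite !pochsE /bailey_weight.
have -> : A * Q / q ^- (3 * n) = A * Q ^+ n.+1 by fld.
have -> : Q ^- n = q ^- (3 * n) by rewrite exprM.
have S x : x != 0 -> PQ (A * Q / x) n = PQ (A * Q / x) j * PQ (A * Q ^+ j.+1 / x) (n - j).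
  by move=> x0; rewrite (pochB E Q (A * Q / x) jn); congr (_ * PQ _ _); fld.
rewrite !S //; have := N1 j jn; have := N5 j jn; rewrite !invfM => M1 M5.
move: (PQ Q j)^-1 (PQ (A * Q ^+ n.+1) j)^-1 (PQ (A * Q / x2) j)^-1 (PQ (A * Q / x3) j)^-1
  (PQ (A * Q / x4) j)^-1 (PQ (A * Q / x6) j)^-1 => y1 y2 y3 y4 y5 y6.
by pgen; field; nz.
Qed.

Section Params.
Variables (a b c : F) (n : nat).
Hypotheses (a0 : a != 0) (b0 : b != 0) (c0 : c != 0) (gen : generic3 a b c).
Hypothesis qn : qpow_neq0 E Q n.

(** In the applications below the eight numbers are the exponents of a, b, c, q in the numerator and
    then in the denominator. *)
Lemma generic_orbit i1 j1 k1 l1 i2 j2 k2 l2 x : (i1, j1, k1) != (i2, j2, k2) ->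
  x = a ^+ i1 * b ^+ j1 * c ^+ k1 * q ^+ l1 / (a ^+ i2 * b ^+ j2 * c ^+ k2 * q ^+ l2) ->
  orbit_neq0 E q x.
Proof.
move=> ijk -> u v; have := @gen i1 j1 k1 (l1 + u)%N i2 j2 k2 (l2 + v)%N ijk.
by rewrite !exprD; congr (E _ != 0); fld.
Qed.

Lemma generic_neq0 i1 j1 k1 l1 i2 j2 k2 l2 x : (i1, j1, k1) != (i2, j2, k2) ->
  x = a ^+ i1 * b ^+ j1 * c ^+ k1 * q ^+ l1 / (a ^+ i2 * b ^+ j2 * c ^+ k2 * q ^+ l2) ->
  E x != 0.
Proof.
by move=> ijk xE; have := generic_orbit ijk xE 0%N 0%N; rewrite expr0 mulr1 divr1.
Qed.

Let go := generic_orbit.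
Let ge := generic_neq0.

Let NQ x i j k y : orbit_neq0 E q x -> y = x * q ^+ i / q ^+ j -> PQ y k != 0.
Proof. exact: (@poch_orbit_neq0 _ E Q q x y k i j 3 erefl). Qed.
Let N x i j k y : orbit_neq0 E q x -> y = x * q ^+ i / q ^+ j -> P y k != 0.
Proof. exact: (@poch_orbit_neq0 _ E q q x y k i j 1 erefl). Qed.

Let Q0 : Q != 0. Proof. exact: expf_neq0. Qed.

(** The balancing conditions b c d = a q and d e = a^2 q^(3n+1), solved for d and e; A is a f / c
    for f = a/b. *)
Let d := a * q / (b * c).
Let e := a * b * c * q ^+ (3 * n).
Let A := a ^+ 2 / (b * c).

Let d0 : d != 0. Proof. by rewrite /d; nz. Qed.
Let e0 : e != 0. Proof. by rewrite /e; nz. Qed.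
Let A0 : A != 0. Proof. by rewrite /A; nz. Qed.

Lemma generic_cubic : cubic_generic E q a d.
Proof.
split.
- by apply: (@go 1 0 0 0 0 0 0 0) => //; fld.
- by apply: (@go 1 0 0 1 0 1 1 0) => //; rewrite /d; fld.
- by apply: (@go 2 0 0 0 0 0 0 0) => //; fld.
- by apply: (@go 2 0 0 1 0 1 1 0) => //; rewrite /d; fld.
- by apply: (@go 0 1 1 0 0 0 0 1) => //; rewrite /d; fld.
- by apply: (@go 1 0 0 2 0 2 2 0) => //; rewrite /d; fld.
Qed.

(** Modulo 3, (d; q)_(3j) yields the parameters d, d q, d q^2, and (a; q)_(3j) yields the matching
    denominators a q^2, a q, a, because A q^3 = a d q^2. *)
Lemma pomega_cubic_rhs :
  cubic_rhs E q n a d b c = E A * PQ (a * Q / b) n * PQ (a * Q / c) n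
    * pomega A [:: a / c; d * q ^+ 2; e; d; d * q; a / b; q ^- (3 * n)] n.
Proof.
rewrite /cubic_rhs /pomega big_distrr /=; apply: eq_bigr => j _.
have jn : (j <= n)%N by rewrite -ltnS.
move: (nat_of_ord j) jn => {}j jn.
have EA : E A != 0 by apply: (@ge 2 0 0 0 0 1 1 0) => //; rewrite /A; fld.
rewrite !pochsE.
have -> : A * Q / (a / c) = a * Q / b by rewrite /A; fld.
have -> : A * Q / (d * q ^+ 2) = a by rewrite /A /d; fld.
have -> : A * Q / d = a * q ^+ 2 by rewrite /A /d; fld.
have -> : A * Q / (d * q) = a * q by rewrite /A /d; fld.
have -> : A * Q / (a / b) = a * Q / c by rewrite /A /d; fld.
have -> : A * Q / q ^- (3 * n) = A * Q ^+ n.+1 by rewrite /A; fld.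
have -> : A * Q / e = d ^+ 2 * q / (a * q ^+ (3 * n)) by rewrite /A /d /e; fld.
have -> : a ^+ 2 * q ^+ (3 * n).+1 / d = e by rewrite /e /d; fld.
have -> : a * d / q = A by rewrite /A /d; fld.
have -> : Q ^- n = q ^- (3 * n) by rewrite exprM.
rewrite !poch_triple.
have Sb : PQ (a * Q / b) n = PQ (a * Q / b) j * PQ (a * Q ^+ j.+1 / b) (n - j).
  by rewrite (pochB E Q (a * Q / b) jn); congr (_ * PQ _ _); fld.
have Sc : PQ (a * Q / c) n = PQ (a * Q / c) j * PQ (a * Q ^+ j.+1 / c) (n - j).
  by rewrite (pochB E Q (a * Q / c) jn); congr (_ * PQ _ _); fld.
rewrite Sb Sc.
have N1 : PQ (a * Q / b) j != 0 by apply: (@NQ _ 3 0 _ _ (@go 1 0 0 0 0 1 0 0 _ isT erefl)); fld.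
have N2 : PQ (a * Q / c) j != 0 by apply: (@NQ _ 3 0 _ _ (@go 1 0 0 0 0 0 1 0 _ isT erefl)); fld.
have oa := @go 1 0 0 0 0 0 0 0 _ isT erefl.
have N3 : PQ a j != 0 by apply: (@NQ _ 0 0 _ _ oa); fld.
have N4 : PQ (a * q) j != 0 by apply: (@NQ _ 1 0 _ _ oa); fld.
have N5 : PQ (a * q ^+ 2) j != 0 by apply: (@NQ _ 2 0 _ _ oa); fld.
have N6 : PQ Q j != 0 by apply: poch_q_neq0 jn.
have N7 : PQ (A * Q ^+ n.+1) j != 0.
  by apply: (@NQ _ (3 * n.+1) 0 _ _ (@go 2 0 0 0 0 1 1 0 _ isT erefl)); rewrite /A; fld.
have N8 : PQ (d ^+ 2 * q / (a * q ^+ (3 * n))) j != 0.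
  by apply: (@NQ _ 3 (3 * n) _ _ (@go 1 0 0 0 0 2 2 0 _ isT erefl)); rewrite /d; fld.
by pgen; field; nz.
Qed.

(** In a ratio of two reflections of equal length the signs and the quadratic exponents cancel. *)
Lemma poch_ratio r x y x' y' : r != 0 -> x != 0 -> y != 0 -> x' != 0 -> y' != 0 ->
  x * y * r ^+ n = r -> x' * y' * r ^+ n = r ->
  poch E r x n * poch E r y' n * x' ^+ n = poch E r x' n * poch E r y n * x ^+ n.
Proof.
move=> r0 x0 y0 x0' y0' xy xy'.
rewrite (poch_refl EV r0 x0 y0 xy) (poch_refl EV r0 x0' y0' xy') [(- x) ^+ n]exprNn [(- x') ^+ n]exprNn.
by ring.
Qed.

Lemma cubic_coef_prod :
  cubic_coef E q n a d * E A =
  E a * (PQ (a * Q) n * PQ (A * Q / e) n * PQ (a * Q / (d * e)) n * PQ (A * Q / d) n)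
  / (PQ (a * Q / e) n * PQ (A * Q) n * PQ (a * Q / d) n * PQ (A * Q / (d * e)) n).
Proof.
have EA : E A != 0 by apply: (@ge 2 0 0 0 0 1 1 0) => //; rewrite /A; fld.
have oA := @go 2 0 0 0 0 1 1 0 _ isT erefl.
have obc := @go 0 1 1 0 0 0 0 0 _ isT erefl.
have oa := @go 1 0 0 0 0 0 0 0 _ isT erefl.
rewrite /cubic_coef [P a _]pochSl !poch_triple.
have -> : a * d / q = A by rewrite /A /d; fld.
rewrite [PQ A n.+1]pochSl.
have -> : a * q / d * q = a * q ^+ 2 / d by fld.
have -> : a * q / d * q ^+ 2 = a * Q / d by fld.
have -> : a * q * q = a * q ^+ 2 by fld.
have -> : a * q * q ^+ 2 = a * Q by fld.
have -> : A * Q / d = a * q ^+ 2 by rewrite /A /d; fld.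
have de0 : d * e != 0 by nz.
(* Since e carries q^(3n), each factor with e is the reflection of one without e. The powers left
   over from [R1] and [R2] cancel by [pw]. *)
have R1 : PQ (A * Q / e) n * PQ (a * q / d) n * (a * Q / e) ^+ n =
    PQ (a * Q / e) n * PQ (a * q ^+ 2 / d ^+ 2) n * (A * Q / e) ^+ n.
  apply: poch_ratio; try nz; rewrite /A /e /d; fld.
have R2 : PQ (a * Q / (d * e)) n * PQ (a * q ^+ 2 / d) n * (A * Q / (d * e)) ^+ n =
    PQ (A * Q / (d * e)) n * PQ (a * q) n * (a * Q / (d * e)) ^+ n.
  apply: poch_ratio; try nz; rewrite /A /e /d; fld.
have pw : (A * Q / e) ^+ n * (a * Q / (d * e)) ^+ n = (a * Q / e) ^+ n * (A * Q / (d * e)) ^+ n.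
  by rewrite -!exprMn; congr (_ ^+ _); fld.
have M1 : (a * Q / e) ^+ n != 0 by nz.
have M2 : (A * Q / (d * e)) ^+ n != 0 by nz.
have N1 : PQ (a * q / d) n != 0 by apply: (@NQ _ 0 0 _ _ obc); rewrite /d; fld.
have N2 : PQ (a * q ^+ 2 / d) n != 0 by apply: (@NQ _ 1 0 _ _ obc); rewrite /d; fld.
have N3 : PQ (a * Q / d) n != 0 by apply: (@NQ _ 2 0 _ _ obc); rewrite /d; fld.
have N4 : PQ (A * Q) n != 0 by apply: (@NQ _ 3 0 _ _ oA); rewrite /A; fld.
have N5 : PQ (a * Q / e) n != 0.
  by apply: (@NQ _ 3 (3 * n) _ _ (@go 0 0 0 0 0 1 1 0 _ isT erefl)); rewrite /e; fld.
have N6 : PQ (A * Q / (d * e)) n != 0.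
  by apply: (@NQ _ 2 (3 * n) _ _ (@go 0 0 0 0 0 1 1 0 _ isT erefl)); rewrite /A /d /e; fld.
have N7 : PQ (a * q) n != 0 by apply: (@NQ _ 1 0 _ _ oa); fld.
have K : PQ (a * q ^+ 2 / d ^+ 2) n = PQ (A * Q / e) n * PQ (a * Q / (d * e)) n
    * (PQ (a * q / d) n * PQ (a * q ^+ 2 / d) n)
    / (PQ (a * q) n * (PQ (a * Q / e) n * PQ (A * Q / (d * e)) n)).
  apply: (mulIf (mulf_neq0 N7 (mulf_neq0 N5 N6))); rewrite divfK; last by nz.
  apply: (mulfI (mulf_neq0 M1 M2)); rewrite -{1}pw.
  transitivity ((PQ (a * Q / e) n * PQ (a * q ^+ 2 / d ^+ 2) n * (A * Q / e) ^+ n)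
    * (PQ (A * Q / (d * e)) n * PQ (a * q) n * (a * Q / (d * e)) ^+ n)).
    by ring.
  by rewrite -R1 -R2; ring.
by rewrite K {K R1 R2 pw M1 M2}; pgen; field; nz.
Qed.

Let lhs_sum := transf_lhs n a b c d e.

Let EA : E A != 0. Proof. by apply: (@ge 2 0 0 0 0 1 1 0) => //; rewrite /A; fld. Qed.
Let Ea : E a != 0. Proof. by apply: (@ge 1 0 0 0 0 0 0 0) => //; fld. Qed.

Let Nb j : PQ (a * Q / b) j != 0.
Proof. by apply: (@NQ _ 3 0 _ _ (@go 1 0 0 0 0 1 0 0 _ isT erefl)); fld. Qed.

Let Nc j : PQ (a * Q / c) j != 0.
Proof. by apply: (@NQ _ 3 0 _ _ (@go 1 0 0 0 0 0 1 0 _ isT erefl)); fld. Qed.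

Lemma lhs_sumE : lhs_sum = cubic_lhs E q n a d b c / (E a * PQ (a * Q / b) n * PQ (a * Q / c) n).
Proof.
apply: (mulIf (mulf_neq0 (mulf_neq0 Ea (Nb n)) (Nc n))); rewrite divfK; last by nz.
rewrite /lhs_sum /transf_lhs /cubic_lhs big_distrl /=; apply: eq_bigr => j _.
have jn : (j <= n)%N by rewrite -ltnS.
move: (nat_of_ord j) jn => {}j jn.
rewrite !pochsE.
have -> : a ^+ 2 * q ^+ (3 * n).+1 / d = e by rewrite /e /d; fld.
have -> : Q ^- n = q ^- (3 * n) by rewrite exprM.
have -> : d / (a * q ^+ (3 * n)) = a * q / e by rewrite /e /d; fld.
rewrite addn1.
have Sb : PQ (a * Q / b) n = PQ (a * Q / b) j * PQ (a * Q ^+ j.+1 / b) (n - j).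
  by rewrite (pochB E Q (a * Q / b) jn); congr (_ * PQ _ _); fld.
have Sc : PQ (a * Q / c) n = PQ (a * Q / c) j * PQ (a * Q ^+ j.+1 / c) (n - j).
  by rewrite (pochB E Q (a * Q / c) jn); congr (_ * PQ _ _); fld.
rewrite Sb Sc; have N1 := Nb j; have N2 := Nc j; have N3 := Ea.
rewrite [(P (a * q / e) j * _)^-1]invfM.
move: (P (a * q / d) (2 * j))^-1 (P (a * q / e) j)^-1 (P (a * q ^+ (3 * n).+1) j)^-1 => y1 y2 y3.
by pgen; field; nz.
Qed.

Lemma lhs_sum_omega : lhs_sum =
  PQ (a * Q) n * PQ (A * Q / e) n * PQ (a * Q / (d * e)) n * PQ (A * Q / d) n
  / (PQ (a * Q / e) n * PQ (A * Q) n * PQ (a * Q / d) n * PQ (A * Q / (d * e)) n)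
  * pomega A [:: a / c; d * q ^+ 2; e; d; d * q; a / b; q ^- (3 * n)] n.
Proof.
rewrite lhs_sumE (cubic_transformation E1 EV Espan) //; last exact: generic_cubic.
  rewrite pomega_cubic_rhs.
  transitivity (cubic_coef E q n a d * E A / E a
    * pomega A [:: a / c; d * q ^+ 2; e; d; d * q; a / b; q ^- (3 * n)] n).
    have := Ea; have := Nb n; have := Nc n; move: (pomega _ _ _) (cubic_coef _ _ _ _ _) => w k.
    by pgen; field; nz.
  rewrite cubic_coef_prod; have := Ea; move: (pomega _ _ _)
    (PQ (a * Q / e) n * PQ (A * Q) n * PQ (a * Q / d) n * PQ (A * Q / (d * e)) n)^-1 => w k.
  by pgen; field; nz.
by rewrite /d; fld.
Qed.

(** This is a f / c for f = a/e. *)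
Let la := a ^+ 2 / (c * e).
Let la0 : la != 0. Proof. by rewrite /la; nz. Qed.

(** Bailey's transformation in base q^3 with a/c, d q and d kept: the scaling by la/A sends d q^2,
    e, a/b to a q^3/(c e), b, a/e. *)
Lemma omega_bailey :
  PQ (a * Q) n * PQ (A * Q / e) n * PQ (a * Q / (d * e)) n * PQ (A * Q / d) n
  / (PQ (a * Q / e) n * PQ (A * Q) n * PQ (a * Q / d) n * PQ (A * Q / (d * e)) n)
  * pomega A [:: a / c; d * q ^+ 2; e; d; d * q; a / b; q ^- (3 * n)] n =
  PQ (a * Q) n * PQ (A * Q / e) n * PQ (a * Q / (b * d)) n * PQ (la * Q / d) n
  / (PQ (a * Q / b) n * PQ (la * Q) n * PQ (a * Q / d) n * PQ (A * Q / (d * e)) n)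
  * pomega la [:: a / c; a * Q / (c * e); b; d; d * q; a / e; q ^- (3 * n)] n.
Proof.
have oA := @go 2 0 0 0 0 1 1 0 _ isT erefl.
have ola : orbit_neq0 E q la by apply: (@go 1 0 0 0 0 1 2 (3 * n)) => //; rewrite /la /e; fld.
have Ela : E la != 0 by have := ola 0%N 0%N; rewrite expr0 mulr1 divr1.
have ac0 : a / c != 0 by nz.
have dq0 : d * q != 0 by nz.
have oX i j x y : orbit_neq0 E q x -> y = x * q ^+ i / q ^+ j -> orbit_neq0 E Q y.
  exact: orbit_neq0X.
have oa := @go 1 0 0 0 0 0 0 0 _ isT erefl.
have obc := @go 0 1 1 0 0 0 0 0 _ isT erefl.
have := @elliptic_bailey F E E1 EV Espan Q Q0 n A (d * q ^+ 2) e (a / b) d la (a / c) (d * q).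
have -> : la * (d * q ^+ 2) / A = a * Q / (c * e) by rewrite /la /A /d; fld.
have -> : la * e / A = b by rewrite /la /A; fld.
have -> : la * (a / b) / A = a / e by rewrite /la /A; fld.
have M1 j : PQ (A * Q / (a / c)) j != 0.
  by apply: (@NQ _ 3 0 _ _ (@go 1 0 0 0 0 1 0 0 _ isT erefl)); rewrite /A; fld.
have M2 j : PQ (A * Q / (d * q)) j != 0.
  by apply: (@NQ _ 1 0 _ _ oa); rewrite /A /d; fld.
have M3 j : PQ (la * Q / (a / c)) j != 0.
  by apply: (@NQ _ 3 (3 * n) _ _ (@go 0 0 0 0 0 1 1 0 _ isT erefl)); rewrite /la /e; fld.
have M4 j : PQ (la * Q / (d * q)) j != 0.
  by apply: (@NQ _ 1 (3 * n) _ _ (@go 0 0 0 0 0 0 1 0 _ isT erefl)); rewrite /la /e /d; fld.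
rewrite !pomega_vwp //.
move=> H; have {}H := H A0 _ e0 _ d0 la0 ac0 dq0 _ _ qn.
have : E A * PQ (A * Q / (a / c)) n * PQ (A * Q / (d * q)) n
    * pomega A [:: a / c; d * q ^+ 2; e; d; d * q; a / b; q ^- (3 * n)] n =
  PQ A n.+1 * PQ (la * Q / d) n / (PQ (A * Q / d) n * PQ la n.+1) * (A / la) ^+ n
  * (E la * PQ (la * Q / (a / c)) n * PQ (la * Q / (d * q)) n
    * pomega la [:: a / c; a * Q / (c * e); b; d; d * q; a / e; q ^- (3 * n)] n).
  apply: H; first by nz.
  - by nz.
  - by rewrite /la /A /d /e; fld.
  - by rewrite /la /A /d /e; fld.
  - by apply: (oX 0 0 _ _ oA); rewrite /A; fld.
  - by apply: (oX 0 0 _ _ ola); fld.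
  - by apply: (oX 0 3 _ _ oa); rewrite /A /d; fld.
  - by apply: (oX 0 (3 * n) _ _ (@go 1 0 0 0 0 2 2 0 _ isT erefl)); rewrite /A /e; fld.
  - by apply: (oX 0 0 _ _ (@go 1 0 0 0 0 0 1 0 _ isT erefl)); rewrite /A; fld.
  - by apply: (oX 0 1 _ _ oa); rewrite /A /d; fld.
  - by apply: (oX 0 (3 * n + 1) _ _ (@go 0 0 0 0 0 0 1 0 _ isT erefl)); rewrite /la /d /e; fld.
  - by apply: (oX 0 (3 * n + 1) _ _ (@go 2 0 0 0 0 1 2 0 _ isT erefl)); rewrite /la /A /d /e; fld.
  - by apply: (oX 0 (3 * n) _ _ (@go 2 0 0 0 0 2 2 0 _ isT erefl)); rewrite /la /e; fld.
  - by apply: (oX 0 0 _ _ (@go 1 0 0 0 0 1 0 0 _ isT erefl)); fld.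
have -> : A * Q / (a / c) = a * Q / b by rewrite /A; fld.
have -> : la * Q / (a / c) = a * Q / e by rewrite /la; fld.
have A_dq : A * Q / (d * q) = a * q by rewrite /A /d; fld.
rewrite A_dq ![PQ _ n.+1]pochSl; move: (pomega _ _ _) (pomega _ _ _) => w2 w1 Hw.
set k := (A / la) ^+ n in Hw.
have de0 : d * e != 0 by nz.
have bdE : a * Q / (b * d) = c * q ^+ 2 by rewrite /d; fld.
have k0 : k != 0 by rewrite /k; nz.
(* The power (A/la)^n of Bailey's transformation is absorbed by a ratio of reflections, which
   exchanges a q^3/(d e) for a q^3/(b d). *)
have K : PQ (a * Q / (d * e)) n = PQ (a * Q / (b * d)) n * PQ (a * q) n / (PQ (la * Q / (d * q)) n * k).
  apply: (mulIf (mulf_neq0 (M4 n) k0)); rewrite divfK; last by rewrite mulf_neq0.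
  have z0 : (a * Q / (d * e)) ^+ n != 0 by nz.
  apply: (mulIf z0); rewrite bdE.
  transitivity (PQ (a * Q / (d * e)) n * PQ (la * Q / (d * q)) n * (c * q ^+ 2) ^+ n).
    rewrite -mulrA -[_ * k * _]mulrA /k -exprMn.
    have -> : A / la * (a * Q / (d * e)) = c * q ^+ 2 by rewrite /A /la /d; fld.
    by rewrite !mulrA.
  apply: poch_ratio; try nz; rewrite /la /d /e; fld.
have N1 := M2 n; have N2 := M3 n; have N3 := M4 n; have N4 := Nb n.
rewrite A_dq in N1.
have laE : la * Q / (a / c) = a * Q / e by rewrite /la; fld.
rewrite laE in N2.
have N5 : PQ (A * Q) n != 0 by apply: (@NQ _ 3 0 _ _ oA); rewrite /A; fld.
have N6 : PQ (la * Q) n != 0 by apply: (@NQ _ 3 0 _ _ ola); fld.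
have N7 : PQ (A * Q / d) n != 0 by apply: (@NQ _ 2 0 _ _ oa); rewrite /A /d; fld.
have N8 : PQ (a * Q / d) n != 0 by apply: (@NQ _ 2 0 _ _ obc); rewrite /d; fld.
have N9 : PQ (A * Q / (d * e)) n != 0.
  by apply: (@NQ _ 2 (3 * n) _ _ (@go 0 0 0 0 0 1 1 0 _ isT erefl)); rewrite /A /d /e; fld.
have N10 := EA.
have -> : w1 = E A * PQ (A * Q) n * PQ (la * Q / d) n / (PQ (A * Q / d) n * (E la * PQ (la * Q) n))
  * k * (E la * PQ (a * Q / e) n * PQ (la * Q / (d * q)) n * w2)
  / (E A * PQ (a * Q / b) n * PQ (a * q) n).
  by rewrite -Hw [X in X / _]mulrC mulfK // !mulf_neq0.
rewrite K {K Hw}; clearbody k; pgen; field; nz.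
Qed.

Lemma generic_transformation f : f = a / b \/ f = a / e ->
  transf_lhs n a b c d e = transf_rhs n a b c d e f.
Proof.
have X1 : a ^+ 2 * Q / (b * c * e) = A * Q / e by rewrite /A; fld.
have X2 : a ^+ 2 * Q / (b * c * d * e) = A * Q / (d * e) by rewrite /A; fld.
case=> ->; rewrite /transf_rhs !pochsE X1 X2 -/lhs_sum lhs_sum_omega.
  have -> : a ^+ 2 * Q / (b * d * e * (a / b)) = a * Q / (d * e) by fld.
  have -> : a * (a / b) * Q / (c * d) = A * Q / d by rewrite /A; fld.
  have -> : a ^+ 2 * Q / (b * e * (a / b)) = a * Q / e by fld.
  have -> : a * (a / b) * Q / c = A * Q by rewrite /A; fld.
  have -> : a * (a / b) / c = A by rewrite /A; fld.
  have -> : a / b * Q / c = d * q ^+ 2 by rewrite /d; fld.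
  have -> : b * e * (a / b) / a = e by fld.
  by rewrite !mulrA.
rewrite omega_bailey.
have -> : a ^+ 2 * Q / (b * d * e * (a / e)) = a * Q / (b * d) by fld.
have -> : a * (a / e) * Q / (c * d) = la * Q / d by rewrite /la; fld.
have -> : a ^+ 2 * Q / (b * e * (a / e)) = a * Q / b by fld.
have -> : a * (a / e) * Q / c = la * Q by rewrite /la; fld.
have -> : a * (a / e) / c = la by rewrite /la; fld.
have -> : a / e * Q / c = a * Q / (c * e) by fld.
have -> : b * e * (a / e) / a = b by fld.
by rewrite !mulrA.
Qed.

End Params.
End Generic.

(** * Passage to the limit *)

(* The limit [T] is abstract: over [R[i]], unification would unfold complex multiplication. *)
Section AbstractLimits.
Variables (F : fieldType) (E : F -> F) (T : (nat -> F) -> F -> Prop).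
Hypothesis Text : forall u v l, (forall i, u i = v i) -> T u l -> T v l.
Hypothesis Tcst : forall x, T (fun=> x) x.
Hypothesis TM : forall u v x y, T u x -> T v y -> T (fun i => u i * v i) (x * y).
Hypothesis TV : forall u x, x != 0 -> T u x -> T (fun i => (u i)^-1) x^-1.
Hypothesis TX : forall u x k, T u x -> T (fun i => u i ^+ k) (x ^+ k).
Hypothesis Tsum : forall m (u : nat -> nat -> F) l, (forall k, (k < m)%N -> T (u k) (l k)) ->
  T (fun i => \sum_(k < m) u k i) (\sum_(k < m) l k).
Hypothesis Tprod : forall m (u : nat -> nat -> F) l, (forall k, (k < m)%N -> T (u k) (l k)) ->
  T (fun i => \prod_(k < m) u k i) (\prod_(k < m) l k).
Hypothesis TE : forall u x, x != 0 -> T u x -> T (fun i => E (u i)) (E x).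

Lemma lim_poch r u x k : r != 0 -> x != 0 -> T u x ->
  T (fun i => poch E r (u i) k) (poch E r x k).
Proof.
move=> r0 x0 ux; apply: (@Tprod k (fun j i => E (u i * r ^+ j)) (fun j => E (x * r ^+ j))) => j _.
apply: TE; first by rewrite mulf_neq0 // expf_neq0.
exact: TM ux (Tcst _).
Qed.

Lemma lim_pochs1 r u x k : r != 0 -> x != 0 -> T u x ->
  T (fun i => pochs E r [:: u i] k) (pochs E r [:: x] k).
Proof.
move=> r0 x0 ux; rewrite pochs1; apply: Text (lim_poch k r0 x0 ux) => i.
by rewrite pochs1.
Qed.

Lemma lim_pochs r u x s t k : r != 0 -> x != 0 -> T u x ->
  T (fun i => pochs E r (s i) k) (pochs E r t k) ->
  T (fun i => pochs E r (u i :: s i) k) (pochs E r (x :: t) k).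
Proof.
move=> r0 x0 ux st; rewrite pochs_cons; apply: Text (TM (lim_poch k r0 x0 ux) st) => i.
by rewrite pochs_cons.
Qed.

Ltac neq := by rewrite ?(mulf_neq0, expf_neq0, invr_neq0).
(** Follows the syntax of the limit expression. At an inverse, nonvanishing comes from a denominator
    hypothesis in the context or from nonzero parameters. *)
Ltac lim_tac := lazymatch goal with
  | |- T (fun _ => ?x) _ => exact (Tcst x)
  | |- T (fun i => GRing.exp (@?X i) ?k) (GRing.exp ?x _) =>
      refine (@TX X x k _); lim_tac
  | |- T (fun i => GRing.inv (@?X i)) (GRing.inv ?x) =>
      refine (@TV X x _ _); [first [assumption|neq]|lim_tac]
  | |- T (fun i => GRing.mul (@?X i) (@?Y i)) (GRing.mul ?x ?y) =>
      refine (@TM X Y x y _ _); lim_tac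
  | |- T (fun i => E (@?X i)) (E ?x) => refine (@TE X x _ _); [neq|lim_tac]
  | |- T (fun i => poch _ ?r (@?U i) ?k) (poch _ _ ?x _) =>
      refine (@lim_poch r U x k _ _ _); [neq|neq|lim_tac]
  | |- T (fun i => pochs _ ?r (cons (@?U i) nil) ?k) (pochs _ _ (cons ?x nil) _) =>
      refine (@lim_pochs1 r U x k _ _ _); [neq|neq|lim_tac]
  | |- T (fun i => pochs _ ?r (cons (@?U i) (@?S i)) ?k) (pochs _ _ (cons ?x ?t) _) =>
      refine (@lim_pochs r U x S t k _ _ _ _); [neq|neq|lim_tac|lim_tac]
  | _ => assumption
  end.

Variables (q : F) (n : nat).
Hypothesis q0 : q != 0.
Local Notation Q := (q ^+ 3).

Section Limits.
Variables (a b c d e f : F) (a_ b_ c_ d_ e_ f_ : nat -> F).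
Hypotheses (a0 : a != 0) (b0 : b != 0) (c0 : c != 0) (d0 : d != 0) (e0 : e != 0) (f0 : f != 0).
Hypotheses (ta : T a_ a) (tb : T b_ b) (tc : T c_ c) (td : T d_ d) (te : T e_ e) (tf : T f_ f).

Lemma lim_transf_lhs :
  E a != 0 ->
  (forall k : nat, (k <= n)%N ->
     [/\ pochs E Q [:: a * Q / b; a * Q / c] k != 0,
         poch E q (a * q / d) (2 * k) != 0 &
         pochs E q [:: a * q / e; a * q ^+ (3 * n + 1)] k != 0]) ->
  T (fun i => transf_lhs E q n (a_ i) (b_ i) (c_ i) (d_ i) (e_ i)) (transf_lhs E q n a b c d e).
Proof.
move=> Ea den.
apply: (@Tsum n.+1 (fun k i => E (a_ i * q ^+ (4 * k)) / E (a_ i)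
  * pochs E q [:: b_ i; c_ i] k / pochs E Q [:: a_ i * Q / b_ i; a_ i * Q / c_ i] k
  * poch E q (d_ i) (2 * k) / poch E q (a_ i * q / d_ i) (2 * k)
  * pochs E Q [:: e_ i; q ^- (3 * n)] k
  / pochs E q [:: a_ i * q / e_ i; a_ i * q ^+ (3 * n + 1)] k * q ^+ k)
 (fun k => E (a * q ^+ (4 * k)) / E a
  * pochs E q [:: b; c] k / pochs E Q [:: a * Q / b; a * Q / c] k
  * poch E q d (2 * k) / poch E q (a * q / d) (2 * k)
  * pochs E Q [:: e; q ^- (3 * n)] k
  / pochs E q [:: a * q / e; a * q ^+ (3 * n + 1)] k * q ^+ k)) => k.
by rewrite ltnS => /den [D1 D2 D3]; lim_tac.
Qed.

Lemma lim_transf_rhs :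
  pochs E Q [:: a ^+ 2 * Q / (b * e * f); a * f * Q / c;
                       a * Q / d; a ^+ 2 * Q / (b * c * d * e)] n != 0 ->
  E (a * f / c) != 0 ->
  (forall k : nat, (k <= n)%N ->
     pochs E Q (Q :: [seq a * f / c * Q / ai
                  | ai <- [:: a / c; f * Q / c; b * e * f / a; d; d * q; f; q ^- (3 * n)]]) k != 0) ->
  T (fun i => transf_rhs E q n (a_ i) (b_ i) (c_ i) (d_ i) (e_ i) (f_ i))
    (transf_rhs E q n a b c d e f).
Proof.
move=> D1 EA den; rewrite /transf_rhs; apply: TM; first by lim_tac.
apply: (@Tsum n.+1 (fun k i => E (a_ i * f_ i / c_ i * Q ^+ (2 * k)) / E (a_ i * f_ i / c_ i)
  * pochs E Q (a_ i * f_ i / c_ i :: [:: a_ i / c_ i; f_ i * Q / c_ i; b_ i * e_ i * f_ i / a_ i;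
      d_ i; d_ i * q; f_ i; q ^- (3 * n)]) k * Q ^+ k
  / pochs E Q (Q :: [seq a_ i * f_ i / c_ i * Q / x | x <- [:: a_ i / c_ i; f_ i * Q / c_ i;
      b_ i * e_ i * f_ i / a_ i; d_ i; d_ i * q; f_ i; q ^- (3 * n)]]) k)
 (fun k => E (a * f / c * Q ^+ (2 * k)) / E (a * f / c)
  * pochs E Q (a * f / c :: [:: a / c; f * Q / c; b * e * f / a; d; d * q; f; q ^- (3 * n)]) k * Q ^+ k
  / pochs E Q (Q :: [seq a * f / c * Q / x | x <- [:: a / c; f * Q / c; b * e * f / a;
      d; d * q; f; q ^- (3 * n)]]) k)) => k.
by rewrite ltnS => /den /= D; lim_tac.
Qed.

End Limits.

Hypothesis E1 : E 1 = 0.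
Hypothesis EV : forall x, x != 0 -> E x^-1 = - (E x / x).
Hypothesis Espan : forall m : F, m != 0 -> exists u v, forall s : F, s != 0 ->
  exists al be, forall x, x != 0 -> E (s * x) * E (s * m / x) = al * u x + be * v x.
Hypothesis Tuniq : forall u x y, T u x -> T u y -> x = y.
Hypothesis approx : forall a b c, a != 0 -> b != 0 -> c != 0 ->
  exists u v w : nat -> F, [/\ T u a, T v b, T w c &
    forall i, [/\ u i != 0, v i != 0, w i != 0 & generic3 E q (u i) (v i) (w i)]].

Lemma transformation_of_limits (a b c d e f : F) :
  a != 0 -> b != 0 -> c != 0 -> d != 0 -> e != 0 ->
  b * c * d = a * q -> d * e = a ^+ 2 * q ^+ (3 * n + 1) -> f = a / b \/ f = a / e ->
  E a != 0 ->
  (forall k : nat, (k <= n)%N ->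
     [/\ pochs E Q [:: a * Q / b; a * Q / c] k != 0,
         poch E q (a * q / d) (2 * k) != 0 &
         pochs E q [:: a * q / e; a * q ^+ (3 * n + 1)] k != 0]) ->
  pochs E Q [:: a ^+ 2 * Q / (b * e * f); a * f * Q / c;
                       a * Q / d; a ^+ 2 * Q / (b * c * d * e)] n != 0 ->
  E (a * f / c) != 0 ->
  (forall k : nat, (k <= n)%N ->
     pochs E Q (Q :: [seq a * f / c * Q / ai
                  | ai <- [:: a / c; f * Q / c; b * e * f / a; d; d * q; f; q ^- (3 * n)]]) k != 0) ->
  transf_lhs E q n a b c d e = transf_rhs E q n a b c d e f.
Proof.
move=> a0 b0 c0 d0 e0 bcd de ff Ea den1 den2 EA den3.
have f0 : f != 0 by case: ff => ->; rewrite mulf_neq0 ?invr_neq0.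
have bc0 : b * c != 0 by rewrite mulf_neq0.
have dE : d = a * q / (b * c) by rewrite -bcd mulrAC mulfV // mul1r.
have eE : e = a * b * c * q ^+ (3 * n).
  by apply: (mulfI d0); rewrite de dE addn1 (exprS q); field; rewrite b0 c0.
(* As q is not perturbed, this has to be read off the factor (q^3; q^3)_n of the denominators. *)
have qn : qpow_neq0 E Q n.
  move=> k /andP[k0 kn]; have := den3 n (leqnn n).
  rewrite /pochs big_cons mulf_eq0 negb_or => /andP[/prodf_neq0 H _].
  have kn' : (k.-1 < n)%N by rewrite prednK.
  by have := H (Ordinal kn') isT; rewrite /= -exprS prednK.
have [u [v [w [ua vb wc G]]]] := approx a0 b0 c0.
(* The sequences for d and e keep both balancing conditions exact, and the one for f stays on the
   same alternative, so the generic identity holds at every index. *)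
pose du i := u i * q / (v i * w i); pose eu i := u i * v i * w i * q ^+ (3 * n).
have tdu : T du d by rewrite dE /du; lim_tac.
have teu : T eu e by rewrite eE /eu; lim_tac.
have [fu tfu fuE] : exists2 fu, T fu f & forall i, fu i = u i / v i \/ fu i = u i / eu i.
  by case: ff => ->; [exists (fun i => u i / v i)|exists (fun i => u i / eu i)];
    (lim_tac || by move=> i; auto).
have L := lim_transf_lhs a0 b0 c0 d0 e0 ua vb wc tdu teu Ea den1.
apply: (Tuniq L).
apply: Text (lim_transf_rhs a0 b0 c0 d0 e0 f0 ua vb wc tdu teu tfu den2 EA den3) => i.
have [ui vi wi gi] := G i.
by rewrite (generic_transformation E1 EV Espan q0 ui vi wi gi qn (fuE i)).
Qed.

End AbstractLimits.

(** * Complex sequences and the theta product *)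

Section Convergence.
Variable R : realType.
Local Notation C := (R[i]).
Local Notation nrm := (@Normc.normc R).

Lemma nrm_ge0 (z : C) : 0 <= nrm z.
Proof. by case: z => a b; exact: sqrtr_ge0. Qed.

Lemma nrm_prod n (f : nat -> C) : nrm (\prod_(k < n) f k) = \prod_(k < n) nrm (f k).
Proof. by elim: n => [|n IH]; rewrite ?big_ord0 ?Normc.normc1 // !big_ord_recr /= Normc.normcM IH. Qed.

Lemma nrmX (z : C) n : nrm (z ^+ n) = nrm z ^+ n.
Proof. by elim: n => [|n IH]; rewrite ?expr0 ?Normc.normc1 // !exprS Normc.normcM IH. Qed.

Lemma nrm_distrC (x y : C) : nrm (x - y) = nrm (y - x).
Proof. by rewrite -normcN opprB. Qed.

Lemma nrm_tri (x y z : C) : nrm (x - z) <= nrm (x - y) + nrm (y - z).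
Proof. by rewrite -[x - z](subrKA y) le_normcD. Qed.

Lemma nrm_eq0 (z : C) : (nrm z == 0) = (z == 0).
Proof. by apply/eqP/eqP => [/Normc.eq0_normc|->]; rewrite ?Normc.normc0. Qed.

Lemma nrm_gt0 (z : C) : z != 0 -> 0 < nrm z.
Proof. by move=> z0; rewrite lt_def nrm_eq0 z0 nrm_ge0. Qed.

Lemma Re_le_nrm (z : C) : `|complex.Re z| <= nrm z.
Proof. by have := normc_ge_Re z; rewrite lecR. Qed.

Lemma Im_le_nrm (z : C) : `|complex.Im z| <= nrm z.
Proof.
case: z => a b /=; rewrite -[leLHS]sqrtr_sqr ler_wsqrtr //.
by rewrite lerDr sqr_ge0.
Qed.

Lemma nrm_le_ReIm (z : C) : nrm z <= `|complex.Re z| + `|complex.Im z|.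
Proof.
case: z => a b /=.
rewrite -(@ler_pXn2r _ 2) ?nnegrE ?sqrtr_ge0 ?addr_ge0 //.
rewrite sqr_sqrtr ?addr_ge0 ?sqr_ge0 // sqrrD !real_normK ?num_real //.
by have := mulr_ge0 (normr_ge0 a) (normr_ge0 b); lra.
Qed.

(** The norm of [R[i]] takes values in [R[i]]; with the real-valued [normc] all estimates are real
    inequalities. *)
Definition tends (u : nat -> C) (l : C) :=
  forall e : R, 0 < e -> exists N, forall n, (N <= n)%N -> nrm (l - u n) < e.

Lemma tendsP (u : nat -> C) (l : C) : ((u @ \oo --> l)%classic <-> tends u l).
Proof.
split.
  move=> /(@cvgrPdist_lt _ (R[i])^o) H e e0; have := H e%:C.
  rewrite ltcR => /(_ e0) [N _ HN]; exists N => n Nn.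
  have : (nrm (l - u n))%:C < e%:C := HN n Nn.
  by rewrite ltcR.
move=> H; apply/(@cvgrPdist_lt _ (R[i])^o) => e; rewrite ltcE /= => /andP[/eqP ie e0].
have [N HN] := H _ e0; exists N => // n Nn /=.
by rewrite ltcE /= ie eqxx /=; exact: HN.
Qed.

Lemma tends_lim u l : tends u l -> lim (u @ \oo)%classic = l.
Proof. by move=> /tendsP/cvg_lim; apply; exact: (@norm_hausdorff _ (R[i])^o). Qed.

Lemma tends_uniq u l l' : tends u l -> tends u l' -> l = l'.
Proof. by move=> /tends_lim <- /tends_lim. Qed.

Lemma tends_ext u v l : (forall n, u n = v n) -> tends u l -> tends v l.
Proof. by move=> uv H e /H [N HN]; exists N => n /HN; rewrite uv. Qed.

Lemma tends_ext_S u v l : (forall n, u n.+1 = v n.+1) -> tends u l -> tends v l.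
Proof. by move=> uv H e /H [N HN]; exists N.+1 => -[|n] // /ltnW/HN; rewrite uv. Qed.

Lemma tends_cst l : tends (fun=> l) l.
Proof. by move=> e e0; exists 0%N => n _; rewrite subrr Normc.normc0. Qed.

Lemma tendsD u v a b : tends u a -> tends v b -> tends (fun n => u n + v n) (a + b).
Proof. move=> /tendsP ua /tendsP vb; apply/tendsP; exact: (@cvgD R[i] (R[i])^o _ _ _ u v a b ua vb). Qed.

Lemma tendsM u v a b : tends u a -> tends v b -> tends (fun n => u n * v n) (a * b).
Proof. move=> /tendsP ua /tendsP vb; apply/tendsP; exact: (@cvgM R[i] _ _ _ u v a b ua vb). Qed.

Lemma tendsV u a : a != 0 -> tends u a -> tends (fun n => (u n)^-1) a^-1.
Proof. move=> a0 /tendsP ua; apply/tendsP; exact: (@cvgV R[i] _ _ _ u a a0 ua). Qed.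

Lemma tendsN u a : tends u a -> tends (fun n => - u n) (- a).
Proof.
move=> ua; rewrite -mulN1r; apply: tends_ext (tendsM (tends_cst (-1)) ua) => n.
by rewrite mulN1r.
Qed.

Lemma tendsX u a k : tends u a -> tends (fun n => u n ^+ k) (a ^+ k).
Proof.
move=> ua; elim: k => [|k IH]; first by apply: tends_ext (tends_cst 1) => n; rewrite expr0.
by rewrite exprS; apply: tends_ext (tendsM ua IH) => n; rewrite exprS.
Qed.

Lemma tends_sum N (u : nat -> nat -> C) l : (forall k, (k < N)%N -> tends (u k) (l k)) ->
  tends (fun n => \sum_(k < N) u k n) (\sum_(k < N) l k).
Proof.
elim: N => [|N IH] H.
  by rewrite big_ord0; apply: tends_ext (tends_cst 0) => n; rewrite big_ord0.
rewrite big_ord_recr /=.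
apply: tends_ext (tendsD (IH (fun k kN => H k (ltnW kN))) (H N (ltnSn N))) => n.
by rewrite big_ord_recr.
Qed.

Lemma tends_prod N (u : nat -> nat -> C) l : (forall k, (k < N)%N -> tends (u k) (l k)) ->
  tends (fun n => \prod_(k < N) u k n) (\prod_(k < N) l k).
Proof.
elim: N => [|N IH] H.
  by rewrite big_ord0; apply: tends_ext (tends_cst 1) => n; rewrite big_ord0.
rewrite big_ord_recr /=.
apply: tends_ext (tendsM (IH (fun k kN => H k (ltnW kN))) (H N (ltnSn N))) => n.
by rewrite big_ord_recr.
Qed.

Lemma geo_small (K s e : R) : 0 <= s < 1 -> 0 < e ->
  exists N, forall n, (N <= n)%N -> K * s ^+ n < e.
Proof.
move=> /andP[s0 s1] e0.
have := @cvg_geometric R K s; rewrite ger0_norm // => /(_ s1).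
move=> /cvgrPdist_lt /(_ _ e0) [N _ HN]; exists N => n /HN /=.
rewrite sub0r normrN => /(le_lt_trans (ler_norm _)).
by [].
Qed.

Lemma tends_geo u l (K s : R) : 0 <= s < 1 ->
  (forall n, nrm (l - u n) <= K * s ^+ n) -> tends u l.
Proof.
move=> s01 H e /(geo_small K s01) [N HN]; exists N => n /HN; exact: le_lt_trans.
Qed.

Lemma tends_geo_trans u v l (K s : R) : 0 <= s < 1 ->
  (forall n, nrm (u n - v n) <= K * s ^+ n) -> tends u l -> tends v l.
Proof.
move=> s01 H ul e e0.
have [|N1 H1] := geo_small K (e := e / 2) s01; first by rewrite divr_gt0.
have [|N2 H2] := ul (e / 2); first by rewrite divr_gt0.
exists (N1 + N2)%N => n Nn; rewrite (le_lt_trans (nrm_tri _ (u n) _)) //.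
rewrite [e]splitr ltrD ?H2 ?(le_lt_trans (H n)) ?H1 //; lia.
Qed.

Lemma tends_le u l (a : C) (K : R) : tends u l ->
  (exists N, forall n, (N <= n)%N -> nrm (u n - a) <= K) -> nrm (l - a) <= K.
Proof.
move=> ul [N HN]; rewrite leNgt; apply/negP => lt.
have [|N' HN'] := ul (nrm (l - a) - K); first by rewrite subr_gt0.
have := nrm_tri l (u (maxn N N')) a.
have := HN (maxn N N') (leq_maxl _ _); have := HN' (maxn N N') (leq_maxr _ _).
lra.
Qed.

(** Adding the geometric tail K s^n / (1 - s) makes the sequence nonincreasing and bounded below, so
    monotone convergence applies. *)
Lemma real_geo_cvg (x : nat -> R) (K s : R) : 0 <= s < 1 ->
  (forall n, `|x n.+1 - x n| <= K * s ^+ n) ->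
  exists l, forall e : R, 0 < e -> exists N, forall n, (N <= n)%N -> `|l - x n| < e.
Proof.
move=> s01 H; have /andP[s0 s1] := s01.
pose w n := K * s ^+ n / (1 - s); pose y n := x n + w n.
have s1' : 0 < 1 - s by rewrite subr_gt0.
have K0 : 0 <= K by have := le_trans (normr_ge0 _) (H 0%N); rewrite expr0 mulr1.
have wS n : w n - w n.+1 = K * s ^+ n.
  by rewrite /w exprS; field; rewrite gt_eqF.
have w0 n : 0 <= w n by rewrite /w divr_ge0 ?mulr_ge0 ?exprn_ge0 // ltW.
have yS n : y n.+1 <= y n.
  by have := H n; have := wS n; rewrite ler_norml /y => ? /andP[? ?]; lra.
have ylow n : x 0%N - w 0%N <= y n.
  suff : x 0%N - w 0%N + w n <= x n by rewrite /y; have := w0 n; lra.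
  elim: n => [|n IH]; first by lra.
  by have := H n; have := wS n; rewrite ler_norml => ? /andP[? ?]; lra.
have : cvgn y.
  apply: nonincreasing_is_cvgn; first by apply/nonincreasing_seqP.
  by exists (x 0%N - w 0%N) => _ [n _ <-].
move=> /cvg_ex [l /cvgrPdist_lt yl]; exists l => e e0.
have [|N1 _ H1] := yl (e / 2); first by rewrite divr_gt0.
have [|N2 H2] := @geo_small (K / (1 - s)) s (e / 2) s01; first by rewrite divr_gt0.
exists (N1 + N2)%N => n Nn.
have N1n : (N1 <= n)%N by lia.
have N2n : (N2 <= n)%N by lia.
have h1 : `|l - y n| < e / 2 := H1 n N1n; have h2 := H2 n N2n.
have -> : l - x n = (l - y n) + w n by rewrite /y; ring.
rewrite (le_lt_trans (ler_normD _ _)) // [e]splitr ltrD // ger0_norm //.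
by rewrite /w mulrAC.
Qed.

Lemma geo_tends (u : nat -> C) (K s : R) : 0 <= s < 1 ->
  (forall n, nrm (u n.+1 - u n) <= K * s ^+ n) ->
  exists l, tends u l /\ forall n, nrm (l - u n) <= K / (1 - s) * s ^+ n.
Proof.
move=> s01 H; have /andP[s0 s1] := s01.
have s1' : 0 < 1 - s by rewrite subr_gt0.
have K0 : 0 <= K by have := le_trans (nrm_ge0 _) (H 0%N); rewrite expr0 mulr1.
have [|a ua] := @real_geo_cvg (fun n => complex.Re (u n)) K s s01.
  by move=> n; rewrite (le_trans _ (H n)) // -raddfB Re_le_nrm.
have [|b ub] := @real_geo_cvg (fun n => complex.Im (u n)) K s s01.
  by move=> n; rewrite (le_trans _ (H n)) // -raddfB Im_le_nrm.
have ul : tends u (a +i* b).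
  move=> e e0; have [|N1 H1] := ua (e / 2); first by rewrite divr_gt0.
  have [|N2 H2] := ub (e / 2); first by rewrite divr_gt0.
  exists (N1 + N2)%N => n Nn; rewrite (le_lt_trans (nrm_le_ReIm _)) //.
  by rewrite [e]splitr !raddfB /= ltrD ?H1 ?H2 //; lia.
exists (a +i* b); split=> // n.
apply: (tends_le ul); exists n => m nm; rewrite -(subnKC nm).
(* The bound with the subtracted power telescopes, which lets the induction close. *)
suff : nrm (u (n + (m - n))%N - u n) <= K / (1 - s) * (s ^+ n - s ^+ (n + (m - n))).
  move=> /le_trans; apply; rewrite ler_wpM2l ?divr_ge0 ?(ltW s1') //.
  by rewrite gerBl exprn_ge0.
elim: (m - n)%N => [|k IH]; first by rewrite addn0 !subrr Normc.normc0 mulr0.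
rewrite addnS (le_trans (nrm_tri _ (u (n + k)%N) _)) //.
have -> : K / (1 - s) * (s ^+ n - s ^+ (n + k).+1) =
    K * s ^+ (n + k) + K / (1 - s) * (s ^+ n - s ^+ (n + k)).
  by rewrite exprS; field; rewrite gt_eqF.
by rewrite lerD.
Qed.

Lemma sum_geo_le (s : R) n : 0 <= s < 1 -> \sum_(k < n) s ^+ k <= (1 - s)^-1.
Proof.
move=> /andP[s0 s1]; have s1' : 0 < 1 - s by rewrite subr_gt0.
rewrite -[leRHS]mul1r ler_pdivlMr // mulrC.
have -> : (1 - s) * (\sum_(k < n) s ^+ k) = 1 - s ^+ n.
  elim: n => [|n IH]; first by rewrite big_ord0 mulr0 subrr.
  by rewrite big_ord_recr /= mulrDr IH exprS; ring.
by rewrite gerBl exprn_ge0.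
Qed.

(** By 1 + t <= exp t this bounds all partial products of factors 1 + a_k with |a_k| <= K s^k. *)
Definition prod_bound (K s : R) := expR (K / (1 - s)).

Lemma prod_geo (a : nat -> C) (K s : R) : 0 <= K -> 0 <= s < 1 ->
  (forall k, nrm (a k) <= K * s ^+ k) ->
  exists l, tends (fun N => \prod_(k < N) (1 + a k)) l /\
    forall N, nrm (l - \prod_(k < N) (1 + a k)) <= prod_bound K s * K / (1 - s) * s ^+ N.
Proof.
move=> K0 s01 H; apply: geo_tends => // N.
rewrite big_ord_recr /= mulrDr mulr1 addrAC subrr add0r Normc.normcM -mulrA.
apply: ler_pM; rewrite ?nrm_ge0 // (nrm_prod N (fun k => 1 + a k)).
apply: (@le_trans _ _ (\prod_(k < N) expR (K * s ^+ k))).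
  apply: ler_prod => k _; rewrite nrm_ge0 (le_trans (le_normcD _ _)) //.
  by rewrite Normc.normc1 (le_trans _ (expR_ge1Dx _)) // lerD2l H.
rewrite -expR_sum ler_expR -mulr_sumr ler_wpM2l //; exact: sum_geo_le.
Qed.

(** * The theta product: convergence, continuity, zeros, inversion *)

Section Theta.
Variable p : C.
Hypothesis p1 : nrm p < 1.
Local Notation r := (nrm p).
Local Notation E := (Etheta p).

Let r01 : 0 <= r < 1. Proof. by rewrite nrm_ge0. Qed.

Definition theta_prod (x : C) (N : nat) :=
  \prod_(k < N) ((1 - x * p ^+ k) * (1 - p ^+ k.+1 / x)).

Definition theta_fac (x : C) k := - (x * p ^+ k) - p ^+ k.+1 / x + p ^+ k * p ^+ k.+1.

Lemma theta_facE x k : x != 0 ->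
  (1 - x * p ^+ k) * (1 - p ^+ k.+1 / x) = 1 + theta_fac x k.
Proof. by move=> x0; rewrite /theta_fac; field. Qed.

Lemma nrmXp_le k l : (k <= l)%N -> nrm (p ^+ l) <= r ^+ k.
Proof. by move=> kl; rewrite nrmX ler_wiXn2l ?nrm_ge0 // ltW. Qed.

Lemma theta_fac_le x B k : x != 0 -> nrm x <= B -> (nrm x)^-1 <= B ->
  nrm (theta_fac x k) <= (2 * B + 1) * r ^+ k.
Proof.
move=> x0 xB xB'; rewrite /theta_fac.
have h1 : nrm (- (x * p ^+ k)) <= B * r ^+ k.
  by rewrite normcN Normc.normcM nrmX ler_wpM2r ?exprn_ge0 ?nrm_ge0.
have h2 : nrm (- (p ^+ k.+1 / x)) <= B * r ^+ k.
  rewrite normcN Normc.normcM Normc.normcV mulrC.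
  by apply: ler_pM; rewrite ?nrm_ge0 ?invr_ge0 ?nrm_ge0 ?nrmXp_le.
have h3 : nrm (p ^+ k * p ^+ k.+1) <= r ^+ k.
  by rewrite -exprD nrmXp_le // leq_addr.
have := le_normcD (- (x * p ^+ k) - p ^+ k.+1 / x) (p ^+ k * p ^+ k.+1).
have := le_normcD (- (x * p ^+ k)) (- (p ^+ k.+1 / x)).
lra.
Qed.

(** The rate depends on x only through a bound B for |x| and 1/|x|: convergence is uniform on
    annuli, whence continuity. *)
Definition theta_rate (B : R) := prod_bound (2 * B + 1) r * (2 * B + 1) / (1 - r).

Lemma Etheta_rate x B : x != 0 -> nrm x <= B -> (nrm x)^-1 <= B ->
  tends (theta_prod x) (E x) /\
  forall N, nrm (E x - theta_prod x N) <= theta_rate B * r ^+ N.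
Proof.
move=> x0 xB xB'.
have B0 : 0 <= 2 * B + 1 by have := le_trans (nrm_ge0 x) xB; lra.
have [l [ul lr]] := prod_geo B0 r01 (fun k => theta_fac_le k x0 xB xB').
have eqN N : theta_prod x N = \prod_(k < N) (1 + theta_fac x k).
  by apply: eq_bigr => k _; rewrite theta_facE.
have ul' : tends (theta_prod x) l by apply: tends_ext ul => N; rewrite eqN.
have -> : E x = l by exact: tends_lim ul'.
by split=> // N; rewrite eqN; exact: lr.
Qed.

Lemma Etheta_tends x : x != 0 -> tends (theta_prod x) (E x).
Proof.
move=> x0; have h := ltW (nrm_gt0 x0); have h' : 0 <= (nrm x)^-1 by rewrite invr_ge0.
by have [] // := @Etheta_rate x (nrm x + (nrm x)^-1) x0; rewrite ?lerDl ?lerDr.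
Qed.

Lemma Etheta_cont u x : x != 0 -> tends u x -> tends (fun n => E (u n)) (E x).
Proof.
move=> x0 ux e e0; have xp := nrm_gt0 x0.
(* Bounds |u n| and 1/|u n| as soon as u n lies within |x|/2 of x. *)
pose B := 2 * nrm x + 2 / nrm x.
have [N HN] := geo_small (theta_rate B) (e := e / 3) r01 ltac:(lra).
have xN : tends (fun n => theta_prod (u n) N) (theta_prod x N).
  apply: (@tends_prod N (fun k n => (1 - u n * p ^+ k) * (1 - p ^+ k.+1 / u n))
    (fun k => (1 - x * p ^+ k) * (1 - p ^+ k.+1 / x))) => k _.
  apply: tendsM; apply: tendsD (tends_cst 1) (tendsN _).
    exact: tendsM ux (tends_cst _).
  exact: tendsM (tends_cst _) (tendsV x0 ux).
have [N1 H1] := xN (e / 3) ltac:(lra).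
have [N2 H2] := ux (nrm x / 2) ltac:(lra).
exists (N1 + N2)%N => n Nn.
have h1 := H1 n ltac:(lia); have h2 := H2 n ltac:(lia).
have xi : 0 < (nrm x)^-1 by rewrite invr_gt0.
have un1 : nrm (u n) <= B.
  have := le_normcD x (- (x - u n)); rewrite normcN opprB addrC subrK /B; lra.
have un2 : nrm x / 2 <= nrm (u n).
  have := le_normcD (u n) (x - u n); rewrite addrC subrK; lra.
have un0 : u n != 0 by rewrite -nrm_eq0 gt_eqF //; lra.
have un3 : (nrm (u n))^-1 <= B.
  apply: (@le_trans _ _ (2 / nrm x)); last by rewrite /B; lra.
  rewrite -[2 / _]invf_div lef_pV2 // posrE; lra.
have [_ R1] := @Etheta_rate x B x0 ltac:(rewrite /B; lra) ltac:(rewrite /B; lra).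
have [_ R2] := Etheta_rate un0 un1 un3.
have a1 := le_lt_trans (R1 N) (HN N (leqnn N)).
have a3 := le_lt_trans (R2 N) (HN N (leqnn N)); rewrite nrm_distrC in a3.
have -> : e = e / 3 + (e / 3 + e / 3) by lra.
apply: (le_lt_trans (nrm_tri _ (theta_prod x N) _)); apply: ltrD a1 _.
by apply: (le_lt_trans (nrm_tri _ (theta_prod (u n) N) _)); apply: ltrD h1 a3.
Qed.

(** If no factor vanishes, the reciprocals of the factors also form a convergent product; the two
    limits multiply to 1, so neither is 0. *)
Lemma Etheta_eq0 x : x != 0 -> E x = 0 -> exists k, x * p ^+ k = 1 \/ x = p ^+ k.+1.
Proof.
move=> x0 Ex0; apply: contrapT => noz.
have fac0 k : 1 + theta_fac x k != 0.
  rewrite -theta_facE // mulf_neq0 // subr_eq0 eq_sym; apply/negP => /eqP H; apply: noz.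
    by exists k; left.
  by exists k; right; rewrite -[RHS](divfK x0) H mul1r.
pose b k := - theta_fac x k / (1 + theta_fac x k).
have bE k : (1 + theta_fac x k) * (1 + b k) = 1 by rewrite /b; field; exact: fac0.
pose B := nrm x + (nrm x)^-1; pose A := 2 * B + 1.
have h := ltW (nrm_gt0 x0); have h' : 0 <= (nrm x)^-1 by rewrite invr_ge0.
(* The rate must be positive, since its powers are divided by below, while r = 0 when p = 0. *)
pose s := Num.max r (1 / 2).
have s01 : 0 <= s < 1 by rewrite /s le_max nrm_ge0 gt_max p1 /=; lra.
have s0 : 0 < s by rewrite /s lt_max; apply/orP; right; lra.
have A0 : 0 <= A by rewrite /A /B; lra.
have aA k : nrm (theta_fac x k) <= A * s ^+ k.
  apply: le_trans (theta_fac_le (B := B) k x0 _ _) _; rewrite /B ?lerDl ?lerDr //.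
  by rewrite ler_wpM2l // lerXn2r ?nnegrE ?nrm_ge0 ?(ltW s0) // /s le_max lexx.
have [N HN] := geo_small A (e := 1 / 2) s01 ltac:(lra).
(* From N on the factors have modulus at least 1/2, which gives 2A; the sum pays for the finitely
   many earlier terms. *)
pose K := 2 * A + \sum_(k < N) nrm (b k) / s ^+ k.
have S0 : 0 <= \sum_(k < N) nrm (b k) / s ^+ k.
  by apply: sumr_ge0 => k _; rewrite divr_ge0 ?nrm_ge0 ?exprn_ge0 ?ltW.
have bK k : nrm (b k) <= K * s ^+ k.
  case: (ltnP k N) => [kN|Nk].
    rewrite -ler_pdivrMr ?exprn_gt0 // /K (bigD1 (Ordinal kN)) //=.
    have : 0 <= \sum_(i < N | i != Ordinal kN) nrm (b i) / s ^+ i.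
      by apply: sumr_ge0 => i _; rewrite divr_ge0 ?nrm_ge0 ?exprn_ge0 ?ltW.
    lra.
  have h1 := le_lt_trans (aA k) (HN k Nk).
  have h2 : 1 / 2 <= nrm (1 + theta_fac x k).
    have := le_normcD (1 + theta_fac x k) (- theta_fac x k).
    rewrite addrK Normc.normc1 normcN; lra.
  apply: (@le_trans _ _ (2 * A * s ^+ k)).
    rewrite /b Normc.normcM Normc.normcV normcN ler_pdivrMr; last lra.
    apply: (le_trans (aA k)).
    have : 0 <= A * s ^+ k by rewrite mulr_ge0 // exprn_ge0 // ltW.
    nra.
  by apply: ler_wpM2r; [rewrite exprn_ge0 // ltW|rewrite /K; lra].
have K0 : 0 <= K by rewrite /K; lra.
have [l [bl _]] := prod_geo K0 s01 bK.
have := tendsM (Etheta_tends x0) bl; rewrite Ex0 mul0r => lim0.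
have lim1 : tends (fun N => theta_prod x N * \prod_(k < N) (1 + b k)) 1.
  apply: tends_ext (tends_cst 1) => M; rewrite /theta_prod -big_split big1 // => k _.
  by rewrite theta_facE //; exact: bE.
by have /eqP := tends_uniq lim0 lim1; rewrite eq_sym oner_eq0.
Qed.

Lemma Etheta1 : E 1 = 0.
Proof.
apply: tends_uniq (Etheta_tends (oner_neq0 _)) _.
apply: tends_ext_S (tends_cst 0) => n.
by rewrite /theta_prod big_ord_recl expr0 mulr1 subrr !mul0r.
Qed.

Lemma tends_pX : tends (fun n => p ^+ n) 0.
Proof.
apply: (@tends_geo _ _ 1 r r01) => n.
by rewrite sub0r normcN nrmX mul1r.
Qed.

(** Inverting x exchanges the two halves of the product up to a shift by one factor; the boundary
    factors tend to 1. *)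
Lemma theta_prodV x N : x != 0 ->
  (1 - p ^+ N / x) * theta_prod x^-1 N = - ((1 - x * p ^+ N) * theta_prod x N / x).
Proof.
move=> x0; elim: N => [|N IH].
  by rewrite /theta_prod !big_ord0 expr0 !mulr1; field.
rewrite /theta_prod !big_ord_recr /= -/(theta_prod x N) -/(theta_prod x^-1 N) invrK.
transitivity ((1 - p ^+ N.+1 / x) * (1 - p ^+ N.+1 * x) *
  ((1 - p ^+ N / x) * theta_prod x^-1 N)); first by ring.
by rewrite IH; ring.
Qed.

Lemma EthetaV x : x != 0 -> E x^-1 = - (E x / x).
Proof.
move=> x0; have xi0 : x^-1 != 0 by rewrite invr_eq0.
have one y : tends (fun n => 1 - y * p ^+ n) 1.
  by have := tendsD (tends_cst 1) (tendsN (tendsM (tends_cst y) tends_pX)); rewrite mulr0 subr0.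
have L := tendsM (one x^-1) (Etheta_tends xi0); rewrite mul1r in L.
have L' := tendsN (tendsM (tendsM (one x) (Etheta_tends x0)) (tends_cst x^-1)).
rewrite mul1r in L'; apply: tends_uniq L _; apply: tends_ext L' => N.
by rewrite -theta_prodV // [x^-1 * _]mulrC.
Qed.

End Theta.
End Convergence.

(** * Bilateral series *)

Section Bilateral.
Variable R : realType.
Local Notation C := (R[i]).
Local Notation nrm := (@Normc.normc R).

Definition bsum (f : int -> C) N := f 0 + \sum_(k < N) (f (Posz k.+1) + f (Negz k)).

Definition bilim (f : int -> C) : C := lim (bsum f @ \oo)%classic.

Lemma bsum0 f : bsum f 0 = f 0.
Proof. by rewrite /bsum big_ord0 addr0. Qed.

Lemma bsumS f N : bsum f N.+1 = bsum f N + (f (Posz N.+1) + f (Negz N)).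
Proof. by rewrite /bsum big_ord_recr /= addrA. Qed.

Lemma eq_bsum f g N : (forall n, (`|n| <= N)%N -> f n = g n) -> bsum f N = bsum g N.
Proof.
elim: N => [|N IH] fg; first by rewrite !bsum0 fg.
by rewrite !bsumS IH => [|n nN]; rewrite ?fg //; lia.
Qed.

Lemma bsumB f g N : bsum f N - bsum g N = bsum (fun n => f n - g n) N.
Proof. by elim: N => [|N IH]; rewrite ?bsum0 // !bsumS -IH; ring. Qed.

Lemma bsumZ c f N : c * bsum f N = bsum (fun n => c * f n) N.
Proof. by elim: N => [|N IH]; rewrite ?bsum0 // !bsumS -IH; ring. Qed.

Lemma bsumD f g N : bsum f N + bsum g N = bsum (fun n => f n + g n) N.
Proof. by elim: N => [|N IH]; rewrite ?bsum0 // !bsumS -IH; ring. Qed.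

Lemma bsum_exchange (G : int -> int -> C) M N :
  bsum (fun n => bsum (fun t => G t n) M) N = bsum (fun t => bsum (G t) N) M.
Proof.
elim: M => [|M IH]; first by rewrite bsum0; apply: eq_bsum => n _; rewrite bsum0.
by rewrite bsumS -IH !bsumD; apply: eq_bsum => n _; rewrite bsumS.
Qed.

Lemma bsum_le f N (K s : R) : 0 <= s < 1 ->
  (forall n, (`|n| <= N)%N -> nrm (f n) <= K * s ^+ `|n|) ->
  nrm (bsum f N) <= 2 * K / (1 - s).
Proof.
move=> s01 H; have /andP[s0 s1] := s01.
have s1' : 0 < 1 - s by rewrite subr_gt0.
have K0 : 0 <= K by have := le_trans (nrm_ge0 _) (H 0 isT); rewrite expr0 mulr1.
suff : nrm (bsum f N) <= K + 2 * K * s * \sum_(k < N) s ^+ k.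
  move=> /le_trans; apply.
  apply: (@le_trans _ _ (K + 2 * K * s * (1 - s)^-1)).
    by rewrite lerD2l ler_wpM2l ?sum_geo_le // !mulr_ge0.
  rewrite -subr_ge0.
  have -> : 2 * K / (1 - s) - (K + 2 * K * s / (1 - s)) = K by field; rewrite gt_eqF.
  by [].
elim: N H => [|N IH] H.
  by rewrite bsum0 big_ord0 mulr0 addr0; have := H 0 isT; rewrite expr0 mulr1.
rewrite bsumS big_ord_recr /= mulrDr [leRHS]addrA (le_trans (le_normcD _ _)) // lerD //.
  by apply: IH => n nN; apply: H; rewrite leqW.
have h1 := H (Posz N.+1) (leqnn _); have h2 := H (Negz N) (leqnn _).
have := le_normcD (f (Posz N.+1)) (f (Negz N)).
by rewrite /= !exprS in h1 h2 *; lra.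
Qed.

Lemma bilimP f (K s : R) : 0 <= s < 1 -> (forall n, nrm (f n) <= K * s ^+ `|n|) ->
  tends (bsum f) (bilim f) /\ forall N, nrm (bilim f - bsum f N) <= 2 * K / (1 - s) * s ^+ N.
Proof.
move=> s01 H; have /andP[s0 s1] := s01.
have K0 : 0 <= K by have := le_trans (nrm_ge0 _) (H 0); rewrite expr0 mulr1.
have [|l [ul lr]] := @geo_tends R (bsum f) (2 * K) s s01.
  move=> N; rewrite bsumS addrAC subrr add0r (le_trans (le_normcD _ _)) //.
  have h1 := H (Posz N.+1); have h2 := H (Negz N); rewrite /= !exprS in h1 h2.
  have : s * s ^+ N <= s ^+ N by rewrite ler_piMl ?exprn_ge0 // ltW.
  by move=> /(ler_wpM2l K0); lra.
by rewrite /bilim (tends_lim ul).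
Qed.

Lemma bilim_le f (K s : R) : 0 <= s < 1 -> (forall n, nrm (f n) <= K * s ^+ `|n|) ->
  nrm (bilim f) <= 2 * K / (1 - s).
Proof.
move=> s01 H; have [ul _] := bilimP s01 H; rewrite -[bilim f]subr0.
apply: (tends_le ul); exists 0%N => n _; rewrite subr0.
by apply: bsum_le => // m _.
Qed.

Lemma eq_bilim f g : (forall n, f n = g n) -> bilim f = bilim g.
Proof. by move=> fg; congr bilim; apply/funext. Qed.

Lemma bilimZ c f (K s : R) : 0 <= s < 1 -> (forall n, nrm (f n) <= K * s ^+ `|n|) ->
  bilim (fun n => c * f n) = c * bilim f.
Proof.
move=> s01 H; have [ul _] := bilimP s01 H; apply: tends_lim.
by apply: tends_ext (tendsM (tends_cst c) ul) => N; rewrite bsumZ.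
Qed.

Lemma bsum_shift f N :
  bsum (fun n => f (n + 1)) N = bsum f N + (f (N.+1%:Z) - f (- N%:Z)).
Proof.
elim: N => [|N IH]; first by rewrite !bsum0 add0r oppr0; ring.
rewrite !bsumS IH NegzE.
have -> : Posz N.+1 + 1 = Posz N.+2 by lia.
have -> : (- N.+1%:Z + 1 = - N%:Z)%R by lia.
by ring.
Qed.

Lemma bilim_shift1 f (K s : R) : 0 <= s < 1 -> (forall n, nrm (f n) <= K * s ^+ `|n|) ->
  bilim (fun n => f (n + 1)) = bilim f.
Proof.
move=> s01 H; have [ul _] := bilimP s01 H; apply: tends_lim.
have /andP[s0 s1] := s01.
have K0 : 0 <= K by have := le_trans (nrm_ge0 _) (H 0); rewrite expr0 mulr1.
apply: (@tends_geo_trans _ (bsum f) _ _ (2 * K) s s01 _ ul) => N.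
rewrite bsum_shift opprD addrA subrr add0r normcN.
have h1 := H (N.+1%:Z); have h2 := H (- N%:Z); rewrite abszN /= exprS in h1 h2.
have := le_normcD (f N.+1) (- f (- N%:Z)); rewrite normcN.
have : s * s ^+ N <= s ^+ N by rewrite ler_piMl ?exprn_ge0 // ltW.
by move=> /(ler_wpM2l K0); lra.
Qed.

Lemma dominated_shift f m (K s : R) : 0 < s < 1 -> (forall n, nrm (f n) <= K * s ^+ `|n|) ->
  forall n, nrm (f (n + m)) <= K / s ^+ `|m| * s ^+ `|n|.
Proof.
move=> /andP[s0 s1] H n; have K0 : 0 <= K.
  by have := le_trans (nrm_ge0 _) (H 0); rewrite expr0 mulr1.
apply: (le_trans (H _)); rewrite -mulrA ler_wpM2l // ler_pdivlMl ?exprn_gt0 // -exprD.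
apply: ler_wiXn2l; [exact: ltW|exact: ltW|lia].
Qed.

Lemma bilim_shift f m (K s : R) : 0 < s < 1 -> (forall n, nrm (f n) <= K * s ^+ `|n|) ->
  bilim (fun n => f (n + m)) = bilim f.
Proof.
move=> s01; have s01' : 0 <= s < 1 by move/andP: s01 => [/ltW -> ->].
have pos k g (K' : R) : (forall n, nrm (g n) <= K' * s ^+ `|n|) ->
    bilim (fun n => g (n + k%:Z)) = bilim g.
  elim: k => [|k IH] H; first by apply: eq_bilim => n; rewrite addr0.
  rewrite -(IH H) -(bilim_shift1 s01' (dominated_shift k%:Z s01 H)).
  by apply: eq_bilim => n; congr g; lia.
case: m => [k|k] H; first exact: pos H.
have := dominated_shift (Negz k) s01 H => /(pos k.+1) <-.
by apply: eq_bilim => n; congr f; lia.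
Qed.

(** Between -(2N+1) and 2N+1, the indices 2j and 2j+1 with |j| <= N leave out only -(2N+1). *)
Lemma bsum_parity f N : bsum f (2 * N).+1 =
  bsum (fun j => f (2 * j)) N + bsum (fun j => f (2 * j + 1)) N + f (- (2 * N).+1%:Z).
Proof.
elim: N => [|N IH].
  rewrite muln0 bsumS !bsum0 mulr0 add0r.
  have -> : Negz 0 = (- 1%:Z)%R by lia.
  by rewrite addrA.
have -> : (2 * N.+1 = (2 * N).+2)%N by lia.
rewrite bsumS bsumS IH !bsumS.
have -> : Negz (2 * N).+1 = 2 * Negz N by lia.
have -> : Negz (2 * N).+2 = - (2 * N).+3%:Z by lia.
have -> : 2 * Negz N + 1 = - (2 * N).+1%:Z by lia.
have -> : Posz (2 * N).+2 = 2 * Posz N.+1 by lia.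
have -> : Posz (2 * N).+3 = 2 * Posz N.+1 + 1 by lia.
by ring.
Qed.

Lemma bilim_parity f (K s : R) : 0 < s < 1 -> (forall n, nrm (f n) <= K * s ^+ `|n|) ->
  bilim f = bilim (fun j => f (2 * j)) + bilim (fun j => f (2 * j + 1)).
Proof.
move=> s01 H; have s01' : 0 <= s < 1 by move/andP: s01 => [/ltW -> ->].
have [s0 s1] := andP s01.
have K0 : 0 <= K by have := le_trans (nrm_ge0 _) (H 0); rewrite expr0 mulr1.
have H0 n : nrm (f (2 * n)) <= K * s ^+ `|n|.
  by apply: (le_trans (H _)); rewrite ler_wpM2l //; apply: ler_wiXn2l; [exact: ltW|exact: ltW|lia].
have H1 n : nrm (f (2 * n + 1)) <= K / s * s ^+ `|n|.
  apply: (le_trans (H _)); rewrite -mulrA ler_wpM2l // ler_pdivlMl // -exprS.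
  by apply: ler_wiXn2l; [exact: ltW|exact: ltW|lia].
have [u0 _] := bilimP s01' H0; have [u1 _] := bilimP s01' H1; have [u _] := bilimP s01' H.
apply: tends_uniq (tendsD u0 u1).
apply: (@tends_geo_trans _ (fun N => bsum f (2 * N).+1) _ _ K s s01').
  move=> N; rewrite bsum_parity addrAC subrr add0r (le_trans (H _)) // ler_wpM2l //.
  by apply: ler_wiXn2l; [exact: ltW|exact: ltW|lia].
by move=> e /u [M HM]; exists M => N MN; apply: HM; lia.
Qed.

(** Under the product bound, both iterated sums are limits of the same finite sums over squares. *)
Lemma bilim_fubini (G : int -> int -> C) (K s : R) : 0 <= s < 1 ->
  (forall t n, nrm (G t n) <= K * s ^+ `|t| * s ^+ `|n|) ->
  bilim (fun n => bilim (fun t => G t n)) = bilim (fun t => bilim (fun n => G t n)).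
Proof.
move=> s01.
have main (G' : int -> int -> C) : (forall t n, nrm (G' t n) <= K * s ^+ `|t| * s ^+ `|n|) ->
    tends (fun N => bsum (fun n => bsum (fun t => G' t n) N) N)
      (bilim (fun n => bilim (fun t => G' t n))).
  move=> H; have [s0 s1] := andP s01; have s1' : 0 < 1 - s by rewrite subr_gt0.
  have Hn n t : nrm (G' t n) <= K * s ^+ `|n| * s ^+ `|t| by rewrite mulrAC.
  have S n : nrm (bilim (fun t => G' t n)) <= 2 * K / (1 - s) * s ^+ `|n|.
    by have := bilim_le s01 (Hn n); lra.
  have [u _] := bilimP s01 S.
  apply: (@tends_geo_trans _ _ _ _ (2 * (2 * K / (1 - s)) / (1 - s)) s s01 _ u) => N.
  rewrite bsumB.
  have -> : 2 * (2 * K / (1 - s)) / (1 - s) * s ^+ N =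
    2 * (2 * K / (1 - s) * s ^+ N) / (1 - s) by field; rewrite gt_eqF.
  apply: bsum_le => // n _.
  have [_ /(_ N)] := bilimP s01 (Hn n).
  by move=> /le_trans; apply; rewrite le_eqVlt; apply/orP; left; apply/eqP; field; rewrite gt_eqF.
move=> H; have L1 := main _ H.
have H' t n : nrm (G n t) <= K * s ^+ `|t| * s ^+ `|n| by rewrite mulrAC.
have L2 := main (fun t n => G n t) H'.
apply: tends_uniq L1 _; apply: tends_ext L2 => N; exact: bsum_exchange.
Qed.

End Bilateral.

(** * The Jacobi triple product *)

Section GaussianBinomial.
Variables (F : fieldType) (p : F).

(** The Gaussian binomial coefficient by its Pascal rule, which involves no division. *)
Fixpoint gbin (m j : nat) : F :=
  match m, j with
  | _, 0 => 1
  | 0, _.+1 => 0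
  | m'.+1, j'.+1 => gbin m' j + p ^+ (m' - j') * gbin m' j'
  end.

Lemma gbin0 m : gbin m 0 = 1. Proof. by case: m. Qed.

Lemma gbin_small m j : (m < j)%N -> gbin m j = 0.
Proof.
elim: m j => [|m IH] [|j] //= mj.
by rewrite !IH ?mulr0 ?addr0 //; lia.
Qed.

(** The finite q-binomial theorem, in base p. *)
Lemma gbin_prod m z : \prod_(k < m) (1 - z * p ^+ k) =
  \sum_(j < m.+1) gbin m j * p ^+ 'C(j, 2) * (- z) ^+ j.
Proof.
elim: m => [|m IH]; first by rewrite big_ord0 big_ord1 /= !expr0 !mulr1.
rewrite big_ord_recr /= IH mulrBr mulr1.
rewrite [in RHS]big_ord_recl /= !expr0 !mulr1.
have -> : \sum_(i < m.+1) (gbin m (bump 0 i) + p ^+ (m - i) * gbin m i)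
    * p ^+ 'C(bump 0 i, 2) * (- z) ^+ bump 0 i =
  \sum_(i < m.+1) gbin m i.+1 * p ^+ 'C(i.+1, 2) * (- z) ^+ i.+1
  + \sum_(i < m.+1) (- (gbin m i * p ^+ 'C(i, 2) * (- z) ^+ i * (z * p ^+ m))).
  rewrite -big_split /=; apply: eq_bigr => i _; rewrite /bump /= add1n.
  have -> : p ^+ m = p ^+ (m - i) * p ^+ i by rewrite -exprD subnK // -ltnS.
  by rewrite binS bin1 exprD exprS; ring.
rewrite sumrN -mulr_suml addrA; congr (_ - _).
rewrite [LHS]big_ord_recl /= gbin0 !expr0 !mulr1; congr (_ + _).
rewrite [RHS]big_ord_recr /= gbin_small // !mul0r addr0.
by apply: eq_bigr.
Qed.

Hypothesis unit_root : forall k, 1 - p ^+ k.+1 != 0.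

Definition qfact m : F := \prod_(k < m) (1 - p ^+ k.+1).

Lemma qfact_neq0 m : qfact m != 0.
Proof. by apply/prodf_neq0 => k _; exact: unit_root. Qed.

Lemma qfactS m : qfact m.+1 = qfact m * (1 - p ^+ m.+1).
Proof. exact: big_ord_recr. Qed.

Lemma gbinE j l : gbin (j + l) j = qfact (j + l) / (qfact j * qfact l).
Proof.
suff H m : forall j l, (j + l = m)%N -> gbin m j = qfact m / (qfact j * qfact l) by exact: H.
have q0 : qfact 0 = 1 by exact: big_ord0.
elim: m => [|m IH] {}j {}l.
  move=> jl; have -> : j = 0%N by lia.
  have -> : l = 0%N by lia.
  by rewrite q0 mulr1 divr1.
case: j => [|j] jl; first by rewrite gbin0 -jl q0 mul1r divff // qfact_neq0.
case: l jl => [|l] jl.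
  have mj : m = j by lia.
  subst m; rewrite /= gbin_small // add0r subnn expr0 mul1r (IH j 0%N) ?addn0 // q0 !mulr1.
  by rewrite !divff ?qfact_neq0.
rewrite /= (IH j.+1 l) ?(IH j l.+1); [|lia|lia].
have -> : (m - j = l.+1)%N by lia.
have mE : p ^+ m.+1 = p ^+ j.+1 * p ^+ l.+1 by rewrite -exprD; congr (_ ^+ _); lia.
rewrite (qfactS m) (qfactS j) (qfactS l) mE.
have := qfact_neq0 j; have := qfact_neq0 l; have := unit_root j; have := unit_root l.
move: (p ^+ j.+1) (p ^+ l.+1) (qfact j) (qfact l) (qfact m) => x y a b c *.
by field; apply/and4P; split.
Qed.

End GaussianBinomial.

(** * From the finite triple product to the theta series *)

Section Jacobi.
Variable R : realType.
Local Notation C := (R[i]).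
Local Notation nrm := (@Normc.normc R).
Variable p : C.
Hypotheses (p1 : nrm p < 1) (p0 : p != 0).
Local Notation r := (nrm p).
Local Notation E := (Etheta p).

Let r01 : 0 <= r < 1. Proof. by rewrite nrm_ge0. Qed.
Let r0 : 0 < r. Proof. exact: nrm_gt0. Qed.

Definition gterm (e : int -> nat) (y : C) (n : int) : C := p ^+ e n * y ^ n.

(** Consecutive terms have ratio A r^k, which is at most 1 from some N on; the first N + 1 terms are
    bounded by their sum. *)
Lemma gauss_dominated (A : R) : 0 <= A -> exists2 K, 0 <= K &
  forall k, r ^+ 'C(k, 2) * A ^+ k <= K.
Proof.
move=> A0; have [N HN] := geo_small A r01 (@ltr01 R).
pose t k := r ^+ 'C(k, 2) * A ^+ k.
have t0 k : 0 <= t k by rewrite mulr_ge0 ?exprn_ge0 ?nrm_ge0.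
exists (\sum_(k < N.+1) t k); first by apply: sumr_ge0 => k _.
have small k : (k <= N)%N -> t k <= \sum_(k < N.+1) t k.
  rewrite -ltnS => kN; rewrite (bigD1 (Ordinal kN)) //= lerDl.
  by apply: sumr_ge0 => i _.
move=> k; rewrite -/(t k); case: (leqP k N) => [/small //|Nk].
rewrite -(subnKC (ltnW Nk)); elim: (k - N)%N => [|l IH]; first by rewrite addn0 small.
apply: le_trans IH; rewrite addnS /t binS bin1 exprD exprS.
have h : A * r ^+ (N + l) <= 1 by rewrite ltW // HN // leq_addr.
have := ler_wpM2l (t0 (N + l)%N) h; rewrite /t; lra.
Qed.

Lemma nrm_exprz (y : C) (n : int) : y != 0 ->
  nrm (y ^ n) <= (nrm y + (nrm y)^-1) ^+ `|n|.
Proof.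
move=> y0; have y0' := nrm_gt0 y0; have yi : 0 < (nrm y)^-1 by rewrite invr_gt0.
have A0 : 0 <= nrm y + (nrm y)^-1 by lra.
case: n => n.
  rewrite -exprnP nrmX lerXn2r ?nnegrE ?nrm_ge0 //; lra.
rewrite NegzE -exprnN Normc.normcV nrmX -exprVn abszN /=.
rewrite lerXn2r ?nnegrE //; lra.
Qed.

(** Quadratic exponents beat every geometric rate, so s > 0 is free; r/2, 1/2 and 1/4 are used
    later. *)
Lemma gterm_dominated e y (s : R) : (forall n, ('C(`|n|, 2) <= e n)%N) -> y != 0 -> 0 < s ->
  exists2 K, 0 <= K & forall n, nrm (gterm e y n) <= K * s ^+ `|n|.
Proof.
move=> en y0 s0; have y0' := nrm_gt0 y0; have yi : 0 < (nrm y)^-1 by rewrite invr_gt0.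
pose A := (nrm y + (nrm y)^-1) / s.
have A0 : 0 <= A by rewrite divr_ge0 // ltW // addr_gt0.
have [K K0 HK] := gauss_dominated A0; exists K => // n.
apply: (@le_trans _ _ (r ^+ 'C(`|n|, 2) * A ^+ `|n| * s ^+ `|n|)); last first.
  by rewrite ler_wpM2r ?exprn_ge0 // ltW.
rewrite -mulrA -exprMn divfK ?gt_eqF // /gterm Normc.normcM.
apply: ler_pM; rewrite ?nrm_ge0 ?nrm_exprz // nrmX.
by apply: ler_wiXn2l => //; exact: ltW.
Qed.

(** The number n(n-1)/2 for every integer n; [Negz k] is -(k+1), whence k+2. *)
Definition tri (n : int) : nat := match n with Posz k => 'C(k, 2) | Negz k => 'C(k.+2, 2) end.

Lemma triE n : (tri n)%:Z * 2 = n * (n - 1).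
Proof.
have H k : ('C(k.+1, 2))%:Z * 2 = k.+1%:Z * k%:Z.
  by elim: k => [|k IH] //; rewrite binS bin1; lia.
case: n => [[|k]|k] /=; first by rewrite bin0n.
  by rewrite H; lia.
by rewrite H NegzE; lia.
Qed.

Lemma triD t n : (tri (t + n))%:Z = (tri t)%:Z + (tri n)%:Z + t * n.
Proof.
have e : (t + n) * (t + n - 1) = t * (t - 1) + n * (n - 1) + (t * n) * 2 by ring.
have := triE (t + n); rewrite e -(triE t) -(triE n); lia.
Qed.

Lemma triN2 j : (tri (- j))%:Z * 2 = j * j + j.
Proof. by rewrite triE; ring. Qed.

Lemma tri_double j : (tri (2 * j))%:Z = 2 * (j * j) - j.
Proof.
have e : 2 * j * (2 * j - 1) = (2 * (j * j) - j) * 2 by ring.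
by have := triE (2 * j); rewrite e; lia.
Qed.

Lemma absz_sq (j : int) : (`|j| * `|j|)%:Z = j * j.
Proof. by rewrite PoszM !abszE -normrM ger0_norm // -expr2 sqr_ge0. Qed.

Lemma tri_ge n : ('C(`|n|, 2) <= tri n)%N.
Proof.
by case: n => k //=; rewrite [leqRHS]binS leq_addr.
Qed.

Lemma exprz_eq (m n : int) : m = n -> p ^ m = p ^ n. Proof. by move=> ->. Qed.

Definition theta_term (x : C) := gterm tri (- x).

Let unit_root k : 1 - p ^+ k.+1 != 0.
Proof.
rewrite subr_eq0; apply/negP => /eqP H.
have : nrm (p ^+ k.+1) < 1 by rewrite nrmX exprn_ilt1 ?nrm_ge0.
by rewrite -H Normc.normc1 ltxx.
Qed.

Lemma sum_sym (g : int -> C) N :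
  \sum_(j < (2 * N).+1) g (j%:Z - N%:Z) = bsum g N.
Proof.
elim: N g => [|N IH] g; first by rewrite big_ord1 bsum0 subrr.
have -> : (2 * N.+1 = (2 * N).+2)%N by lia.
rewrite big_ord_recl big_ord_recr /= bsumS -IH.
have -> : 0%:Z - N.+1%:Z = Negz N by lia.
have -> : (bump 0 (2 * N).+1)%:Z - N.+1%:Z = Posz N.+1 by rewrite /bump; lia.
rewrite addrA addrAC [in RHS]addrC -!addrA addrCA; congr (_ + (_ + _)).
by apply: eq_bigr => i _; congr g; rewrite /bump /=; lia.
Qed.

Definition theta_coef N (n : int) : C := gbin p (2 * N) `|n + N%:Z|.

(** The finite triple product: pulling -x/p^(i+1) out of each factor 1 - p^(i+1)/x joins both halves
    into one product of 2N factors starting at x/p^N, which the q-binomial theorem expands. *)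
Lemma theta_prod_bsum x N : x != 0 ->
  theta_prod p x N = bsum (fun n => theta_coef N n * theta_term x n) N.
Proof.
move=> x0; have mx0 : - x != 0 by rewrite oppr_eq0.
have -> : theta_prod p x N = (- x) ^ (- N%:Z) * p ^+ 'C(N.+1, 2)
    * \prod_(k < 2 * N) (1 - x / p ^+ N * p ^+ k).
  rewrite mul2n -addnn big_split_ord /=.
  have -> : \prod_(i < N) (1 - x / p ^+ N * p ^+ (N + i)) = \prod_(i < N) (1 - x * p ^+ i).
    by apply: eq_bigr => i _; rewrite exprD mulrA divfK // expf_neq0.
  rewrite (reindex_inj rev_ord_inj) /=.
  have -> : \prod_(i < N) (1 - x / p ^+ N * p ^+ (N - i.+1)) =
      \prod_(i < N) ((- x) / p ^+ i.+1) * \prod_(i < N) (1 - p ^+ i.+1 / x).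
    rewrite -big_split; apply: eq_bigr => i _ /=.
    have pE : p ^+ N = p ^+ (N - i.+1) * p ^+ i.+1 by rewrite -exprD subnK.
    rewrite pE; field; rewrite x0 !expf_neq0 //.
  have -> : \prod_(i < N) ((- x) / p ^+ i.+1) = (- x) ^+ N / p ^+ 'C(N.+1, 2).
    elim: (N) => [|M IHM]; first by rewrite big_ord0 !expr0 divr1.
    rewrite big_ord_recr /= IHM [in RHS]binS bin1 exprD [in RHS]exprSr.
    by field; rewrite !expf_neq0.
  rewrite /theta_prod big_split /= -exprnN.
  by field; rewrite !expf_neq0.
rewrite gbin_prod mulr_sumr -[RHS](sum_sym _ N); apply: eq_bigr => j _.
rewrite /theta_coef /theta_term /gterm subrK absz_nat.
have -> : (- (x / p ^+ N)) ^+ j = (- x) ^ j%:Z * p ^ (- (N%:Z * j%:Z)).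
  by rewrite -mulNr exprMn exprVn -exprM -PoszM -exprnN exprnP.
rewrite expfzDr //.
have pE : p ^+ tri (j%:Z - N%:Z) = p ^+ 'C(N.+1, 2) * p ^+ 'C(j, 2) * p ^ (- (N%:Z * j%:Z)).
  rewrite !exprnP -!expfzDr //; apply: exprz_eq.
  have h1 := triE (j%:Z - N%:Z); have h2 := triE (N.+1%:Z); have h3 := triE j%:Z.
  rewrite /= in h1 h2 h3; nia.
by rewrite pE; ring.
Qed.

Lemma rate_prod3 (u v w U V W : C) (B e : R) : 0 <= B -> 0 <= e ->
  nrm v <= B -> nrm w <= B -> nrm U <= B -> nrm V <= B ->
  nrm (U - u) <= e -> nrm (V - v) <= e -> nrm (W - w) <= e ->
  nrm (u * v * w - U * V * W) <= 3 * B ^+ 2 * e.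
Proof.
move=> B0 e0 vB wB UB VB uU vV wW.
have -> : u * v * w - U * V * W =
  - ((U - u) * (v * w)) + (- (U * (V - v) * w) + - (U * V * (W - w))) by ring.
rewrite (le_trans (le_normcD _ _)) //.
have -> : 3 * B ^+ 2 * e = e * (B * B) + (B * e * B + B * B * e) by ring.
apply: lerD; first by rewrite normcN !Normc.normcM !ler_pM ?mulr_ge0 ?nrm_ge0.
apply: (le_trans (le_normcD _ _)); rewrite !normcN !Normc.normcM.
by apply: lerD; rewrite !ler_pM ?mulr_ge0 ?nrm_ge0.
Qed.

Lemma absz_split (N : nat) (n : int) : (`|n| <= N)%N -> exists j l : nat,
  [/\ absz (n + N%:Z) = j, (j + l = 2 * N)%N, (N - `|n| <= j)%N & (N - `|n| <= l)%N].
Proof.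
move=> nN; case: n nN => k kN.
  by exists (N + k)%N, (N - k)%N; rewrite /= in kN *; split=> //=; lia.
rewrite /= in kN; exists (N - k.+1)%N, (N + k.+1)%N; split=> //=; lia.
Qed.

(** The coefficient is (p;p)_(2N) / ((p;p)_(N+n) (p;p)_(N-n)), so its limit does not depend on n.
    The error r^(N-|n|) is uniform enough to pass to the limit under the sum. *)
Lemma theta_coef_rate : exists ka K, 0 <= K /\
  forall N n, (`|n| <= N)%N -> nrm (theta_coef N n - ka) <= K * r ^+ (N - `|n|).
Proof.
have [U [_ UP]] := prod_geo (a := fun k => - p ^+ k.+1) ler01 r01
  (fun k => ltac:(rewrite normcN mul1r; exact: nrmXp_le)).
(* Chosen so that 1 + b_k = 1/(1 - p^(k+1)): U and V are the limits of (p;p)_N and of its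
   inverse. *)
pose b k := p ^+ k.+1 / (1 - p ^+ k.+1).
have r1 : 0 < 1 - r by rewrite subr_gt0.
have bK k : nrm (b k) <= (1 - r)^-1 * r ^+ k.
  have h0 := nrmXp_le p1 (leqnSn k).
  have h1 : 1 - r <= nrm (1 - p ^+ k.+1).
    have := le_normcD (1 - p ^+ k.+1) (p ^+ k.+1); rewrite subrK Normc.normc1.
    have : nrm (p ^+ k.+1) <= r by rewrite -[leRHS]expr1; apply: nrmXp_le.
    lra.
  rewrite /b Normc.normcM Normc.normcV mulrC.
  by apply: ler_pM; rewrite ?invr_ge0 ?nrm_ge0 // lef_pV2 // posrE (lt_le_trans r1).
have b0 : 0 <= (1 - r)^-1 by rewrite invr_ge0 ltW.
have [V [_ VP]] := prod_geo b0 r01 bK.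
set KU := (X in forall N, _ <= X * _) in UP; set KV := (X in forall N, _ <= X * _) in VP.
have uE N : \prod_(k < N) (1 + - p ^+ k.+1) = qfact p N by [].
have vE N : \prod_(k < N) (1 + b k) = (qfact p N)^-1.
  rewrite /qfact -prodfV; apply: eq_bigr => k _; rewrite /b.
  by field; exact: unit_root.
have KU0 : 0 <= KU by have := le_trans (nrm_ge0 _) (UP 0%N); rewrite expr0 mulr1.
have KV0 : 0 <= KV by have := le_trans (nrm_ge0 _) (VP 0%N); rewrite expr0 mulr1.
pose B := nrm U + nrm V + KV; pose K := KU + KV.
have B0 : 0 <= B by rewrite !addr_ge0 ?nrm_ge0.
have K0 : 0 <= K by rewrite addr_ge0.
have [U0 V0] := (nrm_ge0 U, nrm_ge0 V).
have vB k : nrm (qfact p k)^-1 <= B.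
  have := VP k; rewrite vE.
  have : KV * r ^+ k <= KV by rewrite ler_piMr // exprn_ile1 // ltW.
  have := le_normcD V (- (V - (qfact p k)^-1)); rewrite normcN opprB addrC subrK /B.
  lra.
have rr k l : (l <= k)%N -> r ^+ k <= r ^+ l.
  by move=> lk; apply: ler_wiXn2l => //; exact: ltW.
exists (U * V * V), (3 * B ^+ 2 * K); split; first by rewrite !mulr_ge0 ?exprn_ge0.
move=> N n nN.
have [j [l [jE lE jN lN]]] := absz_split nN.
rewrite /theta_coef jE -lE gbinE // invfM mulrA -[leRHS]mulrA.
have e0 : 0 <= K * r ^+ (N - `|n|) by rewrite mulr_ge0 ?exprn_ge0 ?nrm_ge0.
have UB : nrm U <= B by rewrite /B; lra.
have VB : nrm V <= B by rewrite /B; lra.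
have h m : (N - `|n| <= m)%N -> nrm (V - (qfact p m)^-1) <= K * r ^+ (N - `|n|).
  move=> Nm; rewrite -vE; apply: (le_trans (VP m)).
  by apply: ler_pM => //; [rewrite exprn_ge0 // nrm_ge0|rewrite /K; lra|exact: rr].
apply: (rate_prod3 B0 e0) => //; [|exact: h|exact: h].
rewrite -uE; apply: (le_trans (UP (j + l)%N)).
apply: ler_pM => //; [by rewrite exprn_ge0 // nrm_ge0|by rewrite /K; lra|].
by apply: rr; apply: leq_trans jN (leq_addr _ _).
Qed.

Lemma theta_term_dominated x (s : R) : x != 0 -> 0 < s ->
  exists2 K, 0 <= K & forall n, nrm (theta_term x n) <= K * s ^+ `|n|.
Proof. by move=> x0 s0; apply: gterm_dominated => //; [exact: tri_ge|rewrite oppr_eq0]. Qed.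

Lemma jacobi_triple : exists ka, forall x, x != 0 -> E x = ka * bilim (theta_term x).
Proof.
have [ka [K1 [K10 H1]]] := theta_coef_rate; exists ka => x x0.
(* With terms decaying like (r/2)^|n|, the error r^(N-|n|) (r/2)^|n| is r^N 2^(-|n|), whose sum over
   n is of order r^N. *)
have r2 : 0 < r / 2 by rewrite divr_gt0.
have r2' : 0 <= r / 2 < 1 by rewrite ltW //=; have := p1; lra.
have [K2 K20 H2] := theta_term_dominated x0 r2.
have [ul _] := bilimP r2' H2.
have kul : tends (fun N => ka * bsum (theta_term x) N) (ka * bilim (theta_term x)).
  exact: tendsM (tends_cst ka) ul.
apply: tends_uniq (Etheta_tends p1 x0) _.
apply: (@tends_geo_trans _ _ _ _ (2 * (K1 * K2) / (1 - 1 / 2)) r r01 _ kul) => N.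
rewrite nrm_distrC theta_prod_bsum // bsumZ bsumB.
have -> : 2 * (K1 * K2) / (1 - 1 / 2) * r ^+ N = 2 * (K1 * K2 * r ^+ N) / (1 - 1 / 2) by ring.
apply: bsum_le => [|n nN]; first lra.
rewrite -mulrBl Normc.normcM.
apply: (@le_trans _ _ (K1 * r ^+ (N - `|n|) * (K2 * (r / 2) ^+ `|n|))).
  by apply: ler_pM; rewrite ?nrm_ge0 ?H1.
have -> : r ^+ N = r ^+ (N - `|n|) * r ^+ `|n| by rewrite -exprD subnK.
by rewrite exprMn div1r le_eqVlt; apply/orP; left; apply/eqP; ring.
Qed.

(** * Products of two theta series *)

Lemma absz_shear (t n : int) : (absz t + absz n <= 2 * absz (t + n)%R + 2 * absz n)%N.
Proof. lia. Qed.

Lemma bin2_le_sq k : ('C(k, 2) <= k * k)%N.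
Proof. by elim: k => [|k IH] //; rewrite binS bin1; nia. Qed.

(** Theta series in base p^2, with exponents j^2 here and j^2 + j in [odd_basis]: the contributions
    of even and odd index differences to the product of two series in base p. *)
Definition even_basis (m d : C) := bilim (gterm (fun j => `|j| * `|j|)%N (d ^+ 2 / m)).
Definition odd_basis (m d : C) := d * bilim (gterm (fun j => 2 * tri (- j))%N (d ^+ 2 / m)).

Local Opaque bilim Etheta.

(** The double series is summed along the index difference t. The inner sum f t involves only p^t
    s^2 m, and f (t + 2j) is an explicit multiple of f t, so only f 0 and f 1 remain as
    coefficients; s then drops out of the two sums over j. *)
Lemma theta_span m s d ka : m != 0 -> s != 0 -> d != 0 ->
  (forall x, x != 0 -> E x = ka * bilim (theta_term x)) ->
  E (s * d) * E (s * m / d) =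
  ka ^+ 2 * bilim (gterm (fun n => 2 * tri n)%N (s ^+ 2 * m)) * even_basis m d
  + - (ka ^+ 2 * s * bilim (gterm (fun n => 2 * tri n)%N (p * (s ^+ 2 * m)))) * odd_basis m d.
Proof.
move=> m0 s0 d0 EE.
have x0 : s * d != 0 by rewrite mulf_neq0.
have y0 : s * m / d != 0 by rewrite !mulf_neq0 ?invr_neq0.
have w0 : s ^+ 2 * m != 0 by rewrite mulf_neq0 ?expf_neq0.
have z0 : d ^+ 2 / m != 0 by rewrite mulf_neq0 ?invr_neq0 ?expf_neq0.
have px n : p ^ n != 0 by rewrite expfz_neq0.
pose si : R := 1 / 2.
have si01 : 0 < si < 1 by rewrite /si; lra.
have si01' : 0 <= si < 1 by rewrite /si; lra.
have si0 : 0 < si by rewrite /si; lra.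
(* Each series is dominated at the squared rate, because the change of indices to (t, n) costs the
   factor 2 of [absz_shear]. *)
have si4 : 0 < si ^+ 2 by rewrite exprn_gt0.
have si40 : 0 <= si ^+ 2 < 1 by rewrite /si; lra.
rewrite (EE _ x0) (EE _ y0).
have [K1 K10 H1] := theta_term_dominated x0 si4.
have [K2 K20 H2] := theta_term_dominated y0 si4.
have H1' := fun n => H1 n.
pose f t := gterm (fun n => 2 * tri n)%N (p ^ t * (s ^+ 2 * m)).
have fd t : exists2 K, 0 <= K & forall n, nrm (f t n) <= K * si ^+ `|n|.
  apply: gterm_dominated => //; last by rewrite mulf_neq0.
  by move=> n; rewrite (leq_trans (tri_ge n)) // leq_pmull.
have TT t n : theta_term (s * d) (t + n) * theta_term (s * m / d) n = theta_term (s * d) t * f t n.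
  rewrite /f /theta_term /gterm.
  have mx0 : - (s * d) != 0 by rewrite oppr_eq0.
  rewrite expfzDr //.
  have -> : (p ^ t * (s ^+ 2 * m)) ^ n = p ^ (t * n) * ((- (s * d)) ^ n * (- (s * m / d)) ^ n).
    rewrite expfzMl -exprz_exp; congr (_ * _); rewrite -expfzMl; congr (_ ^ _).
    by field.
  have pE : p ^+ tri (t + n) * p ^+ tri n = p ^+ tri t * (p ^+ (2 * tri n) * p ^ (t * n)).
    rewrite !exprnP -!expfzDr //; apply: exprz_eq.
    by rewrite triD PoszM; ring.
  transitivity (p ^+ tri (t + n) * p ^+ tri n *
    ((- (s * d)) ^ t * ((- (s * d)) ^ n * (- (s * m / d)) ^ n))); first by ring.
  by rewrite pE; ring.
have GK t n : nrm (theta_term (s * d) (t + n) * theta_term (s * m / d) n)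
    <= K1 * K2 * si ^+ `|t| * si ^+ `|n|.
  rewrite Normc.normcM; apply: (le_trans (ler_pM _ _ (H1 _) (H2 _))); rewrite ?nrm_ge0 //.
  rewrite mulrACA -[leRHS]mulrA ler_wpM2l ?mulr_ge0 // -!exprM -!exprD.
  by apply: ler_wiXn2l; [exact: ltW|rewrite /si; lra|exact: absz_shear].
have step1 : bilim (theta_term (s * d)) * bilim (theta_term (s * m / d)) =
    bilim (fun t => theta_term (s * d) t * bilim (f t)).
  transitivity (bilim (fun n => bilim (fun t => theta_term (s * d) (t + n) * theta_term (s * m / d) n))).
    rewrite -(bilimZ _ si40 H2); apply: eq_bilim => n.
    have si4' : 0 < si ^+ 2 < 1 by rewrite si4; case/andP: si40.
    rewrite -(bilim_shift n si4' H1) mulrC.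
    rewrite -(bilimZ _ si40 (dominated_shift n si4' H1)).
    by apply: eq_bilim => t; rewrite mulrC.
  rewrite (bilim_fubini si01' GK); apply: eq_bilim => t.
  have [K _ H] := fd t; rewrite -(bilimZ _ si01' H).
  by apply: eq_bilim => n; rewrite TT.
(* Replacing n by n - j absorbs the factor p^(2jn) into the quadratic exponent 2 [tri] n. *)
have fshift t j : bilim (f (t + 2 * j)) = p ^ (- (j * j) + j - j * t) * (s ^+ 2 * m) ^ (- j) * bilim (f t).
  have [K _ H] := fd (t + 2 * j); rewrite -(bilim_shift (- j) si01 H).
  have [K' _ H'] := fd t; rewrite -(bilimZ _ si01' H').
  apply: eq_bilim => n; rewrite /f /gterm [(p ^ (t + _) * _) ^ _]expfzMl [(p ^ t * _) ^ _]expfzMl.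
  rewrite !exprz_exp [(s ^+ 2 * m) ^ (n - j)]expfzDr //.
  have pE : p ^+ (2 * tri (n - j)) * p ^ ((t + 2 * j) * (n - j)) =
      p ^ (- (j * j) + j - j * t) * (p ^+ (2 * tri n) * p ^ (t * n)).
    rewrite !exprnP -!expfzDr //; apply: exprz_eq.
    have e : (tri (- j))%:Z * 2 = j * j + j := triN2 j.
    rewrite !PoszM triD mulrDr mulrDr [2%:Z * (tri (- j))%:Z]mulrC e; ring.
  transitivity (p ^+ (2 * tri (n - j)) * p ^ ((t + 2 * j) * (n - j))
    * ((s ^+ 2 * m) ^ n * (s ^+ 2 * m) ^ (- j))); first by ring.
  by rewrite pE; ring.
have [K3 K30 H3] : exists2 K, 0 <= K & forall n, nrm (theta_term (s * d) n * bilim (f n)) <= K * si ^+ `|n|.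
  exists (2 * (K1 * K2) / (1 - si)) => [|n].
    by rewrite divr_ge0 ?mulr_ge0 // /si; lra.
  have [K _ H] := fd n; rewrite -(bilimZ _ si01' H).
  have := @bilim_le _ _ (K1 * K2 * si ^+ `|n|) si si01' (GK n).
  rewrite (@eq_bilim _ _ (fun k => theta_term (s * d) n * f n k)); last by move=> k; rewrite TT.
  by move=> /le_trans; apply; rewrite le_eqVlt; apply/orP; left; apply/eqP; ring.
have kaM (x y : C) : ka * x * (ka * y) = ka ^+ 2 * (x * y) by rewrite expr2 mulrACA.
transitivity (ka ^+ 2 * bilim (fun t => theta_term (s * d) t * bilim (f t))).
  by rewrite -step1; exact: kaM.
have -> := bilim_parity si01 H3.
rewrite mulrDr.
have sdz j : (- (s * d)) ^ (2 * j) * (s ^+ 2 * m) ^ (- j) = (d ^+ 2 / m) ^ j.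
  rewrite -exprz_exp -exprz_inv -expfzMl; congr (_ ^ _).
  by rewrite -exprnP; field; rewrite m0 s0.
congr (_ + _).
  have [K K0 H] : exists2 K, 0 <= K & forall n, nrm (gterm (fun j => `|j| * `|j|)%N (d ^+ 2 / m) n) <= K * si ^+ `|n|.
    apply: gterm_dominated => // n; exact: bin2_le_sq.
  rewrite -mulrA /even_basis; congr (_ * _); rewrite -(bilimZ _ si01' H).
  apply: eq_bilim => j; have := fshift 0 j; rewrite add0r => ->.
  have -> : bilim (f 0) = bilim (gterm (fun n => 2 * tri n)%N (s ^+ 2 * m)).
    by rewrite /f expr0z mul1r.
  rewrite /theta_term /gterm -sdz.
  have -> : p ^+ (`|j| * `|j|)%N = p ^+ tri (2 * j) * p ^ (- (j * j) + j - j * 0).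
    rewrite !exprnP -!expfzDr //; apply: exprz_eq.
    by rewrite absz_sq tri_double; ring.
  by ring.
have [K K0 H] : exists2 K, 0 <= K & forall n, nrm (gterm (fun j => 2 * tri (- j))%N (d ^+ 2 / m) n) <= K * si ^+ `|n|.
  apply: gterm_dominated => // n.
  by rewrite -abszN (leq_trans (tri_ge _)) // leq_pmull.
have B1 : bilim (f 1) = bilim (gterm (fun n => 2 * tri n)%N (p * (s ^+ 2 * m))).
  by rewrite /f expr1z.
set H1s := bilim (gterm _ (p * _)); rewrite /odd_basis.
set H2s := bilim (gterm (fun j => 2 * tri (- j))%N _).
suff -> : bilim (fun j => theta_term (s * d) (2 * j + 1) * bilim (f (2 * j + 1))) =
    - (s * H1s) * d * H2s by ring.
rewrite /H2s -(bilimZ _ si01' H).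
apply: eq_bilim => j; have := fshift 1 j; rewrite [1 + _]addrC => ->.
have {}B1 : bilim (f 1) = H1s := B1.
rewrite B1; move: H1s {B1} => H1s.
rewrite /theta_term /gterm -sdz expfzDr ?oppr_eq0 // expr1z.
have -> : p ^+ (2 * tri (- j)) = p ^+ tri (2 * j + 1) * p ^ (- (j * j) + j - j * 1).
  rewrite !exprnP -!expfzDr //; apply: exprz_eq.
  by rewrite PoszM mulrC triN2 triD tri_double (_ : tri 1 = 0%N) //; ring.
by ring.
Qed.


End Jacobi.

Lemma Etheta_span (R : realType) (p m : R[i]) : Normc.normc p < 1 -> m != 0 ->
  exists u v : R[i] -> R[i], forall s, s != 0 -> exists al be, forall x, x != 0 ->
    Etheta p (s * x) * Etheta p (s * m / x) = al * u x + be * v x.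
Proof.
(* The series argument uses negative powers of p. For p = 0, E(x) = 1 - x and the space is spanned
   by 1 and x + m/x. *)
move=> p1 m0; have [p0|p0] := eqVneq p 0.
  have E0 x : x != 0 -> Etheta p x = 1 - x.
    move=> x0; apply: tends_uniq (Etheta_tends p1 x0) _.
    apply: tends_ext_S (tends_cst (1 - x)) => N.
    rewrite /theta_prod big_ord_recl big1 /= ?p0 => [|i _]; rewrite !expr0n /=.
      by rewrite mul0r subr0 !mulr1.
    by rewrite mulr0 mul0r subr0 mulr1.
  exists (fun=> 1), (fun x => x + m / x) => s s0.
  exists (1 + s ^+ 2 * m), (- s) => x x0.
  by rewrite !E0 ?mulf_neq0 ?invr_neq0 //; field.
have [ka EE] := jacobi_triple p1 p0.
exists (even_basis p m), (odd_basis p m) => s s0.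
exists (ka ^+ 2 * bilim (gterm p (fun n => 2 * tri n)%N (s ^+ 2 * m))),
  (- (ka ^+ 2 * s * bilim (gterm p (fun n => 2 * tri n)%N (p * (s ^+ 2 * m))))) => x x0.
exact: theta_span.
Qed.

(** * Perturbation to generic parameters *)

Section Perturbation.
Variable R : realType.
Local Notation C := (R[i]).
Local Notation nrm := (@Normc.normc R).

Lemma pow_ratio_inj (x y : R) j1 j2 : 0 < x -> 0 < y -> j1 != j2 ->
  x ^+ j1 * y ^+ j2 = y ^+ j1 * x ^+ j2 -> x = y.
Proof.
move=> x0 y0; wlog j12 : j1 j2 / (j1 < j2)%N.
  move=> W j12 H; have [j|j|j] := ltngtP j1 j2; last by rewrite j eqxx in j12.
    exact: (W j1 j2).
  by apply: (W j2 j1) => //; [rewrite eq_sym|rewrite mulrC -H mulrC].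
move=> _ H; have [l lE] : exists l, j2 = (j1 + l.+1)%N by exists (j2 - j1.+1)%N; lia.
move: H; rewrite lE !exprD => H.
have : y ^+ l.+1 = x ^+ l.+1.
  have xy : x ^+ j1 * y ^+ j1 != 0 by rewrite mulf_neq0 // expf_neq0 // gt_eqF.
  by apply: (mulfI xy); rewrite -mulrA H; ring.
by move=> /(pexpIrn (ltn0Sn l)); rewrite !nnegrE !ltW // => /(_ isT isT).
Qed.

(** Each of the countably many relations holds for at most one scale s, while the interval from 1 to
    1 + e has positive measure. *)
Lemma avoid_powers (T : countType) (w : T -> R) (B e : R) : 0 < B -> 0 < e ->
  exists s, [/\ 1 < s, s < 1 + e & forall t j1 j2, j1 != j2 ->
    (B * s) ^+ j1 != w t * (B * s) ^+ j2].
Proof.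
move=> B0 e0.
pose bad (t : T * nat * nat) : set R := [set s | [/\ 1 < s, t.1.2 != t.2 &
  (B * s) ^+ t.1.2 = w t.1.1 * (B * s) ^+ t.2]]%classic.
have bad1 t : countable (bad t).
  apply: finite_set_countable.
  have [->|/set0P[s0 [h1 h2 h3]]] := eqVneq (bad t) set0; first exact: finite_set0.
  apply: (@sub_finite_set _ _ [set s0]%classic); last exact: finite_set1.
  move=> s [g1 g2 g3] /=; apply: (mulfI (lt0r_neq0 B0)).
  have p1 : 0 < B * s by rewrite mulr_gt0 // (lt_trans ltr01).
  have p2 : 0 < B * s0 by rewrite mulr_gt0 // (lt_trans ltr01).
  by apply: (pow_ratio_inj p1 p2 h2); rewrite g3 h3; ring.
have badU : countable (\bigcup_t bad t)%classic.
  by apply: bigcup_countable => //; exact: countableP.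
apply: contrapT => H.
have sub : ([set` `]1, (1 + e)[%R] `<=` \bigcup_t bad t)%classic.
  move=> s /=; rewrite in_itv /= => /andP[s1 s2]; apply: contrapT => nb; apply: H.
  exists s; split=> // t j1 j2 j12; apply/eqP => E; apply: nb.
  by exists (t, j1, j2).
have := countable_lebesgue_measure0 (sub_countable (subset_card_le sub) badU).
rewrite lebesgue_measure_itv /= lte_fin ltrDl e0 -EFinD => -[].
by move/eqP; rewrite addrAC subrr add0r gt_eqF.
Qed.

(** Scaling b by a real factor is enough: a forbidden relation would already hold between moduli. *)
Lemma perturb (T : countType) (w : T -> C) (b : C) (e : R) : b != 0 -> 0 < e ->
  exists b', [/\ b' != 0, nrm (b - b') <= nrm b * e & forall t j1 j2, j1 != j2 ->
    b' ^+ j1 != w t * b' ^+ j2].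
Proof.
move=> b0 e0; have bp := nrm_gt0 b0.
have [s [s1 se H]] := avoid_powers (fun t => nrm (w t)) bp e0.
have s0 : 0 < s by exact: lt_trans s1.
have nrms (x : R) : nrm x%:C = `|x| by rewrite /= expr0n addr0 sqrtr_sqr.
exists (b * s%:C); split.
- by rewrite mulf_neq0 // -nrm_eq0 nrms gt_eqF // normr_gt0 gt_eqF.
- have -> : b - b * s%:C = b * (1 - s)%:C by rewrite rmorphB /=; ring.
  rewrite Normc.normcM nrms ler_wpM2l ?nrm_ge0 //.
  by rewrite ler_norml; lra.
move=> t j1 j2 j12; apply/eqP => /(congr1 nrm).
rewrite Normc.normcM !nrmX Normc.normcM nrms gtr0_norm // => /eqP.
by apply/negP; exact: H.
Qed.

Variable p : C.
Hypothesis p1 : nrm p < 1.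
Local Notation E := (Etheta p).

(** For p = 0 the spurious values are 0, which a nonzero argument avoids. *)
Definition theta_zero (t : nat * bool) : C := if t.2 then p ^+ t.1.+1 else (p ^+ t.1)^-1.

Lemma Etheta_neq0 x : x != 0 -> (forall t, x != theta_zero t) -> E x != 0.
Proof.
move=> x0 xz; apply/eqP => /(Etheta_eq0 p1 x0) [k [H|H]].
  have pk : p ^+ k != 0 by apply: contra_eq_neq H => ->; rewrite mulr0 eq_sym oner_neq0.
  by move/eqP: (xz (k, false)); apply; rewrite /theta_zero /= -[LHS](mulfK pk) H mul1r.
by move/eqP: (xz (k, true)); apply.
Qed.

(** The three choices are successive: b' avoids countably many values built from a', and c' those
    built from a' and b'. A relation is then excluded by the last of the three variables whose
    exponents differ. *)
Lemma generic_perturb (q a b c : C) (e : R) : q != 0 -> a != 0 -> b != 0 -> c != 0 -> 0 < e ->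
  exists abc : C * C * C, [/\ [/\ abc.1.1 != 0, abc.1.2 != 0 & abc.2 != 0],
    [/\ nrm (a - abc.1.1) <= nrm a * e, nrm (b - abc.1.2) <= nrm b * e &
        nrm (c - abc.2) <= nrm c * e] & generic3 E q abc.1.1 abc.1.2 abc.2].
Proof.
move=> q0 a0 b0 c0 e0.
have X0 (x : C) k : x != 0 -> x ^+ k != 0 by exact: expf_neq0.
have [a' [a0' aa' Ha]] := perturb (fun t : (nat * bool) * (nat * nat) =>
  theta_zero t.1 * q ^+ t.2.2 / q ^+ t.2.1) a0 e0.
have [b' [b0' bb' Hb]] := perturb (fun t : (nat * bool) * (nat * nat * nat * nat) =>
  let: (i1, l1, i2, l2) := t.2 in
  theta_zero t.1 * (a' ^+ i2 * q ^+ l2) / (a' ^+ i1 * q ^+ l1)) b0 e0.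
have [c' [c0' cc' Hc]] := perturb (fun t : (nat * bool) * (nat * nat * nat * nat * nat * nat) =>
  let: (i1, j1, l1, i2, j2, l2) := t.2 in
  theta_zero t.1 * (a' ^+ i2 * b' ^+ j2 * q ^+ l2) / (a' ^+ i1 * b' ^+ j1 * q ^+ l1)) c0 e0.
exists (a', b', c'); split=> //= i1 j1 k1 l1 i2 j2 k2 l2 ijk.
apply: Etheta_neq0.
  by rewrite !mulf_neq0 ?invr_neq0 ?mulf_neq0 ?X0.
move=> t; apply/negP => /eqP H.
have [A1 A2 B1 B2] := And4 (X0 a' i1 a0') (X0 a' i2 a0') (X0 b' j1 b0') (X0 b' j2 b0').
have [C1 C2 Q1 Q2] := And4 (X0 c' k1 c0') (X0 c' k2 c0') (X0 q l1 q0) (X0 q l2 q0).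
have {}H : a' ^+ i1 * b' ^+ j1 * c' ^+ k1 * q ^+ l1 =
    theta_zero t * (a' ^+ i2 * b' ^+ j2 * c' ^+ k2 * q ^+ l2).
  by rewrite -H divfK // !mulf_neq0.
case: (eqVneq k1 k2) => [k12|k12]; last first.
  move/eqP: (Hc (t, (i1, j1, l1, i2, j2, l2)) k1 k2 k12); apply.
  have D : a' ^+ i1 * b' ^+ j1 * q ^+ l1 != 0 by rewrite !mulf_neq0.
  apply: (mulfI D); rewrite /=.
  transitivity (a' ^+ i1 * b' ^+ j1 * c' ^+ k1 * q ^+ l1); first by ring.
  rewrite H.
  transitivity (theta_zero t * (a' ^+ i2 * b' ^+ j2 * q ^+ l2) / (a' ^+ i1 * b' ^+ j1 * q ^+ l1)
    * (a' ^+ i1 * b' ^+ j1 * q ^+ l1) * c' ^+ k2); last by ring.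
  by rewrite divfK //; ring.
case: (eqVneq j1 j2) => [j12|j12]; last first.
  move/eqP: (Hb (t, (i1, l1, i2, l2)) j1 j2 j12); apply.
  have D : a' ^+ i1 * q ^+ l1 != 0 by rewrite !mulf_neq0.
  apply: (mulfI D); apply: (mulIf C1); rewrite /=.
  transitivity (a' ^+ i1 * b' ^+ j1 * c' ^+ k1 * q ^+ l1); first by ring.
  rewrite H k12.
  transitivity (theta_zero t * (a' ^+ i2 * q ^+ l2) / (a' ^+ i1 * q ^+ l1) * (a' ^+ i1 * q ^+ l1)
    * b' ^+ j2 * c' ^+ k2); last by ring.
  by rewrite divfK //; ring.
case: (eqVneq i1 i2) => [i12|i12]; first by rewrite i12 j12 k12 eqxx in ijk.
move/eqP: (Ha (t, (l1, l2)) i1 i2 i12); apply.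
apply: (mulfI Q1); apply: (mulIf C1); apply: (mulIf B1); rewrite /=.
transitivity (a' ^+ i1 * b' ^+ j1 * c' ^+ k1 * q ^+ l1); first by ring.
rewrite H k12 j12.
transitivity (theta_zero t * q ^+ l2 / q ^+ l1 * q ^+ l1 * a' ^+ i2 * c' ^+ k2 * b' ^+ j2); last by ring.
by rewrite divfK //; ring.
Qed.

Lemma generic_sequence (q a b c : C) : q != 0 -> a != 0 -> b != 0 -> c != 0 ->
  exists u v w : nat -> C, [/\ tends u a, tends v b, tends w c &
    forall n, [/\ u n != 0, v n != 0, w n != 0 & generic3 E q (u n) (v n) (w n)]].
Proof.
move=> q0 a0 b0 c0.
have e0 n : 0 < (1 / 2 : R) ^+ n by rewrite exprn_gt0 // divr_gt0.
have [S HS] := choice (fun n => generic_perturb q0 a0 b0 c0 (e0 n)).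
have h : 0 <= (1 / 2 : R) < 1 by lra.
exists (fun n => (S n).1.1), (fun n => (S n).1.2), (fun n => (S n).2); split.
- by apply: (@tends_geo _ _ _ (nrm a) _ h) => n; have [_ []] := HS n.
- by apply: (@tends_geo _ _ _ (nrm b) _ h) => n; have [_ []] := HS n.
- by apply: (@tends_geo _ _ _ (nrm c) _ h) => n; have [_ []] := HS n.
- by move=> n; have [[? ? ?] _ ?] := HS n.
Qed.

End Perturbation.

Unset Implicit Arguments.

Theorem theorem4p3 (R : realType) (p q a b c d e f : R[i]) (n : nat) :
  `|p| < 1 -> q != 0 ->
  a != 0 -> b != 0 -> c != 0 -> d != 0 -> e != 0 ->
  b * c * d = a * q ->
  d * e = a ^+ 2 * q ^+ (3 * n + 1) ->
  (f = a / b \/ f = a / e) ->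
  (* genericity: no denominator vanishes *)
  Etheta p a != 0 ->
  (forall k : nat, (k <= n)%N ->
     [/\ epochs p (q ^+ 3) [:: a * q ^+ 3 / b; a * q ^+ 3 / c] k != 0,
         epoch p q (a * q / d) (2 * k)%N != 0 &
         epochs p q [:: a * q / e; a * q ^+ (3 * n + 1)] k != 0]) ->
  epochs p (q ^+ 3) [:: a ^+ 2 * q ^+ 3 / (b * e * f); a * f * q ^+ 3 / c;
                       a * q ^+ 3 / d; a ^+ 2 * q ^+ 3 / (b * c * d * e)] n != 0 ->
  Etheta p (a * f / c) != 0 ->
  (forall k : nat, (k <= n)%N ->
     epochs p (q ^+ 3)
       (q ^+ 3 :: [seq a * f / c * q ^+ 3 / ai
                  | ai <- [:: a / c; f * q ^+ 3 / c; b * e * f / a; d; d * q; f;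
                              q ^- (3 * n)]]) k != 0) ->
  \sum_(k < n.+1)
     Etheta p (a * q ^+ (4 * k)) / Etheta p a
     * epochs p q [:: b; c] k / epochs p (q ^+ 3) [:: a * q ^+ 3 / b; a * q ^+ 3 / c] k
     * epoch p q d (2 * k)%N / epoch p q (a * q / d) (2 * k)%N
     * epochs p (q ^+ 3) [:: e; q ^- (3 * n)] k
     / epochs p q [:: a * q / e; a * q ^+ (3 * n + 1)] k
     * q ^+ k
  = epochs p (q ^+ 3) [:: a * q ^+ 3; a ^+ 2 * q ^+ 3 / (b * c * e);
                         a ^+ 2 * q ^+ 3 / (b * d * e * f); a * f * q ^+ 3 / (c * d)] n
    / epochs p (q ^+ 3) [:: a ^+ 2 * q ^+ 3 / (b * e * f); a * f * q ^+ 3 / c;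
                           a * q ^+ 3 / d; a ^+ 2 * q ^+ 3 / (b * c * d * e)] n
    * omega p (q ^+ 3) (a * f / c)
        [:: a / c; f * q ^+ 3 / c; b * e * f / a; d; d * q; f; q ^- (3 * n)] n.
Proof.
move=> hp q0 a0 b0 c0 d0 e0 bcd de ff Ea den1 den2 EA den3.
have p1 : Normc.normc p < 1 by rewrite -ltcR; exact: hp.
exact: (@transformation_of_limits R[i] (Etheta p) (@tends R) (@tends_ext R) (@tends_cst R)
  (@tendsM R) (@tendsV R) (@tendsX R) (@tends_sum R) (@tends_prod R) (@Etheta_cont R p p1)
  q n q0 (Etheta1 p1) (EthetaV p1) (fun m => @Etheta_span R p m p1) (@tends_uniq R)
  (fun a b c => @generic_sequence R p p1 q a b c q0)
  a b c d e f a0 b0 c0 d0 e0 bcd de ff Ea den1 den2 EA den3).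
Qed.
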